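(* Assume the setting of the binary recovery problem (context), with $m=\alpha n$, $k=\beta n$, $0<\beta<\alpha\le 1$ fixed and $n\to\infty$. Then $$I^{(bin)}_{err}(\alpha,\beta):=\lim_{n\to\infty}\frac{\log P_{err}}{n}\le \min_{c_3\ge0}\Big(-\frac{c_3^2}{2}+I_{sph}+\min_{\nu\ge 0,\ \gamma> c_3/2}\big((1-\beta)\log w_1+\beta\log w_2+c_3\gamma\big)\Big)=:I^{(bin,ub)}_{err,u}(\alpha,\beta),$$ where $\hat\gamma=\frac{c_3-\sqrt{c_3^2+4\alpha}}{4}$, $I_{sph}=\hat\gamma c_3-\frac{\alpha}{2}\log\big(1-\frac{c_3}{2\hat\gamma}\big)$, and $$w_1=\tfrac12\Big(\tfrac{e^{\frac{c_3\nu^2/(4\gamma)}{1-c_3/(2\gamma)}}}{\sqrt{1-c_3/(2\gamma)}}\operatorname{erfc}\Big(\tfrac{\nu}{\sqrt2\sqrt{1-c_3/(2\gamma)}}\Big)+\operatorname{erf}\big(\tfrac{\nu}{\sqrt2}\big)+1\Big),\quad w_2=\tfrac12\Big(\tfrac{e^{\frac{c_3\nu^2/(4\gamma)}{1-c_3/(2\gamma)}}}{\sqrt{1-c_3/(2\gamma)}}\operatorname{erfc}\Big(\tfrac{-\nu}{\sqrt2\sqrt{1-c_3/(2\gamma)}}\Big)+\operatorname{erf}\big(\tfrac{-\nu}{\sqrt2}\big)+1\Big).$$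
   Context: Binary recovery problem: $A\in\mathbb{R}^{m\times n}$ has i.i.d. standard normal entries; $\tilde x\in\{0,1\}^n$ has exactly $k$ ones at arbitrary fixed positions; $y=A\tilde x$; the binary $\ell_1$ program is: minimize $\|x\|_1$ subject to $Ax=y$, $0\le x_i\le1$ for all $i$. $P_{err}$ is the probability that $\tilde x$ is not the (unique) solution of the binary $\ell_1$ program. $\operatorname{erf}(t)=\frac{2}{\sqrt\pi}\int_0^te^{-s^2}ds$, $\operatorname{erfc}=1-\operatorname{erf}$. *)

(* Defs.v *)
From HB Require Import structures.
From mathcomp Require Import all_boot all_order all_algebra.
From mathcomp Require Import all_classical all_reals all_analysis.
Set Implicit Arguments. Unset Strict Implicit. Unset Printing Implicit Defensive.
Import Order.TTheory GRing.Theory Num.Theory.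
Local Open Scope classical_set_scope.
Local Open Scope ring_scope.

Section defs.
Variable R : realType.
Notation mu := (@lebesgue_measure R).

Definition erf (t : R) : R :=
  2 / Num.sqrt pi *
  (if 0 <= t then Rintegral mu `[0, t] (fun s => expR (- s ^+ 2))
   else - Rintegral mu `[t, 0] (fun s => expR (- s ^+ 2))).
Definition erfc (t : R) : R := 1 - erf t.

Definition logE (x : \bar R) : \bar R :=
  match x with
  | EFin r => if r == 0 then -oo%E else (ln r)%:E
  | +oo%E => +oo%E
  | -oo%E => -oo%E
  end.

Definition xtilde n (S : {set 'I_n}) : 'cV[R]_n := \col_i (i \in S)%:R.

Definition l1norm n (x : 'cV[R]_n) : R := \sum_i `|x i 0|.

Definition feasible m n (A : 'M[R]_(m, n)) (y : 'cV[R]_m) (x : 'cV[R]_n) :=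
  A *m x = y /\ forall i, 0 <= x i 0 <= 1.

Definition recovery_fails m n (A : 'M[R]_(m, n)) (S : {set 'I_n}) : Prop :=
  ~ (feasible A (A *m xtilde S) (xtilde S) /\
     forall x, feasible A (A *m xtilde S) x -> x != xtilde S ->
       l1norm (xtilde S) < l1norm x).

Definition iid_std_normal d (T : measurableType d) (P : probability T R) m n
    (A : T -> 'M[R]_(m, n)) : Prop :=
  (forall i j, measurable_fun setT (fun t => A t i j)) /\
  (forall i j (B : set R), measurable B ->
     P ((fun t => A t i j) @^-1` B) = normal_prob 0 1 B) /\
  (forall B : 'I_m -> 'I_n -> set R, (forall i j, measurable (B i j)) ->
     P (\bigcap_(ij in [set: 'I_m * 'I_n]) ((fun t => A t ij.1 ij.2) @^-1` B ij.1 ij.2))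
     = (\prod_(i < m) \prod_(j < n) fine (P ((fun t => A t i j) @^-1` B i j)))%:E).

Definition gamma_hat (alpha c3 : R) : R := (c3 - Num.sqrt (c3 ^+ 2 + 4 * alpha)) / 4.

Definition I_sph (alpha c3 : R) : R :=
  gamma_hat alpha c3 * c3 - alpha / 2 * ln (1 - c3 / (2 * gamma_hat alpha c3)).

Definition w_gen (c3 nu gam : R) : R :=
  let q := 1 - c3 / (2 * gam) in
  (expR ((c3 * nu ^+ 2 / (4 * gam)) / q) / Num.sqrt q *
     erfc (nu / (Num.sqrt 2 * Num.sqrt q)) + erf (nu / Num.sqrt 2) + 1) / 2.
Definition w1 (c3 nu gam : R) : R := w_gen c3 nu gam.
Definition w2 (c3 nu gam : R) : R := w_gen c3 (- nu) gam.

Definition inner_obj (beta c3 nu gam : R) : R :=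
  (1 - beta) * ln (w1 c3 nu gam) + beta * ln (w2 c3 nu gam) + c3 * gam.

(* I^{(bin,ub)}_{err,u}(alpha,beta), with min read as infimum in \bar R *)
Definition I_bin_ub (alpha beta : R) : \bar R :=
  ereal_inf [set v : \bar R | exists c3 : R, 0 <= c3 /\
    v = adde (- c3 ^+ 2 / 2 + I_sph alpha c3)%:E
         (ereal_inf [set u : \bar R | exists nu gam : R, 0 <= nu /\ c3 / 2 < gam /\
                              u = (inner_obj beta c3 nu gam)%:E])].
End defs.

(* Main.v *)
(* Failure of recovery means that ker A contains a unit vector w of the cone of
   directions along which the l1 norm does not increase inside the cube.  With
   g, h standard Gaussian vectors, Gordon's inequality compares the Gaussian
   processes A w + g0 |w| and |w| g + h.w, and in exponential form it gives, for
   c = c3 sqrt n,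
     P_err e^(c^2/2) <= E e^(-c |g|) * E e^(c sup_w (-h.w)).
   The comparison is made for smoothed minima over finite nets of directions by
   letting the heat semigroup act one Gaussian coordinate at a time: the sum of
   the second derivatives is smaller for the first process, and the errors of
   the discretised flow vanish as the time step tends to 0.  The first factor is
   evaluated by a Laplace argument on a finite grid of radii, which yields I_sph;
   the second one by Lagrangian duality, with multipliers nu for the l1
   constraint and gamma for the norm, which yields w1 and w2. *)

Require Import Defs.
From HB Require Import structures.
From mathcomp Require Import all_boot all_order all_algebra.
From mathcomp Require Import all_classical all_reals all_analysis.
From mathcomp Require Import measurable_realfun ring lra.
Set Implicit Arguments. Unset Strict Implicit. Unset Printing Implicit Defensive.
Import Order.TTheory GRing.Theory Num.Theory numFieldNormedType.Exports.
Local Open Scope classical_set_scope.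
Local Open Scope ring_scope.

(** * Image measures, affine changes of variables and densities *)

(** The maximum over the dual unit vector is kept in closed form, as a Euclidean norm smoothed by
    [delta], so that only the minimum over directions is softened. Both processes are restrictions
    of one function on a common coordinate space: one flow moves the entries of A and g0, the other
    moves g and h. Gordon's inequality thus compares two second order operators applied to the same
    function. That function is unbounded, but its logarithmic derivatives are bounded, so errors are
    kept multiplicative: a step of standard deviation e costs a factor exp(O(e^3)), uniformly in the
    base point, and the flows commute, so the one-step comparison is needed for the initial function
    only. On the side of probability the obstacle is that a finite net has to be fixed before A is
    known, while a failing direction depends on A. The entries are therefore first bounded by L,
    which makes A w small at the net point next to a null direction; L is removed by continuity of
    the measure. Finally exp(-c |g|) does not factor over the coordinates of g, whereas Gaussians
    do; hence its domination by a finite mixture of Gaussians. *)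

Section image_measure.
Context d d' (T : measurableType d) (T' : measurableType d') (R : realType).
Variables (m : {measure set T -> \bar R}) (phi : T -> T').

(* The instance on [pushforward m phi] cannot find the measurability proof of a bare function. *)
Definition image_measure (mphi : measurable_fun setT phi) : {measure set T' -> \bar R} :=
  measure_function_pushforward__canonical__measure_function_Measure m mphi.

Lemma ge0_integral_image (mphi : measurable_fun setT phi) (f : T' -> \bar R) :
  measurable_fun setT f -> (forall y, 0 <= f y)%E ->
  (\int[image_measure mphi]_y f y = \int[m]_x f (phi x))%E.
Proof. by move=> mf f0; apply: (ge0_integral_pushforward mphi m). Qed.

End image_measure.

Section lebesgue_affine.
Context {R : realType}.
Notation mu := (@lebesgue_measure R).
Local Open Scope ereal_scope.

(** The image of Lebesgue measure under the affine map, multiplied by [c], gives every half-open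
    interval its length, so by uniqueness it is Lebesgue measure. *)
Lemma ge0_integral_affine (c d : R) (f : R -> \bar R) : (0 < c)%R ->
  measurable_fun [set: R] f -> (forall x, 0 <= f x) ->
  \int[mu]_x f x = c%:E * \int[mu]_x f (c * x + d)%R.
Proof.
move=> c0 mf f0.
pose phi (x : measurableTypeR R) : measurableTypeR R := (c * x + d)%R.
have mphi : measurable_fun setT phi.
  by apply: measurable_funD => //; exact: measurable_funM.
pose nc := NngNum (ltW c0).
transitivity (\int[mscale nc (image_measure mu mphi)]_x f x); last first.
  by rewrite ge0_integral_mscale//= ge0_integral_image.
apply: eq_measure_integral => A mA _; apply: lebesgue_measure_unique => //.
move=> _ [[a b]] /= _ <-; rewrite /mscale/= /pushforward.
have -> : phi @^-1` `]a, b]%classic = `]((a - d) / c)%R, ((b - d) / c)%R]%classic.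
  apply/seteqP; split => x /=; rewrite !in_itv/= /phi ltr_pdivrMr// ler_pdivlMr// mulrC;
    by rewrite ltrBlDr lerBrDr.
rewrite !lebesgue_measure_itv/= !lte_fin ltr_pM2r ?invr_gt0// ltrD2r.
case: ifPn => _; last by rewrite mule0.
by rewrite -!EFinD -EFinM; congr EFin; field; rewrite gt_eqF.
Qed.

End lebesgue_affine.

Section integral_density.
Context d (T : measurableType d) (R : realType).
Variables (mu nu : {measure set T -> \bar R}) (g : T -> R).
Hypotheses (mg : measurable_fun setT g) (g0 : forall x, 0 <= g x).
Hypothesis nuE : forall A, measurable A -> nu A = (\int[mu]_(x in A) (g x)%:E)%E.
Local Open Scope ereal_scope.
Import HBNNSimple.

(** Simple functions come first; the general case follows by monotone convergence on both sides. *)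
Let integral_density_nnsfun (f : {nnsfun T >-> R}) :
  \int[nu]_x (f x)%:E = \int[mu]_x ((f x)%:E * (g x)%:E).
Proof.
under [LHS]eq_integral do rewrite fimfunE -fsumEFin//.
rewrite [LHS]ge0_integral_fsum//; last 2 first.
  - by move=> r; exact/measurable_EFinP/measurableT_comp.
  - by move=> n x _; rewrite EFinM nnfun_muleindic_ge0.
under [RHS]eq_integral.
  move=> x xD; rewrite fimfunE -fsumEFin// ge0_mule_fsuml; last first.
    by move=> r; rewrite EFinM nnfun_muleindic_ge0.
  over.
rewrite [RHS]ge0_integral_fsum//; last 2 first.
  - move=> r; apply: emeasurable_funM; apply/measurable_EFinP => //.
    exact: measurableT_comp.
  - by move=> n x _; apply: mule_ge0; [rewrite EFinM nnfun_muleindic_ge0|rewrite lee_fin].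
apply: eq_fsbigr => r _.
rewrite integralZl_indic_nnsfun//= integral_indic//= setIT nuE//.
have [r0|r0] := leP 0%R r; last first.
  rewrite preimage_nnfun0//= integral_set0 mule0 integral0_eq// => x _.
  by rewrite indicE in_set0 mulr0 mul0e.
transitivity (\int[mu]_x (r%:E * ((\1_(f @^-1` [set r]) x)%:E * (g x)%:E))).
  rewrite ge0_integralZl_EFin//; last 2 first.
    - by move=> x _; rewrite mule_ge0// lee_fin.
    - by apply: emeasurable_funM; apply/measurable_EFinP.
  congr (_ * _); rewrite integral_mkcond; apply: eq_integral => x _.
  rewrite patchE indicE.
  by case: (x \in _); rewrite ?mul1e ?mul0e.
by apply: eq_integral => x _; rewrite EFinM muleA.
Qed.

Lemma ge0_integral_density (f : T -> \bar R) :
  measurable_fun setT f -> (forall x, 0 <= f x) ->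
  \int[nu]_x f x = \int[mu]_x (f x * (g x)%:E).
Proof.
move=> mf f0.
pose f_ := nnsfun_approx measurableT mf.
transitivity (lim (\int[nu]_x (f_ n x)%:E @[n --> \oo])).
  rewrite -monotone_convergence//=.
  - apply: eq_integral => ? /[!inE] xD; apply/esym/cvg_lim => //=.
    exact: cvg_nnsfun_approx.
  - by move=> n; exact/measurable_EFinP/measurable_funTS.
  - by move=> n ? _; rewrite lee_fin.
  - by move=> ? _ ? ? mn; rewrite lee_fin; exact/lefP/nd_nnsfun_approx.
under eq_fun do rewrite integral_density_nnsfun.
rewrite -monotone_convergence//=.
- apply: eq_integral => x _; apply/cvg_lim => //=.
  apply: cvgeZr => //; exact: cvg_nnsfun_approx.
- by move=> n; apply: emeasurable_funM; apply/measurable_EFinP.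
- by move=> n x _; rewrite mule_ge0// lee_fin.
- move=> x _ m n mn; rewrite lee_wpmul2r ?lee_fin//.
  exact/lefP/nd_nnsfun_approx.
Qed.

End integral_density.

(** * Gaussian integrals *)

Section gaussian.
Context {R : realType}.
Notation mu := (@lebesgue_measure R).
Notation gauss := (@normal_prob R 0 1).
Implicit Types (f : R -> \bar R).

Lemma std_normal_pdfE (x : R) :
  normal_pdf 0 1 x = (Num.sqrt (pi *+ 2))^-1 * expR (- (x ^+ 2 / 2)).
Proof.
rewrite normal_pdfE ?oner_eq0// /normal_peak /normal_fun expr1n mul1r subr0.
by rewrite mulNr.
Qed.

Lemma ge0_integral_gauss f : measurable_fun [set: R] f -> (forall x, 0 <= f x)%E ->
  (\int[gauss]_x f x = \int[mu]_x (f x * (normal_pdf 0 1 x)%:E))%E.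
Proof.
move=> mf f0.
by apply: (@ge0_integral_density _ _ _ mu gauss) => //;
  [exact: measurable_normal_pdf|exact: normal_pdf_ge0].
Qed.

Lemma ge0_integral_gauss_opp f : measurable_fun [set: R] f -> (forall x, 0 <= f x)%E ->
  (\int[gauss]_x f (- x)%R = \int[gauss]_x f x)%E.
Proof.
move=> mf f0.
have mN : measurable_fun [set: R] (-%R : R -> measurableTypeR R) by [].
rewrite ge0_integral_gauss//; last exact: measurableT_comp.
rewrite ge0_integral_gauss//.
have -> : (\int[mu]_x (f x * (normal_pdf 0 1 x)%:E) =
  \int[image_measure mu mN]_x (f x * (normal_pdf 0 1 x)%:E))%E.
  by apply: eq_measure_integral => A mA _; exact: (esym (lebesgue_measureN mA)).
have mfp : measurable_fun [set: R] (fun x => (f x * (normal_pdf 0 1 x)%:E)%E).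
  by apply: emeasurable_funM => //; apply/measurable_EFinP; exact: measurable_normal_pdf.
rewrite (ge0_integral_image mu mN mfp); last first.
  by move=> y; rewrite mule_ge0// lee_fin normal_pdf_ge0.
by apply: eq_integral => x _; rewrite !std_normal_pdfE sqrrN.
Qed.

(* Completing the square: [b x - l x^2 - x^2/2 = b^2/(2 q) - q (x - b/q)^2 / 2] with [q = 1 + 2 l]. *)
Lemma gauss_tilt (b l : R) f : 0 < 1 + 2 * l ->
  measurable_fun [set: R] f -> (forall x, 0 <= f x)%E ->
  (\int[gauss]_x ((expR (b * x - l * x ^+ 2))%:E * f x) =
   (expR (b ^+ 2 / (2 * (1 + 2 * l))) / Num.sqrt (1 + 2 * l))%:E *
   \int[gauss]_x f (x / Num.sqrt (1 + 2 * l) + b / (1 + 2 * l))%R)%E.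
Proof.
set q := 1 + 2 * l => q0 mf f0.
have sq0 : 0 < Num.sqrt q by rewrite sqrtr_gt0.
have mT (c e : R) : measurable_fun [set: R] (fun x => f (c * x + e)).
  by apply: (measurableT_comp mf); apply: measurable_funD => //; exact: measurable_funM.
have mE : measurable_fun [set: R] (fun x => (expR (b * x - l * x ^+ 2))%:E).
  apply/measurable_EFinP; apply: measurableT_comp => //.
  by apply: measurable_funB; apply: measurable_funM => //; exact: measurable_funX.
have mpdf := @measurable_normal_pdf R 0 1.
rewrite ge0_integral_gauss; first last.
- by move=> x; rewrite mule_ge0// lee_fin expR_ge0.
- exact: emeasurable_funM.
under [in RHS]eq_integral do rewrite mulrC.
rewrite ge0_integral_gauss//.
have csq0 : 0 < (Num.sqrt q)^-1 by rewrite invr_gt0.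
rewrite (@ge0_integral_affine _ (Num.sqrt q)^-1 (b / q))//; first last.
- by move=> x; rewrite !mule_ge0// lee_fin ?expR_ge0 ?normal_pdf_ge0.
- apply: emeasurable_funM; first exact: emeasurable_funM.
  exact/measurable_EFinP.
rewrite EFinM [in RHS]muleC [in RHS]muleA muleC; congr (_ * _)%E.
rewrite -ge0_integralZr//=.
- apply: eq_integral => x _; rewrite !std_normal_pdfE.
  rewrite -[X in (X * _)%E]muleC -!muleA; congr (_ * _)%E.
  rewrite -!EFinM; congr EFin.
  rewrite mulrCA -[in RHS]mulrA; congr (_ * _).
  rewrite -!expRD; congr expR.
  rewrite (_ : ((Num.sqrt q)^-1 * x + b / q) = (x + b / Num.sqrt q) / Num.sqrt q); last first.
    by rewrite mulrDl [x / _]mulrC -mulrA -invfM -expr2 sqr_sqrtr ?ltW.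
  have -> : l = (Num.sqrt q ^+ 2 - 1) / 2 by rewrite sqr_sqrtr ?ltW// /q; field.
  rewrite -[in RHS](@sqr_sqrtr _ q) ?ltW//.
  by field; rewrite gt_eqF.
- by apply: emeasurable_funM; [exact: mT|exact/measurable_EFinP].
- by move=> x _; rewrite mule_ge0// lee_fin normal_pdf_ge0.
Qed.

Lemma ge0_integral_gauss_cst (k : R) : (\int[gauss]_x k%:E = k%:E)%E.
Proof. by rewrite integral_cst//= (@probability_setT _ _ _ gauss) mule1. Qed.

Lemma gauss_mgf (b : R) : (\int[gauss]_x (expR (b * x))%:E = (expR (b ^+ 2 / 2))%:E)%E.
Proof.
have := @gauss_tilt b 0 (cst 1%E).
rewrite !mulr0 addr0 mulr1 sqrtr1 divr1 /= => /(_ ltr01 (measurable_cst _)).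
move=> /(_ (fun=> lee01)); rewrite ge0_integral_gauss_cst mule1 => <-.
by apply: eq_integral => x _; rewrite mul0r subr0 mule1.
Qed.

Lemma gauss_mgf_sqr (l : R) : 0 <= l ->
  (\int[gauss]_x (expR (- l * x ^+ 2))%:E = (Num.sqrt (1 + 2 * l))^-1%:E)%E.
Proof.
move=> l0; have := @gauss_tilt 0 l (cst 1%E).
rewrite expr0n mul0r expR0 mul1r => /(_ _ (measurable_cst _) (fun=> lee01)).
rewrite ge0_integral_gauss_cst mule1 => <-; last lra.
by apply: eq_integral => x _; rewrite mul0r sub0r mule1 mulNr.
Qed.

(** The normalised sum of two independent standard normals is standard normal. For the heat flow
    this allows one step to be split into two steps of half the variance. *)
Lemma gauss_half_half f : measurable_fun [set: R] f -> (forall x, 0 <= f x)%E ->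
  (\int[gauss]_x \int[gauss]_y f (Num.sqrt 2^-1 * (x + y))%R = \int[gauss]_x f x)%E.
Proof.
move=> mf f0; set s := Num.sqrt 2^-1.
have s0 : 0 < s by rewrite sqrtr_gt0 invr_gt0.
have s2 : s ^+ 2 = 2^-1 by rewrite sqr_sqrtr// invr_ge0.
have mpdf := @measurable_normal_pdf R 0 1.
have maff (c e : R) : measurable_fun [set: R] (fun x => c * x + e).
  by apply: measurable_funD => //; exact: measurable_funM.
have inner x : (\int[gauss]_y f (s * (x + y))%R =
    \int[mu]_y (f y * (s^-1 * normal_pdf 0 1 (s^-1 * y - x))%:E))%E.
  rewrite ge0_integral_gauss//; last first.
    apply: measurableT_comp => //; apply: measurable_funM => //.
    exact: measurable_funD.
  rewrite (@ge0_integral_affine _ s^-1 (- x)) ?invr_gt0//; first last.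
  - by move=> y; rewrite mule_ge0// lee_fin normal_pdf_ge0.
  - apply: emeasurable_funM; last exact/measurable_EFinP.
    apply: measurableT_comp => //; apply: measurable_funM => //.
    exact: measurable_funD.
  rewrite -ge0_integralZl//=.
  - apply: eq_integral => y _; rewrite muleCA -EFinM; congr (f _ * _)%E.
    by rewrite addrC subrK mulrA divff ?mul1r// gt_eqF.
  - apply: emeasurable_funM; last by apply/measurable_EFinP; apply: (measurableT_comp mpdf); exact: maff.
    apply: measurableT_comp => //; apply: measurable_funM => //.
    by apply: measurable_funD => //; exact: maff.
  - by move=> y _; rewrite mule_ge0// lee_fin normal_pdf_ge0.
  - by rewrite lee_fin invr_ge0 ltW.
under eq_integral do rewrite inner.
pose h (xy : R * R) := (f xy.2 * (s^-1 * normal_pdf 0 1 (s^-1 * xy.2 - xy.1))%:E)%E.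
have mh : measurable_fun [set: measurableTypeR R * measurableTypeR R] h.
  apply: emeasurable_funM; first exact: (measurableT_comp mf).
  apply/measurable_EFinP; apply: measurable_funM => //.
  apply: (measurableT_comp mpdf); apply: measurable_funB => //.
  exact: measurable_funM.
have h0 xy : (0 <= h xy)%E.
  by rewrite /h mule_ge0// lee_fin mulr_ge0 ?normal_pdf_ge0// invr_ge0 ltW.
have /= -> := @fubini_tonelli _ _ (measurableTypeR R) (measurableTypeR R) R gauss mu h mh h0.
rewrite ge0_integral_gauss//; apply: eq_integral => y _; rewrite /h /=.
(* As a function of [x] the kernel is a Gaussian tilt with b = [s^-1 * y] and l = 1/2, so after
   exchanging the integrals [gauss_tilt] evaluates the one over [x]. *)
have pdfE x : s^-1 * normal_pdf 0 1 (s^-1 * y - x) =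
    expR (s^-1 * y * x - 2^-1 * x ^+ 2) * (s^-1 / Num.sqrt (pi *+ 2) * expR (- y ^+ 2)).
  rewrite std_normal_pdfE [RHS]mulrC -!mulrA -expRD; congr (_ * (_ * expR _)).
  have s2' : s^-1 ^+ 2 = 2 by rewrite exprVn s2 invrK.
  by rewrite mulrA -expr2 sqrrB exprMn s2'; field; rewrite gt_eqF.
under eq_integral do rewrite pdfE EFinM muleCA.
have q0 : (0 : R) < 1 + 2 * 2^-1 by rewrite divff.
rewrite (@gauss_tilt (s^-1 * y) 2^-1 (fun=> f y * (s^-1 / Num.sqrt (pi *+ 2) * expR (- y ^+ 2))%:E)%E q0)//; last first.
  by move=> _; rewrite mule_ge0// lee_fin !mulr_ge0 ?expR_ge0// invr_ge0 ?sqrtr_ge0// ltW.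
rewrite integral_cst//= [X in (_ * (_ * X))%E](@probability_setT _ _ _ gauss) mule1.
rewrite muleCA; congr (_ * _)%E; rewrite -EFinM; congr EFin.
rewrite std_normal_pdfE (_ : 1 + 2 * 2^-1 = s ^- 2); last by rewrite s2 invrK divff.
rewrite -exprVn sqrtr_sqr ger0_norm; last by rewrite invr_ge0 ltW.
rewrite (_ : - (y ^+ 2 / 2) = (s^-1 * y) ^+ 2 / (2 * s^-1 ^+ 2) + - y ^+ 2); last first.
  by rewrite exprMn exprVn s2 invrK; field.
rewrite expRD invrK.
by field; rewrite [s == 0]gt_eqF// andbT gt_eqF// sqrtr_gt0 pmulrn_rgt0// pi_gt0.
Qed.

End gaussian.

(** * The Gaussian distribution function and the functions w1, w2 *)

Section gaussian_tail.
Context {R : realType}.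
Notation mu := (@lebesgue_measure R).
Notation gauss := (@normal_prob R 0 1).

Lemma gauss_set1 (x : R) : gauss [set x] = 0%E.
Proof.
have /null_content_dominatesP := @normal_prob_dominates R 0 1.
by apply => //; exact: lebesgue_measure_set1.
Qed.

Lemma gauss_opp (A : set R) : measurable A -> gauss (-%R @^-1` A) = gauss A.
Proof.
move=> mA.
have mNA : measurable (-%R @^-1` A).
  have mN : measurable_fun [set: R] (-%R : R -> R) by [].
  by rewrite -[X in measurable X]setTI; exact: mN.
rewrite -[in RHS](setIT A) -integral_indic// -[in LHS](setIT (_ @^-1` _)) -integral_indic//.
rewrite -[RHS]ge0_integral_gauss_opp//.
by apply/measurable_EFinP; exact: measurable_indic.
Qed.

Lemma gauss_le0 : gauss `]-oo, 0%R] = (2^-1)%:E.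
Proof.
have h1 : gauss `]-oo, 0%R] = gauss `]0%R, +oo[.
  rewrite -[RHS]gauss_opp//.
  rewrite opp_preimage_itvbndy oppr0.
  have -> : `]-oo, (0:R)%R]%classic = `]-oo, 0%R[ `|` [set 0].
    by rewrite setUitv1.
  rewrite measureU//; first by rewrite [X in (_ + X)%E]gauss_set1 adde0.
  by apply/seteqP; split => x //= -[]; rewrite in_itv/= => /[swap] ->; rewrite ltxx.
have h2 : (gauss `]-oo, 0%R] + gauss `]0%R, +oo[ = 1)%E.
  rewrite -measureU//.
  - rewrite -(@probability_setT _ _ _ gauss); congr (gauss _).
    apply/seteqP; split => x //= _; rewrite !in_itv/= andbT.
    by case: (leP x 0) => ?; [left|right].
  - apply/seteqP; split => x //= []; rewrite !in_itv/= andbT.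
    by move=> /le_lt_trans /[apply]; rewrite ltxx.
move: h2; rewrite -h1.
have : gauss `]-oo, 0%R] \is a fin_num by exact: fin_num_measure.
case: (gauss `]-oo, 0%R]) => [r| |]// _ /eqP; rewrite -EFinD eqe => /eqP h.
by congr EFin; lra.
Qed.

Lemma Rintegral_gauss_itv (a b : R) :
  Rintegral mu `[a, b] (fun s => expR (- s ^+ 2)) =
  Num.sqrt pi * fine (gauss `[Num.sqrt 2 * a, Num.sqrt 2 * b]).
Proof.
rewrite /Rintegral -[Num.sqrt pi]/(fine (Num.sqrt pi)%:E) -fineM//; last exact: fin_num_measure.
congr fine.
have s20 : (0 : R) < Num.sqrt 2 by rewrite sqrtr_gt0.
have mpdf := @measurable_normal_pdf R 0 1.
have -> : gauss `[Num.sqrt 2 * a, Num.sqrt 2 * b] =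
    (\int[mu]_x ((\1_`[Num.sqrt 2 * a, Num.sqrt 2 * b] x)%:E * (normal_pdf 0 1 x)%:E))%E.
  rewrite -ge0_integral_gauss//; first by rewrite integral_indic// setIT.
  by apply/measurable_EFinP; exact: measurable_indic.
rewrite (@ge0_integral_affine _ (Num.sqrt 2) 0)//; first last.
- by move=> x; rewrite mule_ge0// lee_fin normal_pdf_ge0.
- by apply: emeasurable_funM; apply/measurable_EFinP.
rewrite muleA -EFinM -ge0_integralZl//=; first last.
- by move=> x _; rewrite mule_ge0// lee_fin normal_pdf_ge0.
- have mlin : measurable_fun [set: R] (fun x => Num.sqrt 2 * x + 0).
    by apply: measurable_funD => //; exact: measurable_funM.
  apply: emeasurable_funM; apply/measurable_EFinP; last exact: (measurableT_comp mpdf).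
  by apply: (measurableT_comp _ mlin); exact: measurable_indic.
rewrite integral_mkcond; apply: eq_integral => x _.
rewrite patchE indicE addr0.
have -> : (x \in `[a, b]%classic) =
    (Num.sqrt 2 * x \in `[Num.sqrt 2 * a, Num.sqrt 2 * b]%classic).
  by rewrite !mem_setE !in_itv/= !ler_pM2l.
case: ifPn => _; last by rewrite mul0e mule0.
rewrite mul1e -EFinM; congr EFin.
rewrite std_normal_pdfE exprMn sqr_sqrtr// -[pi *+ 2]mulr_natr (sqrtrM _ (pi_ge0 R)).
rewrite (_ : 2 * x ^+ 2 / 2 = x ^+ 2); last by field.
by field; rewrite !gt_eqF// sqrtr_gt0 pi_gt0.
Qed.

Lemma gauss_cdf (x : R) : gauss `]-oo, x] = ((1 + erf (x / Num.sqrt 2)) / 2)%:E.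
Proof.
have s20 : (0 : R) < Num.sqrt 2 by rewrite sqrtr_gt0.
have spi0 : (0 : R) < Num.sqrt pi by rewrite sqrtr_gt0 pi_gt0.
have close (a b : R) : gauss `]a, b] = gauss `[a, b].
  have [ab|ba] := leP a b.
    rewrite -(@setU1itv _ _ (BRight b) a false) ?bnd_simp// measureU//; first by rewrite [X in (X + _)%E]gauss_set1 add0e.
    by apply/seteqP; split => y //= [->]; rewrite in_itv/= ltxx.
  rewrite set_itv_ge; last by rewrite bnd_simp -leNgt ltW.
  by rewrite set_itv_ge // bnd_simp -ltNge.
rewrite /erf Rintegral_gauss_itv Rintegral_gauss_itv pmulr_lge0 ?invr_gt0// !mulr0.
rewrite (_ : Num.sqrt 2 * (x / Num.sqrt 2) = x); last by field; rewrite gt_eqF.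
have fin (a b : R) : gauss `[a, b] = (fine (gauss `[a, b]))%:E.
  by rewrite fineK//; exact: fin_num_measure.
have split (a b : R) : a <= b -> gauss `]-oo, b] = (gauss `]-oo, a] + gauss `[a, b])%E.
  move=> ab; rewrite -close -measureU//.
  - congr (gauss _); apply/seteqP; split => y /=; rewrite !in_itv/=.
    + by move=> yb; case: (leP y a) => ya; [left|right].
    + by case=> [ya|/andP[]//]; exact: le_trans ab.
  - apply/seteqP; split => y //= []; rewrite !in_itv/= => ya /andP[ay _].
    by move: (le_lt_trans ya ay); rewrite ltxx.
case: ifPn => [x0|]; last rewrite -ltNge => x0.
  rewrite (split 0 x)// gauss_le0 fin -EFinD; congr EFin.
  by field; rewrite gt_eqF.
have := split x 0 (ltW x0); rewrite gauss_le0 [X in (_ + X)%E]fin => /esym/eqP.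
have : gauss `]-oo, x] \is a fin_num by exact: fin_num_measure.
case: (gauss `]-oo, x]) => [r| |]// _; rewrite -EFinD eqe => /eqP h.
congr EFin.
rewrite (_ : r = 2^-1 - fine (gauss `[x, 0])); last by rewrite -h addrK.
by field; rewrite gt_eqF.
Qed.

Lemma gauss_tail (x : R) : gauss `]x, +oo[ = (erfc (x / Num.sqrt 2) / 2)%:E.
Proof.
have -> : `]x, +oo[%classic = ~` `]-oo, x]%classic by rewrite setCitvl.
rewrite probability_setC//. rewrite [X in (1 - X)%E]gauss_cdf -EFinB; congr EFin.
by rewrite /erfc; field.
Qed.

(** Origin of [w1] and [w2]: they are exponential moments of the squared positive part of a shifted
    Gaussian. Below [nu] the integrand is 1 and yields the distribution function; above [nu] it is
    the exponential of a quadratic and yields a tilted tail. The tilt is admissible because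
    [c / 2 < gam] makes 1 - c/(2 gam) positive. *)
Lemma w_gen_integral (c nu gam : R) : 0 < gam -> c / 2 < gam ->
  (\int[gauss]_z (expR (c / (4 * gam) * (Num.max (z - nu) 0) ^+ 2))%:E =
   (w_gen c nu gam)%:E)%E.
Proof.
move=> g0 cg; set a := c / (2 * gam).
have q0 : 0 < 1 - a by rewrite subr_gt0 ltr_pdivrMr ?mulr_gt0// mul1r mulrC -ltr_pdivrMr.
have s0 : 0 < Num.sqrt (1 - a) by rewrite sqrtr_gt0.
have mI (A : set R) : measurable A -> measurable_fun [set: R] (EFin \o \1_A : R -> \bar R).
  by move=> mA; apply/measurable_EFinP; exact: measurable_indic.
have mE : measurable_fun [set: R]
    (fun z => (expR (- a * nu * z - (- a / 2) * z ^+ 2))%:E).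
  apply/measurable_EFinP; apply: measurableT_comp => //.
  by apply: measurable_funB; apply: measurable_funM => //; exact: measurable_funX.
pose k := expR (a * nu ^+ 2 / 2).
transitivity (\int[gauss]_z ((\1_`]-oo, nu] z)%:E +
    (expR (- a * nu * z - (- a / 2) * z ^+ 2))%:E * (k * \1_`]nu, +oo[ z)%:E))%E.
  apply: eq_integral => z _; rewrite !indicE !mem_setE !in_itv/= andbT.
  have [zn|zn] := leP z nu.
    by rewrite max_r ?subr_le0// expr0n/= mulr0 expR0 !mulr0 mule0 adde0.
  rewrite max_l ?subr_ge0 1?ltW// add0e mulr1 -EFinM -expRD; congr (expR _)%:E.
  by rewrite /a; field; rewrite gt_eqF.
rewrite ge0_integralD//; first last.
- apply: emeasurable_funM => //; apply/measurable_EFinP; apply: measurable_funM => //.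
- by move=> z _; rewrite mule_ge0// lee_fin ?mulr_ge0// expR_ge0.
- exact: mI.
rewrite integral_indic// setIT [X in (X + _)%E]gauss_cdf.
rewrite gauss_tilt; first last.
- by move=> z; rewrite lee_fin mulr_ge0// expR_ge0.
- by apply/measurable_EFinP; apply: measurable_funM => //.
- by rewrite mulrCA divff// mulr1.
rewrite (_ : 1 + 2 * (- a / 2) = 1 - a); last by field.
under eq_integral.
  move=> z _; rewrite EFinM (_ : \1_`]nu, +oo[ _ = \1_`](nu / Num.sqrt (1 - a)), +oo[ z); last first.
    rewrite !indicE !mem_setE !in_itv/= !andbT; congr (_%:R).
    rewrite -ltrBlDr -[in RHS](@ltr_pM2r _ (Num.sqrt (1 - a))^-1) ?invr_gt0//.
    congr (_ < _); rewrite -[in RHS]mulrA -invfM -expr2 sqr_sqrtr ?ltW//.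
    by field; rewrite gt_eqF.
  over.
rewrite ge0_integralZl//=; first last.
- by rewrite lee_fin expR_ge0.
- exact: mI.
rewrite integral_indic// setIT [X in (_ * (_ * X))%E]gauss_tail -!EFinM -EFinD; congr EFin.
rewrite /w_gen -/a.
rewrite (_ : c * nu ^+ 2 / (4 * gam) / (1 - a) =
  a * nu ^+ 2 / 2 + (- a * nu) ^+ 2 / (2 * (1 - a))); last first.
  have -> : c = a * (2 * gam) by rewrite /a; field; rewrite gt_eqF.
  by field; rewrite !gt_eqF.
rewrite expRD -/k (_ : nu / Num.sqrt (1 - a) / Num.sqrt 2 = nu / (Num.sqrt 2 * Num.sqrt (1 - a))).
  by field; rewrite gt_eqF.
by rewrite -mulrA -invfM mulrC [X in _ * X^-1]mulrC mulrC.
Qed.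

End gaussian_tail.

(** * Discretised heat flow *)

Section heat_flow.
Context d (V : measurableType d) (R : realType) (I : Type).
Notation gauss := (@normal_prob R 0 1).
Variable move : I -> R -> V -> V.
Hypothesis moveD : forall k s t x, move k s (move k t x) = move k (s + t) x.
Hypothesis moveC : forall k l s t x, move k s (move l t x) = move l t (move k s x).
Hypothesis mmove : forall k,
  measurable_fun [set: V * measurableTypeR R] (fun xt => move k xt.2 xt.1).
Local Open Scope ereal_scope.
Implicit Types (f g : V -> \bar R).

(** [e] is a standard deviation: this is the heat semigroup in direction [k] at a time proportional
    to [e ^+ 2]. *)
Definition heat (k : I) (e : R) f x := \int[gauss]_z f (move k (e * z)%R x).

Lemma measurable_move_scale k (e : R) :
  measurable_fun [set: V * measurableTypeR R] (fun xz => move k (e * xz.2)%R xz.1).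
Proof.
apply: (measurableT_comp (mmove k) (g := fun xz : V * measurableTypeR R => (xz.1, (e * xz.2)%R))).
apply/measurable_fun_pairP; split; first exact: measurable_fst.
by apply: measurable_funM => //; exact: measurable_snd.
Qed.

Lemma measurable_move k x : measurable_fun [set: R] (fun t => move k t x).
Proof.
apply: (measurableT_comp (mmove k) (g := fun t : measurableTypeR R => (x, t))).
by apply/measurable_fun_pairP; split; [exact: measurable_cst|exact: measurable_id].
Qed.

Lemma measurable_heat_integrand k e x f : measurable_fun [set: V] f ->
  measurable_fun [set: R] (fun z => f (move k (e * z)%R x)).
Proof.
move=> mf; apply: (measurableT_comp mf).
by apply: (measurableT_comp (measurable_move k x)); exact: measurable_funM.
Qed.

Lemma heat_ge0 k e f x : (forall x, 0 <= f x) -> 0 <= heat k e f x.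
Proof. by move=> f0; exact: integral_ge0. Qed.

Lemma measurable_heat k e f : measurable_fun [set: V] f -> (forall x, 0 <= f x) ->
  measurable_fun [set: V] (heat k e f).
Proof.
move=> mf f0.
apply: (measurable_fun_fubini_tonelli_F (m2 := gauss)
  (fun xz : V * measurableTypeR R => f (move k (e * xz.2)%R xz.1))) => //.
by apply: (measurableT_comp mf); exact: measurable_move_scale.
Qed.

Lemma le_heat k e f g x : measurable_fun [set: V] f -> (forall x, 0 <= f x) ->
  measurable_fun [set: V] g -> (forall x, f x <= g x) -> heat k e f x <= heat k e g x.
Proof.
move=> mf f0 mg fg; apply: ge0_le_integral => //.
- exact: measurable_heat_integrand.
- exact: measurable_heat_integrand.
Qed.

Lemma heatZ k e (c : R) f x : (0 <= c)%R -> measurable_fun [set: V] f -> (forall x, 0 <= f x) ->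
  heat k e (fun x => c%:E * f x) x = c%:E * heat k e f x.
Proof.
by move=> c0 mf f0; rewrite /heat ge0_integralZl//; exact: measurable_heat_integrand.
Qed.

Lemma heatC k l e e' f x : measurable_fun [set: V] f -> (forall x, 0 <= f x) ->
  heat k e (heat l e' f) x = heat l e' (heat k e f) x.
Proof.
move=> mf f0; rewrite /heat.
under [RHS]eq_integral do under eq_integral do rewrite moveC.
pose h (zy : measurableTypeR R * measurableTypeR R) := f (move l (e' * zy.2)%R (move k (e * zy.1)%R x)).
apply: (fubini_tonelli (m1 := gauss) (m2 := gauss) h) => [|zy]; last exact: f0.
apply: (measurableT_comp mf).
apply: (measurableT_comp (mmove l)
  (g := fun zy : measurableTypeR R * measurableTypeR R => (move k (e * zy.1)%R x, (e' * zy.2)%R))).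
apply/measurable_fun_pairP; split.
  by apply: (measurableT_comp (measurable_move k x)); apply: measurable_funM.
by apply: measurable_funM.
Qed.

Lemma heat_half k e f x : measurable_fun [set: V] f -> (forall x, 0 <= f x) ->
  heat k (e * Num.sqrt 2^-1) (heat k (e * Num.sqrt 2^-1) f) x = heat k e f x.
Proof.
move=> mf f0; rewrite /heat.
rewrite -(gauss_half_half (measurable_heat_integrand k e x mf))//.
apply: eq_integral => z _; apply: eq_integral => y _.
by rewrite moveD -!mulrA -!mulrDr addrC.
Qed.

Definition heats (ks : seq I) (e : R) f := foldr (fun k => heat k e) f ks.

Lemma heats_ge0 ks e f x : (forall x, 0 <= f x) -> 0 <= heats ks e f x.
Proof. by move=> f0; elim: ks x => //= k ks ih x; exact: heat_ge0. Qed.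

Lemma measurable_heats ks e f : measurable_fun [set: V] f -> (forall x, 0 <= f x) ->
  measurable_fun [set: V] (heats ks e f).
Proof.
move=> mf f0; elim: ks => //= k ks ih; apply: measurable_heat => // x.
exact: heats_ge0.
Qed.

Lemma le_heats ks e f g x : measurable_fun [set: V] f -> (forall x, 0 <= f x) ->
  measurable_fun [set: V] g -> (forall x, f x <= g x) -> heats ks e f x <= heats ks e g x.
Proof.
move=> mf f0 mg fg; elim: ks x => //= k ks ih x.
have g0 y : 0 <= g y by exact: le_trans (f0 y) (fg y).
apply: le_heat => //; try exact: measurable_heats.
by move=> y; exact: heats_ge0.
Qed.

Lemma heatsZ ks e (c : R) f x : (0 <= c)%R -> measurable_fun [set: V] f -> (forall x, 0 <= f x) ->
  heats ks e (fun x => c%:E * f x) x = c%:E * heats ks e f x.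
Proof.
move=> c0 mf f0; elim: ks x => //= k ks ih x.
rewrite -heatZ//; first by congr (heat _ _ _ x); apply/funext => y; exact: ih.
- exact: measurable_heats.
- by move=> y; exact: heats_ge0.
Qed.

Lemma heat_heats k e ks e' f : measurable_fun [set: V] f -> (forall x, 0 <= f x) ->
  heat k e (heats ks e' f) = heats ks e' (heat k e f).
Proof.
move=> mf f0; elim: ks => //= l ks <-; apply/funext => x.
by apply: heatC => [|y]; [exact: measurable_heats|exact: heats_ge0].
Qed.

Lemma heats_heats ks e ls e' f : measurable_fun [set: V] f -> (forall x, 0 <= f x) ->
  heats ks e (heats ls e' f) = heats ls e' (heats ks e f).
Proof.
move=> mf f0; elim: ks => //= k ks ->.
by apply: heat_heats => [|y]; [exact: measurable_heats|exact: heats_ge0].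
Qed.

(** A pointwise bound is enough on a set that the moves of [ks] preserve. It serves for the
    decoupled process, whose product bound holds only where the coordinates of A and g0 vanish. *)
Lemma le_heats_on (Q : V -> Prop) (K : pred I) ks e f g x :
  (forall k r y, K k -> Q y -> Q (move k r y)) -> all K ks ->
  measurable_fun [set: V] f -> (forall x, 0 <= f x) ->
  measurable_fun [set: V] g -> (forall x, 0 <= g x) ->
  (forall x, Q x -> f x <= g x) -> Q x -> heats ks e f x <= heats ks e g x.
Proof.
move=> QK + mf f0 mg g0 fg; elim: ks x => [x _|k ks ih x /= /andP[Kk Kks]] Qx; first exact: fg.
apply: ge0_le_integral => //.
- by move=> z _; exact: heats_ge0.
- by apply: measurable_heat_integrand; exact: measurable_heats.
- by apply: measurable_heat_integrand; exact: measurable_heats.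
- by move=> z _; apply: ih => //; exact: QK.
Qed.

Lemma heatsD ks e f g x :
  measurable_fun [set: V] f -> (forall x, 0 <= f x) ->
  measurable_fun [set: V] g -> (forall x, 0 <= g x) ->
  heats ks e (fun x => f x + g x) x = heats ks e f x + heats ks e g x.
Proof.
move=> mf f0 mg g0; elim: ks x => //= k ks ih x.
rewrite {1}/heat; under eq_integral do rewrite ih.
by rewrite ge0_integralD//; try (by move=> z _; exact: heats_ge0);
  apply: measurable_heat_integrand; exact: measurable_heats.
Qed.

Lemma heats_sum (J : Type) (r : seq J) ks e (f : J -> V -> \bar R) x :
  (forall j, measurable_fun [set: V] (f j)) -> (forall j x, 0 <= f j x) ->
  heats ks e (fun x => \sum_(j <- r) f j x) x = \sum_(j <- r) heats ks e (f j) x.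
Proof.
move=> mf f0; elim: r => [|j r ih].
  rewrite big_nil; under [in LHS]eq_fun do rewrite big_nil.
  elim: ks x => //= k ks ihk x; rewrite /heat.
  by under eq_integral do rewrite ihk; rewrite integral0.
rewrite big_cons -ih -heatsD//.
- by congr (heats _ _ _ x); apply/funext => y; rewrite big_cons.
- exact: emeasurable_sum.
- by move=> y; apply: sume_ge0.
Qed.

Lemma heats_half ks e f : measurable_fun [set: V] f -> (forall x, 0 <= f x) ->
  heats ks (e * Num.sqrt 2^-1) (heats ks (e * Num.sqrt 2^-1) f) = heats ks e f.
Proof.
move=> mf f0; elim: ks => //= k ks <-.
set s := (_ * _)%R; have mg := measurable_heats ks s mf f0.
have g0 x : 0 <= heats ks s f x by exact: heats_ge0.
rewrite -(heat_heats k s ks s mg g0); apply/funext => x.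
apply: heat_half => [|y]; [exact: measurable_heats|exact: heats_ge0].
Qed.

Lemma heats_iter ks f j : measurable_fun [set: V] f -> (forall x, 0 <= f x) ->
  iter (2 ^ j) (heats ks (Num.sqrt 2^-1 ^+ j)) f = heats ks 1 f.
Proof.
move=> mf f0; elim: j => [|j <-]; first by rewrite expn0 expr0.
rewrite expnS mulnC exprSr; set s := (_ ^+ j)%R.
elim: (2 ^ j)%N => // n ih; rewrite mulSn !iterD ih /= heats_half//.
- by elim: n {ih} => //= n ih; apply: measurable_heats => // x; elim: n x {ih} => //= n ih x; exact: heats_ge0.
- by elim: n {ih} => //= n ih x; exact: heats_ge0.
Qed.

Lemma iter_heats_ge0 ks e n f x : (forall x, 0 <= f x) -> 0 <= iter n (heats ks e) f x.
Proof. by move=> f0; elim: n x => //= n ih x; exact: heats_ge0. Qed.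

Lemma measurable_iter_heats ks e n f : measurable_fun [set: V] f -> (forall x, 0 <= f x) ->
  measurable_fun [set: V] (iter n (heats ks e) f).
Proof.
by move=> mf f0; elim: n => //= n ih; apply: measurable_heats => // x; exact: iter_heats_ge0.
Qed.

(** The comparison is assumed for [f] alone, not for its iterates. One [ks] step next to [f] is
    exchanged for an [ls] step, which commutes past the remaining [ks] steps to the outside;
    induction then treats those. *)
Lemma le_iter_heats ks ls e (c : R) n f x : (0 <= c)%R ->
  measurable_fun [set: V] f -> (forall x, 0 <= f x) ->
  (forall x, heats ks e f x <= c%:E * heats ls e f x) ->
  iter n (heats ks e) f x <= (c ^+ n)%:E * iter n (heats ls e) f x.
Proof.
move=> c0 mf f0 h; elim: n x => [|n ih] x; first by rewrite /= mul1e.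
have comm : heats ls e (iter n (heats ks e) f) = iter n (heats ks e) (heats ls e f).
  elim: n {ih} => //= n <-; apply: heats_heats; first exact: measurable_iter_heats.
  by move=> y; exact: iter_heats_ge0.
have mono g g' y : measurable_fun [set: V] g -> (forall x, 0 <= g x) ->
    measurable_fun [set: V] g' -> (forall x, g x <= g' x) ->
    iter n (heats ks e) g y <= iter n (heats ks e) g' y.
  move=> mg g0 mg' gg'; elim: (n) y => //= m ihm y.
  apply: le_heats => //; try exact: measurable_iter_heats.
    by move=> z; exact: iter_heats_ge0.
  by apply: measurable_iter_heats => // z; exact: le_trans (g0 z) (gg' z).
have hom g y : measurable_fun [set: V] g -> (forall x, 0 <= g x) ->
    iter n (heats ks e) (fun x => c%:E * g x) y = c%:E * iter n (heats ks e) g y.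
  move=> mg g0; elim: (n) y => //= m ihm y.
  rewrite -heatsZ//; first by congr (heats _ _ _ y); apply/funext => z; exact: ihm.
    exact: measurable_iter_heats.
  by move=> z; exact: iter_heats_ge0.
have mlsf : measurable_fun [set: V] (heats ls e f) by exact: measurable_heats.
have lsf0 y : 0 <= heats ls e f y by exact: heats_ge0.
rewrite iterSr.
apply: (le_trans (y := iter n (heats ks e) (fun x => c%:E * heats ls e f x) x)).
  apply: mono => //; first exact: measurable_heats.
    by move=> y; exact: heats_ge0.
  exact: emeasurable_funM.
rewrite hom// -comm exprS EFinM -muleA lee_wpmul2l ?lee_fin//=.
rewrite -heatsZ ?exprn_ge0//.
- apply: le_heats => //; first exact: measurable_iter_heats.
    by move=> y; exact: iter_heats_ge0.
  by apply: emeasurable_funM => //; exact: measurable_iter_heats.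
- exact: measurable_iter_heats.
- by move=> y; exact: iter_heats_ge0.
Qed.

(* With [2^j] steps of standard deviation [2^(-j/2)] the errors [C e^3] add up to [C 2^(-j/2)]. *)
Lemma le_heats_of_small_time ks ls (C e0 : R) f x : (0 < e0)%R ->
  measurable_fun [set: V] f -> (forall x, 0 <= f x) ->
  (forall (e : R) x, (0 < e <= e0)%R ->
     heats ks e f x <= (expR (C * e ^+ 3))%:E * heats ls e f x) ->
  heats ks 1 f x <= heats ls 1 f x.
Proof.
move=> e00 mf f0 h.
pose s : R := Num.sqrt 2^-1.
have s0 : (0 < s)%R by rewrite sqrtr_gt0 invr_gt0.
have s1 : (s < 1)%R by rewrite -(@sqrtr1 R) ltr_sqrt// invf_lt1// ltr1n.
have cvs : ((s ^+ j)%R @[j --> \oo] --> (0 : R))%R.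
  by apply: cvg_expr; rewrite ger0_norm// ltW.
have step j : (s ^+ j <= e0)%R -> heats ks 1 f x <= (expR (C * s ^+ j))%:E * heats ls 1 f x.
  move=> sj; rewrite -(heats_iter ks j mf f0) -(heats_iter ls j mf f0).
  have hs y : heats ks (s ^+ j) f y <= (expR (C * (s ^+ j) ^+ 3))%:E * heats ls (s ^+ j) f y.
    by apply: h; rewrite exprn_gt0.
  have := @le_iter_heats ks ls (s ^+ j) _ (2 ^ j)%N f x (expR_ge0 _) mf f0 hs.
  rewrite -expRM_natl.
  rewrite (_ : (2 ^ j)%:R * (C * (s ^+ j) ^+ 3) = C * s ^+ j)%R//.
  rewrite mulrCA; congr (C * _)%R.
  rewrite exprSr mulrA -[RHS]mul1r; congr (_ * _)%R.
  by rewrite exprAC sqr_sqrtr ?invr_ge0// natrX -exprMn divff// expr1n.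
have hy0 := heats_ge0 ls 1 x f0; move: step hy0.
case: (heats ls 1 f x) => [b| |] step hy0; last 2 first.
- by rewrite leey.
- by [].
have [j0 _ Hj0] : \forall j \near \oo, (s ^+ j <= e0)%R.
  by apply: (cvgr_le _ cvs).
(* The inequality for the single index [j0] shows that the left side is finite as well, so that the
   limit can be taken among real numbers. *)
have := step j0 (Hj0 j0 (leqnn _)); have hx0 := heats_ge0 ks 1 x f0.
move: step hx0; case: (heats ks 1 f x) => [a| |] // step hx0 _.
rewrite lee_fin.
have cve : (fun j => expR (C * s ^+ j) * b)%R @ \oo --> (expR (C * 0) * b)%R.
  apply: cvgMr_tmp; apply: (cvg_comp _ expR); last exact: continuous_expR.
  exact: cvgMl_tmp.
rewrite mulr0 expR0 mul1r in cve.
apply: (cvgr_to_ge cve); exists j0 => // j jj0.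
by have := step j (Hj0 j jj0); rewrite -EFinM lee_fin.
Qed.

End heat_flow.

(** * Second order Taylor bounds *)

Section taylor.
Context {R : realType}.
Notation gauss := (@normal_prob R 0 1).

Lemma is_derive_cst_fun (x c : R) : is_derive x 1 (fun=> c : R) 0.
Proof. exact: is_derive_cst. Qed.

Lemma is_derive_add_fun (f g : R -> R) (x a b : R) : is_derive x 1 f a -> is_derive x 1 g b ->
  is_derive x 1 (fun s => f s + g s) (a + b).
Proof. by move=> hf hg; exact: is_deriveD. Qed.

Lemma is_derive_sub_fun (f g : R -> R) (x a b : R) : is_derive x 1 f a -> is_derive x 1 g b ->
  is_derive x 1 (fun s => f s - g s) (a - b).
Proof. by move=> hf hg; exact: is_deriveB. Qed.

Lemma is_derive_mul_fun (f g : R -> R) (x a b : R) : is_derive x 1 f a -> is_derive x 1 g b ->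
  is_derive x 1 (fun s => f s * g s) (a * g x + f x * b).
Proof.
move=> hf hg; have h : is_derive x 1 (f * g) (f x *: b + g x *: a) by exact: is_deriveM.
by apply: is_derive_eq h _; rewrite /GRing.scale/= addrC [g x * a]mulrC.
Qed.

Lemma is_derive_sum_fun (I : finType) (f : I -> R -> R) (x : R) (a : I -> R) :
  (forall i, is_derive x 1 (f i) (a i)) ->
  is_derive x 1 (fun s => \sum_i f i s) (\sum_i a i).
Proof.
move=> h; elim: (index_enum I) => [|i r ih].
  rewrite big_nil (_ : (fun s => _) = fun=> 0); first exact: is_derive_cst_fun.
  by apply/funext => s; rewrite big_nil.
rewrite big_cons (_ : (fun s => _) = fun s => f i s + \sum_(j <- r) f j s).
  exact: is_derive_add_fun.
by apply/funext => s; rewrite big_cons.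
Qed.

Lemma is_derive_expR_fun (f : R -> R) (x a : R) : is_derive x 1 f a ->
  is_derive x 1 (fun s => expR (f s)) (expR (f x) * a).
Proof. by move=> h; apply: (@is_derive1_comp _ expR f). Qed.

Lemma is_derive_inv_fun (f : R -> R) (x a : R) : f x != 0 -> is_derive x 1 f a ->
  is_derive x 1 (fun s => (f s)^-1) (- a / f x ^+ 2).
Proof.
move=> fx h; have h' : is_derive x 1 (fun s => (f s)^-1) (- (f x) ^- 2 *: a) by exact: is_deriveV.
by apply: is_derive_eq h' _; rewrite /GRing.scale/= mulNr mulrC mulNr.
Qed.

Lemma is_derive_sqrt_fun (f : R -> R) (x a : R) : 0 < f x -> is_derive x 1 f a ->
  is_derive x 1 (fun s => Num.sqrt (f s)) (a / (2 * Num.sqrt (f x))).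
Proof.
move=> fx h; rewrite mulrC.
by apply: (@is_derive1_comp _ Num.sqrt f); exact: is_derive1_sqrt.
Qed.

Lemma is_derive_continuous (f : R -> R) (x df : R) : is_derive x 1 f df -> {for x, continuous f}.
Proof.
by move=> h; apply: differentiable_continuous; apply/derivable1_diffP; exact: ex_derive.
Qed.

Lemma MVT0 (f df : R -> R) (r : R) : (forall s : R, is_derive s 1 f (df s)) ->
  exists2 c, `|c| <= `|r| & f r - f 0 = df c * r.
Proof.
move=> h.
have fc a b : {within `[a, b], continuous f}.
  by apply: continuous_subspaceT => x; exact: is_derive_continuous (h x).
have [r0|r0] := leP 0 r.
  have [c] := @MVT_segment R f df _ _ r0 (fun x _ => h x) (fc _ _).
  rewrite in_itv/= => /andP[c0 cr] ->; exists c; last by rewrite subr0.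
  by rewrite !ger0_norm.
have [c] := @MVT_segment R f df _ _ (ltW r0) (fun x _ => h x) (fc _ _).
rewrite in_itv/= => /andP[rc c0] e; exists c; first by rewrite (ler0_norm c0) (ltr0_norm r0) lerN2.
by rewrite -opprB e sub0r mulrN opprK.
Qed.

(** Mean value theorem for [ln f], whose derivative [f1 / f] is at most [C] in absolute value. *)
Lemma le_exp_log_lip (C : R) (f f1 : R -> R) (r : R) : (forall s, 0 < f s) ->
  (forall s : R, is_derive s 1 f (f1 s)) -> (forall s, `|f1 s| <= C * f s) ->
  f r <= f 0 * expR (C * `|r|).
Proof.
move=> f0 df hf1.
have [c _] := @MVT0 (@ln R \o f) (fun s => (f s)^-1 * f1 s) r (fun s =>
  @is_derive1_comp _ _ _ _ _ _ (is_derive1_ln (f0 s)) (df s)).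
move=> /= e; rewrite -[leLHS]lnK ?posrE// -[X in X * _]lnK ?posrE// -expRD ler_expR.
rewrite -lerBlDl e (le_trans (ler_norm _))// normrM ler_wpM2r// normrM.
by rewrite gtr0_norm ?invr_gt0// mulrC ler_pdivrMr.
Qed.

Lemma taylor2_bound (C : R) (f f1 f2 f3 : R -> R) (r : R) : 0 <= C ->
  (forall s, 0 < f s) ->
  (forall s : R, is_derive s 1 f (f1 s)) -> (forall s : R, is_derive s 1 f1 (f2 s)) ->
  (forall s : R, is_derive s 1 f2 (f3 s)) ->
  (forall s, `|f1 s| <= C * f s) -> (forall s, `|f3 s| <= C * f s) ->
  `|f r - (f 0 + r * f1 0 + r ^+ 2 / 2 * f2 0)| <=
    C * f 0 * (`|r| ^+ 3 * expR (C * `|r|)).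
Proof.
move=> C0 f0 d1 d2 d3 h1 h3.
pose M := C * f 0 * expR (C * `|r|).
have b3 s : `|s| <= `|r| -> `|f3 s| <= M.
  move=> sr; rewrite (le_trans (h3 s))// /M -mulrA ler_wpM2l//.
  rewrite (le_trans (le_exp_log_lip s f0 d1 h1))// ler_wpM2l ?ler_expR ?ler_wpM2l//.
  exact: ltW.
have b2 s : `|s| <= `|r| -> `|f2 s - f2 0| <= M * `|r|.
  move=> sr; have [c cs ->] := MVT0 s d3; rewrite normrM ler_pM//.
  by apply: b3; exact: le_trans sr.
have b1 s : `|s| <= `|r| -> `|f1 s - f1 0 - s * f2 0| <= M * `|r| * `|r|.
  move=> sr.
  have dg t : is_derive (t : R) 1 (fun s => f1 s - s * f2 0) (f2 t - f2 0).
    apply: is_derive_eq (is_derive_sub_fun (d2 t)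
      (is_derive_mul_fun (is_derive_id t 1) (is_derive_cst_fun t (f2 0)))) _.
    by rewrite mulr0 addr0 mul1r.
  have [c cs e] := MVT0 s dg.
  move: e; rewrite mul0r subr0 addrAC => ->; rewrite normrM ler_pM//.
  by apply: b2; exact: le_trans sr.
have dg t : is_derive (t : R) 1 (fun s => f s - (s * f1 0 + s ^+ 2 / 2 * f2 0))
    (f1 t - f1 0 - t * f2 0).
  have dsq : is_derive (t : R) 1 (fun s => s ^+ 2 / 2 * f2 0) (t * f2 0).
    apply: is_derive_eq (is_derive_mul_fun (is_derive_mul_fun
      (is_derive_mul_fun (is_derive_id t 1) (is_derive_id t 1))
      (is_derive_cst_fun t 2^-1)) (is_derive_cst_fun t (f2 0))) _.
    by field.
  apply: is_derive_eq (is_derive_sub_fun (d1 t) (is_derive_add_fun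
    (is_derive_mul_fun (is_derive_id t 1) (is_derive_cst_fun t (f1 0))) dsq)) _.
  by ring.
have [c cs e] := MVT0 r dg.
have -> : f r - (f 0 + r * f1 0 + r ^+ 2 / 2 * f2 0) = (f1 c - f1 0 - c * f2 0) * r.
  by rewrite -e; field.
rewrite normrM (_ : C * _ * _ = M * `|r| * `|r| * `|r|); last by rewrite /M; ring.
by rewrite ler_wpM2r// b1.
Qed.

Lemma measurable_expR_abs (C : R) : measurable_fun [set: R] (fun z : R => expR (C * `|z|)).
Proof.
by apply: measurableT_comp => //; apply: measurable_funM => //; exact: measurableT_comp.
Qed.

(** The integrand is dominated by exp(C z) + exp(-C z), and both terms have a finite Gaussian
    integral. *)
Lemma integrable_gauss_expR_abs (C : R) : 0 <= C ->
  gauss.-integrable [set: R] (fun z => (expR (C * `|z|))%:E).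
Proof.
move=> C0; have mE (D : R) : measurable_fun [set: R] (fun z => (expR (D * z))%:E : \bar R).
  by apply/measurable_EFinP; apply: measurableT_comp => //; exact: measurable_funM.
have ie (D : R) : gauss.-integrable [set: R] (fun z => (expR (D * z))%:E).
  apply/integrableP; split; first exact: mE.
  under eq_integral do rewrite gee0_abs ?lee_fin ?expR_ge0//.
  by rewrite gauss_mgf ltry.
apply: le_integrable (integrableD _ (ie C) (ie (- C))) => //.
  by apply/measurable_EFinP; exact: measurable_expR_abs.
move=> z _ /=; rewrite lee_fin (ger0_norm (expR_ge0 _)) (ger0_norm (addr_ge0 (expR_ge0 _) (expR_ge0 _))).
have [z0|z0] := leP 0 z; first by rewrite ger0_norm// lerDl expR_ge0.
by rewrite ltr0_norm// mulrN mulNr lerDr expR_ge0.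
Qed.

Lemma integrable_gauss_exp_type (g : R -> R) (K C : R) : 0 <= C ->
  measurable_fun [set: R] g -> (forall z, `|g z| <= K * expR (C * `|z|)) ->
  gauss.-integrable [set: R] (fun z => (g z)%:E).
Proof.
move=> C0 mg h.
apply: le_integrable (integrableZl _ K (integrable_gauss_expR_abs C0)) => //.
  exact/measurable_EFinP.
move=> z _; rewrite -EFinM !abse_EFin lee_fin (le_trans (h z))//; exact: ler_norm.
Qed.

Lemma expn_le_expR (n : nat) (x : R) : 0 <= x -> x ^+ n <= n`!%:R * expR x.
Proof.
move=> x0; case: n => [|n].
  rewrite expr0 fact0 mul1r; apply: le_trans (expR_ge1Dx x); by rewrite lerDl.
rewrite mulrC -ler_pdivrMr ?ltr0n ?fact_gt0//.
by apply: le_trans (expR_ge1Dxn n x0); rewrite lerDr.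
Qed.

Lemma integrable_gauss_pow_exp n (C : R) : 0 <= C ->
  gauss.-integrable [set: R] (fun z => (`|z| ^+ n * expR (C * `|z|))%:E).
Proof.
move=> C0; apply: (@integrable_gauss_exp_type _ n`!%:R (C + 1)).
- by rewrite addr_ge0.
- apply: measurable_funM; last exact: measurable_expR_abs.
  by apply: measurable_funX; exact: normr_measurable.
- move=> z; rewrite ger0_norm ?mulr_ge0 ?exprn_ge0 ?expR_ge0//.
  by rewrite mulrDl mul1r expRD mulrCA mulrC ler_wpM2l ?expR_ge0// expn_le_expR.
Qed.

Lemma integrable_gauss_pow n : gauss.-integrable [set: R] (fun z => (z ^+ n)%:E).
Proof.
apply: (@integrable_gauss_exp_type _ n`!%:R 1) => // z.
by rewrite normrX mul1r expn_le_expR.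
Qed.

Lemma gauss_mean : (\int[gauss]_z (z%:E) = 0)%E.
Proof.
have := integrable_gauss_pow 1; set f := fun z : R => (z ^+ 1)%:E => fi.
transitivity (\int[gauss]_z f z)%E; first by apply: eq_integral => z _; rewrite /f expr1.
rewrite integralE -(@ge0_integral_gauss_opp _ (f^\-)%E); first last.
- by move=> x; exact: funeneg_ge0.
- by apply: measurable_funeneg; exact: measurable_int fi.
rewrite (_ : (fun z => (f^\-)%E (- z)) = (f^\+)%E).
  rewrite subee//; apply: integrable_pos_fin_num => //.
by apply/funext => z; rewrite funenegE funeposE /f !expr1 EFinN oppeK.
Qed.

(** Kept symbolic: it multiplies the curvature of both flows alike, so the comparison depends on its
    sign only. *)
Definition gauss_var : R := fine (\int[gauss]_z (z ^+ 2)%:E).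

Lemma gauss_var_ge0 : 0 <= gauss_var.
Proof. by rewrite fine_ge0// integral_ge0// => z _; rewrite lee_fin sqr_ge0. Qed.

Lemma gauss_integral_quad (a b c l C : R) : 0 <= C ->
  (\int[gauss]_z (a + b * z + c * z ^+ 2 + l * (`|z| ^+ 3 * expR (C * `|z|)))%:E =
   (a + c * gauss_var + l * fine (\int[gauss]_z (`|z| ^+ 3 * expR (C * `|z|))%:E))%:E)%E /\
  gauss.-integrable [set: R]
    (fun z => (a + b * z + c * z ^+ 2 + l * (`|z| ^+ 3 * expR (C * `|z|)))%:E).
Proof.
move=> C0.
have ia : gauss.-integrable [set: R] (fun=> a%:E).
  exact: finite_measure_integrable_cst.
have i1 := integrableZl measurableT b (integrable_gauss_pow 1).
have i2 := integrableZl measurableT c (integrable_gauss_pow 2).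
have i3 := integrableZl measurableT l (integrable_gauss_pow_exp 3 C0).
have e : (fun z => (a + b * z + c * z ^+ 2 + l * (`|z| ^+ 3 * expR (C * `|z|)))%:E) =
    ((((fun=> a%:E) \+ (fun z => b%:E * (z ^+ 1)%:E)) \+ (fun z => c%:E * (z ^+ 2)%:E))
     \+ (fun z : R => l%:E * (`|z| ^+ 3 * expR (C * `|z|))%:E))%E.
  by apply/funext => z /=; rewrite !EFinD !EFinM expr1.
rewrite e; split; last by do !apply: integrableD => //.
rewrite integralD//; last by do !apply: integrableD => //.
rewrite integralD//; last by do !apply: integrableD => //.
rewrite integralD//.
rewrite ge0_integral_gauss_cst !integralZl//; first last.
- exact: integrable_gauss_pow.
- exact: integrable_gauss_pow.
- exact: integrable_gauss_pow_exp.
under eq_integral do rewrite expr1.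
rewrite gauss_mean mule0 adde0 !EFinD !EFinM.
by rewrite !fineK//; apply: integrable_fin_num => //;
  [exact: integrable_gauss_pow_exp|exact: integrable_gauss_pow].
Qed.

Lemma gauss_taylor (C : R) : 0 <= C -> exists2 M : R, 0 <= M &
  forall f f1 f2 f3 : R -> R, (forall s, 0 < f s) ->
  (forall s : R, is_derive s 1 f (f1 s)) -> (forall s : R, is_derive s 1 f1 (f2 s)) ->
  (forall s : R, is_derive s 1 f2 (f3 s)) ->
  (forall s, `|f1 s| <= C * f s) -> (forall s, `|f3 s| <= C * f s) ->
  forall e, 0 < e <= 1 ->
  ((f 0 + gauss_var / 2 * e ^+ 2 * f2 0 - M * e ^+ 3 * f 0)%:E <=
   \int[gauss]_z (f (e * z))%:E <=
   (f 0 + gauss_var / 2 * e ^+ 2 * f2 0 + M * e ^+ 3 * f 0)%:E)%E.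
Proof.
move=> C0; pose W := fine (\int[gauss]_z (`|z| ^+ 3 * expR (C * `|z|))%:E).
have W0 : 0 <= W.
  apply: fine_ge0; apply: integral_ge0 => z _.
  by rewrite lee_fin mulr_ge0 ?exprn_ge0 ?expR_ge0.
exists (C * W) => [|f f1 f2 f3 f0 d1 d2 d3 h1 h3 e /andP[e0 e1]]; first exact: mulr_ge0.
have bound z : `|f (e * z) - (f 0 + f1 0 * e * z + e ^+ 2 / 2 * f2 0 * z ^+ 2)| <=
    C * f 0 * e ^+ 3 * (`|z| ^+ 3 * expR (C * `|z|)).
  have := taylor2_bound (e * z) C0 f0 d1 d2 d3 h1 h3.
  rewrite (_ : f 0 + e * z * f1 0 + _ = f 0 + f1 0 * e * z + e ^+ 2 / 2 * f2 0 * z ^+ 2); last by field.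
  move=> /le_trans; apply; rewrite -[leRHS]mulrA ler_wpM2l ?(mulr_ge0 C0 (ltW (f0 0)))//.
  rewrite normrM (gtr0_norm e0) exprMn -[leLHS]mulrA ler_wpM2l ?exprn_ge0 ?(ltW e0)//.
  rewrite ler_wpM2l ?exprn_ge0// ler_expR ler_wpM2l//.
  by rewrite ler_piMl// ltW.
have [eU iU] := gauss_integral_quad (f 0) (f1 0 * e) (e ^+ 2 / 2 * f2 0) (C * f 0 * e ^+ 3) C0.
have [eL iL] := gauss_integral_quad (f 0) (f1 0 * e) (e ^+ 2 / 2 * f2 0) (- (C * f 0 * e ^+ 3)) C0.
have me : measurable_fun [set: R] (fun z : R => e * z) by exact: measurable_funM.
have mf0 : measurable_fun [set: R] f.
  by apply: continuous_measurable_fun => s; exact: is_derive_continuous (d1 s).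
have mf : measurable_fun [set: R] (fun z => f (e * z)) := measurableT_comp mf0 me.
have iF : gauss.-integrable [set: R] (fun z => (f (e * z))%:E).
  apply: (@integrable_gauss_exp_type _ (f 0) C) => // z.
  rewrite gtr0_norm// (le_trans (le_exp_log_lip (e * z) f0 d1 h1))//.
  by rewrite ler_wpM2l ?(ltW (f0 0))// ler_expR ler_wpM2l// normrM gtr0_norm// ler_piMl//.
have -> : f 0 + gauss_var / 2 * e ^+ 2 * f2 0 - C * W * e ^+ 3 * f 0 =
    f 0 + e ^+ 2 / 2 * f2 0 * gauss_var + - (C * f 0 * e ^+ 3) * W by field.
have -> : f 0 + gauss_var / 2 * e ^+ 2 * f2 0 + C * W * e ^+ 3 * f 0 =
    f 0 + e ^+ 2 / 2 * f2 0 * gauss_var + (C * f 0 * e ^+ 3) * W by field.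
rewrite -eU -eL; apply/andP; split; apply: le_integral => // z _; rewrite lee_fin;
  move: (bound z); rewrite ler_norml => /andP[]; lra.
Qed.

End taylor.

(** * Comparison of two heat flows *)

Section heat_comparison.
Context d (V : measurableType d) (R : realType) (I : Type).
Variable move : I -> R -> V -> V.
Hypothesis move0 : forall k x, move k 0 x = x.
Hypothesis moveD : forall k s t x, move k s (move k t x) = move k (s + t) x.
Hypothesis moveC : forall k l s t x, move k s (move l t x) = move l t (move k s x).
Hypothesis mmove : forall k,
  measurable_fun [set: V * measurableTypeR R] (fun xt => move k xt.2 xt.1).
Implicit Types G S : V -> R.

Definition is_dmove k G G' := forall x (r : R),
  is_derive r 1 (fun s : R => G (move k s x)) (G' (move k r x)).

(** Functions bounded together with their derivatives up to order [n] in all directions. They form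
    an algebra, which is how the logarithmic derivatives of the soft minimum are controlled. *)
Fixpoint tame n G : Prop :=
  [/\ measurable_fun [set: V] G, (exists C : R, forall x, `|G x| <= C) &
    if n is n'.+1 then forall k, exists2 G', is_dmove k G G' & tame n' G' else True].

Lemma tameW n G : tame n.+1 G -> tame n G.
Proof.
elim: n G => [|n ih] G; first by case.
by move=> [mG bG h]; split=> // k; have [G' dG' /ih] := h k; exists G'.
Qed.

Lemma tame_measurable n G : tame n G -> measurable_fun [set: V] G.
Proof. by case: n => [|n] []. Qed.

Lemma tame_bounded n G : tame n G -> exists2 C : R, 0 <= C & forall x, `|G x| <= C.
Proof.
have h : (exists C : R, forall x, `|G x| <= C) -> exists2 C : R, 0 <= C & forall x, `|G x| <= C.
  by move=> [C hC]; exists `|C| => // x; rewrite (le_trans (hC x))// ler_norm.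
by case: n => [|n] [_ /h].
Qed.

Lemma tame_cst n (c : R) : tame n (fun=> c).
Proof.
elim: n c => [|n ih] c; split => //; try by exists `|c|.
by move=> k; exists (fun=> 0) => // x r; exact: is_derive_cst_fun.
Qed.

Lemma tame_add n G S : tame n G -> tame n S -> tame n (fun x => G x + S x).
Proof.
elim: n G S => [|n ih] G S [mG [C hC] dG] [mS [D hD] dS]; split => //; try exact: measurable_funD;
  try by exists (C + D) => x; rewrite (le_trans (ler_normD _ _))// lerD.
move=> k; have [G' dG' tG'] := dG k; have [S' dS' tS'] := dS k.
exists (fun x => G' x + S' x); last exact: ih.
by move=> x r; exact: (is_derive_add_fun (dG' x r) (dS' x r)).
Qed.

Lemma tame_mul n G S : tame n G -> tame n S -> tame n (fun x => G x * S x).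
Proof.
elim: n G S => [|n ih] G S tG tS.
  case: tG tS => mG [C hC] dG [mS [D hD] dS]; split => //; first exact: measurable_funM.
  by exists (C * D) => x; rewrite normrM ler_pM.
have := tameW tG; have := tameW tS.
case: tG tS => mG [C hC] dG [mS [D hD] dS] tS tG; split => //; first exact: measurable_funM.
  by exists (C * D) => x; rewrite normrM ler_pM.
move=> k; have [G' dG' tG'] := dG k; have [S' dS' tS'] := dS k.
exists (fun x => G' x * S x + G x * S' x); last by apply: tame_add; exact: ih.
by move=> x r; exact: (is_derive_mul_fun (dG' x r) (dS' x r)).
Qed.

Lemma tame_sub n G S : tame n G -> tame n S -> tame n (fun x => G x - S x).
Proof.
move=> tG tS; rewrite (_ : (fun x => _) = fun x => G x + (-1) * S x).
  by apply: tame_add => //; apply: tame_mul => //; exact: tame_cst.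
by apply/funext => x; rewrite mulN1r.
Qed.

Lemma tame_sum n (J : Type) (r : seq J) (G : J -> V -> R) :
  (forall j, tame n (G j)) -> tame n (fun x => \sum_(j <- r) G j x).
Proof.
move=> h; elim: r => [|j r ih].
  rewrite (_ : (fun x => _) = fun=> 0); first exact: tame_cst.
  by apply/funext => x; rewrite big_nil.
rewrite (_ : (fun x => _) = fun x => G j x + \sum_(j <- r) G j x); first exact: tame_add.
by apply/funext => x; rewrite big_cons.
Qed.

(** This turns a lower bound 1 + t into an exponential with a loss of second order. Since exp(-x) >=
    1 - x for x = t - 2 t^2, it is enough that (1 + t)(1 - x) = 1 + t^2 (1 + 2 t) is at least 1. *)
Lemma expR_sub_sqr_le (t : R) : - (1 / 2) <= t -> expR (t - 2 * t ^+ 2) <= 1 + t.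
Proof.
move=> ht; have h : 1 - (t - 2 * t ^+ 2) <= expR (- (t - 2 * t ^+ 2)) by exact: expR_ge1Dx.
have p : 0 < 1 - (t - 2 * t ^+ 2) by nra.
rewrite -(ler_pM2r (expR_gt0 (- (t - 2 * t ^+ 2)))) -expRD subrr expR0.
apply: (@le_trans _ _ ((1 + t) * (1 - (t - 2 * t ^+ 2)))); last first.
  by rewrite ler_wpM2l//; lra.
have : 0 <= t ^+ 2 * (1 + 2 * t) by rewrite mulr_ge0 ?sqr_ge0//; lra.
nra.
Qed.

Variables (F : V -> R) (H H' : I -> V -> R).
Hypothesis F0 : forall x, 0 < F x.
Hypothesis mF : measurable_fun [set: V] F.
Hypothesis dF : forall k, is_dmove k F (fun x => F x * H k x).
Hypothesis dH : forall k, is_dmove k (H k) (H' k).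
Hypothesis tH : forall k, tame 3 (H k).
Hypothesis tH' : forall k, tame 3 (H' k).
Let v := @gauss_var R / 2.
Let v0 : 0 <= v. Proof. by rewrite divr_ge0// gauss_var_ge0. Qed.

(* [D_k^2 F = F * curv k]. *)
Definition curv k x := H k x ^+ 2 + H' k x.

Lemma tame_curv k : tame 3 (curv k).
Proof. by apply: tame_add => //; exact: tame_mul. Qed.

(** Multiplicative ansatz for [F] after several small steps, where [S] accumulates the curvatures of
    the directions already treated. *)
Let FS e S x := F x * expR (v * e ^+ 2 * S x).

Lemma FS_gt0 e S x : 0 < FS e S x.
Proof. by rewrite mulr_gt0// expR_gt0. Qed.

Lemma measurable_FS e S : measurable_fun [set: V] S ->
  measurable_fun [set: V] (fun x => (FS e S x)%:E).
Proof.
move=> mS; apply/measurable_EFinP; apply: measurable_funM => //.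
by apply: measurableT_comp => //; exact: measurable_funM.
Qed.

(** Along the orbit in direction [k] the ansatz has logarithmic derivative [K]. Its relative second
    derivative K^2 + K' equals [curv k] up to a term of order e^2, so the step multiplies the ansatz
    by exp(v e^2 curv) up to a factor exp(O(e^3)). *)
Lemma heat_one_step k S : tame 3 S -> exists C e0 : R, [/\ 0 <= C, 0 < e0 <= 1 &
  forall e x, 0 < e <= e0 ->
  ((FS e (fun x => S x + curv k x) x * expR (- (C * e ^+ 3)))%:E <=
   heat move k e (fun x => (FS e S x)%:E) x <=
   (FS e (fun x => S x + curv k x) x * expR (C * e ^+ 3))%:E)%E].
Proof.
move=> tS; have [_ _ /(_ k)[S1 dS1 tS1]] := tS.
have [_ _ /(_ k)[S2 dS2 tS2]] := tS1; have [_ _ /(_ k)[S3 dS3 tS3]] := tS2.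
have [_ _ /(_ k)[H2 dH2 tH2]] := tH' k.
have [cH cH0 hH] := tame_bounded (tH k); have [cH' cH'0 hH'] := tame_bounded (tH' k).
have [cH2 cH20 hH2] := @tame_bounded 2 _ tH2.
have [c1 c10 hS1] := @tame_bounded 2 _ tS1; have [c2 c20 hS2] := @tame_bounded 1 _ tS2.
have [c3 c30 hS3] := @tame_bounded 0 _ tS3.
pose a := cH + v * c1; pose b := cH' + v * c2; pose c := cH2 + v * c3.
have a0 : 0 <= a by rewrite addr_ge0// mulr_ge0.
have b0 : 0 <= b by rewrite addr_ge0// mulr_ge0.
have c0 : 0 <= c by rewrite addr_ge0// mulr_ge0.
(* With f' = f K one has f''' = f (K^3 + 3 K K' + K''). The first summand bounds f'/f and the second
   bounds f'''/f. *)
pose C := a + (a ^+ 3 + 3 * a * b + c).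
have C10 : 0 <= a ^+ 3 + 3 * a * b + c.
  by apply: addr_ge0 => //; apply: addr_ge0; [exact: exprn_ge0|apply: mulr_ge0 => //; exact: mulr_ge0].
have C0 : 0 <= C by exact: addr_ge0.
have [M M0 taylor] := gauss_taylor C0.
(* [D] bounds the cross terms [E] through which the weight exp(v e^2 S) disturbs the curvature. *)
pose D := 2 * cH * c1 + c2 + v * c1 ^+ 2.
have D0 : 0 <= D.
  apply: addr_ge0; last by apply: mulr_ge0 => //; exact: sqr_ge0.
  by apply: addr_ge0 => //; apply: mulr_ge0 => //; exact: mulr_ge0.
pose T := v * (a ^+ 2 + b) + M.
have T0 : 0 <= T.
  by apply: addr_ge0 => //; apply: mulr_ge0 => //; apply: addr_ge0 => //; exact: sqr_ge0.
(* [T * e ^+ 2] bounds the relative increment [t] of the step; this [e0] keeps it below 1/2, as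
   [expR_sub_sqr_le] requires. *)
pose e0 := (1 + 2 * T)^-1.
have e00 : 0 < e0 by rewrite /e0 invr_gt0; lra.
have e01 : e0 <= 1 by rewrite /e0 invf_le1; lra.
(* The summands pay for the cross terms, for the Taylor remainder, and for the loss 2 t^2 when 1 + t
   is bounded below by an exponential. *)
exists (v ^+ 2 * D + M + 2 * T ^+ 2), e0; split.
- by apply: addr_ge0; [apply: addr_ge0 => //|]; apply: mulr_ge0 => //; exact: sqr_ge0.
- by rewrite e00.
move=> e x /andP[e_gt0 ee0].
have e1 : e <= 1 by exact: le_trans ee0 _.
pose ka := v * e ^+ 2.
have ka0 : 0 <= ka by rewrite mulr_ge0// sqr_ge0.
have e2 : e ^+ 2 <= e by rewrite expr2 ler_piMl// ltW.
have e2_1 : e ^+ 2 <= 1 by exact: le_trans e1.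
have kav : ka <= v by rewrite /ka ler_piMr.
pose y r := move k r x.
pose f r := FS e S (y r).
pose K r := H k (y r) + ka * S1 (y r).
pose K1 r := H' k (y r) + ka * S2 (y r).
pose K2 r := H2 (y r) + ka * S3 (y r).
have f0 r : 0 < f r by exact: FS_gt0.
have lin (p q u w z : R) : 0 <= w -> `|p| <= z -> `|q| <= w -> `|p + ka * q| <= z + v * w.
  move=> w0 pz qw; rewrite (le_trans (ler_normD _ _))// lerD// normrM (ger0_norm ka0).
  exact: ler_pM.
have hK r : `|K r| <= a by exact: lin.
have hK1 r : `|K1 r| <= b by exact: lin.
have hK2 r : `|K2 r| <= c by exact: lin.
have dK (r : R) : is_derive r 1 K (K1 r).
  apply: is_derive_eq (is_derive_add_fun (dH k x r)
    (is_derive_mul_fun (is_derive_cst_fun r ka) (dS2 x r))) _.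
  by rewrite mul0r add0r.
have dK1 (r : R) : is_derive r 1 K1 (K2 r).
  apply: is_derive_eq (is_derive_add_fun (dH2 x r)
    (is_derive_mul_fun (is_derive_cst_fun r ka) (dS3 x r))) _.
  by rewrite mul0r add0r.
have d1 (r : R) : is_derive r 1 f (f r * K r).
  apply: is_derive_eq (is_derive_mul_fun (dF k x r)
    (is_derive_expR_fun (is_derive_mul_fun (is_derive_cst_fun r ka) (dS1 x r)))) _.
  by rewrite /f /FS /K -/(y r) -/ka; ring.
have d2 (r : R) : is_derive r 1 (fun r => f r * K r) (f r * (K r ^+ 2 + K1 r)).
  by apply: is_derive_eq (is_derive_mul_fun (d1 r) (dK r)) _; ring.
have d3 (r : R) : is_derive r 1 (fun r => f r * (K r ^+ 2 + K1 r))
    (f r * (K r ^+ 3 + 3 * K r * K1 r + K2 r)).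
  apply: is_derive_eq (is_derive_mul_fun (d1 r) (is_derive_add_fun
    (is_derive_mul_fun (dK r) (dK r)) (dK1 r))) _.
  by ring.
have h1 r : `|f r * K r| <= C * f r.
  rewrite normrM gtr0_norm// mulrC ler_wpM2r ?(ltW (f0 r))//.
  by rewrite (le_trans (hK r))// lerDl.
have h3 r : `|f r * (K r ^+ 3 + 3 * K r * K1 r + K2 r)| <= C * f r.
  rewrite normrM gtr0_norm// mulrC ler_wpM2r ?(ltW (f0 r))//.
  rewrite -[leLHS]add0r lerD// (le_trans (ler_normD _ _))// lerD//.
  rewrite (le_trans (ler_normD _ _))// lerD//; first by rewrite normrX lerXn2r ?nnegrE.
  by rewrite !normrM (@ger0_norm _ 3)// ler_pM// ?mulr_ge0// ler_wpM2l.
have := taylor f _ _ _ f0 d1 d2 d3 h1 h3 e; rewrite e_gt0 e1 => /(_ isT).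
have fE : f 0 = FS e S x by rewrite /f /y move0.
have KE : K 0 ^+ 2 + K1 0 = curv k x + ka * (2 * H k x * S1 x + S2 x + ka * S1 x ^+ 2).
  by rewrite /K /K1 /curv /y move0; ring.
rewrite -/v -/ka fE KE; set E := (X in curv k x + ka * X).
have hE : `|E| <= D.
  rewrite /E (le_trans (ler_normD _ _))// lerD//.
    rewrite (le_trans (ler_normD _ _))// lerD// !normrM ger0_norm// ler_pM// ?mulr_ge0//.
    by rewrite ler_wpM2l.
  by rewrite normrM ger0_norm// ler_pM ?sqr_ge0// normrX lerXn2r ?nnegrE.
have ka2 : ka ^+ 2 <= v ^+ 2 * e ^+ 3.
  rewrite exprMn ler_wpM2l ?sqr_ge0// -exprM (_ : e ^+ (2 * 2) = e ^+ 3 * e); last by ring.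
  by rewrite ler_piMr// exprn_ge0// ltW.
have kaE : `|ka * (ka * E)| <= v ^+ 2 * D * e ^+ 3.
  rewrite mulrA -expr2 normrM ger0_norm ?sqr_ge0// [leRHS]mulrAC.
  by apply: ler_pM => //; exact: sqr_ge0.
have FSE : FS e (fun x => S x + curv k x) x = FS e S x * expR (ka * curv k x).
  by rewrite /FS mulrDr expRD mulrA.
have FS0 := FS_gt0 e S x.
move=> /andP[lo hi]; rewrite FSE; apply/andP; split; last first.
  apply: (le_trans hi); rewrite lee_fin -[leRHS]mulrA -expRD.
  rewrite [leLHS](_ : _ = FS e S x * (1 + (ka * (curv k x + ka * E) + M * e ^+ 3))); last by ring.
  rewrite ler_wpM2l ?(ltW FS0)// (le_trans (expR_ge1Dx _))// ler_expR.
  move: kaE; rewrite mulrDr ler_norml => /andP[_].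
  have : 0 <= 2 * T ^+ 2 * e ^+ 3.
    by apply: mulr_ge0; [apply: mulr_ge0 => //; exact: sqr_ge0|apply: exprn_ge0; exact: ltW].
  lra.
apply: le_trans lo; rewrite lee_fin -[leLHS]mulrA -expRD.
pose t := ka * (curv k x + ka * E) - M * e ^+ 3.
rewrite [leRHS](_ : _ = FS e S x * (1 + t)); last by rewrite /t; ring.
rewrite ler_wpM2l ?(ltW FS0)//.
have e3 : e ^+ 3 <= e ^+ 2 by rewrite exprS ler_piMl ?sqr_ge0.
have ht : `|t| <= T * e ^+ 2.
  rewrite /t -KE (le_trans (ler_normB _ _))// /T mulrDl lerD//.
    rewrite normrM (ger0_norm ka0) /ka [leLHS]mulrAC.
    rewrite ler_wpM2r ?sqr_ge0// ler_wpM2l//.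
    by rewrite (le_trans (ler_normD _ _))// lerD// normrX lerXn2r ?nnegrE.
  by rewrite ger0_norm ?mulr_ge0 ?exprn_ge0 ?(ltW e_gt0)// ler_wpM2l.
have Te : T * e ^+ 2 <= 1 / 2.
  apply: (@le_trans _ _ (T * e0)); first by rewrite ler_wpM2l// (le_trans e2).
  by rewrite /e0 ler_pdivrMr; lra.
have t12 : - (1 / 2) <= t.
  by move: ht; rewrite ler_norml => /andP[+ _]; apply: le_trans; rewrite lerN2.
apply: le_trans (expR_sub_sqr_le t12); rewrite ler_expR.
have t2 : t ^+ 2 <= T ^+ 2 * e ^+ 3.
  rewrite -real_normK ?num_real// (@le_trans _ _ ((T * e ^+ 2) ^+ 2))//.
    by rewrite lerXn2r ?nnegrE// mulr_ge0 ?sqr_ge0.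
  rewrite exprMn ler_wpM2l ?sqr_ge0// (_ : (e ^+ 2) ^+ 2 = e ^+ 3 * e); last by ring.
  by rewrite ler_piMr// exprn_ge0// ltW.
move: kaE; rewrite ler_norml /t mulrDr => /andP[+ _]; rewrite -/t.
move: t2; rewrite /t mulrDr; lra.
Qed.

Lemma heats_one_step ks : exists C e0 : R, [/\ 0 <= C, 0 < e0 <= 1 &
  forall e x, 0 < e <= e0 ->
  ((FS e (fun x => \sum_(k <- ks) curv k x) x * expR (- (C * e ^+ 3)))%:E <=
   heats move ks e (EFin \o F) x <=
   (FS e (fun x => \sum_(k <- ks) curv k x) x * expR (C * e ^+ 3))%:E)%E].
Proof.
elim: ks => [|k ks [C [e0 [C0 /andP[e00 e01] ih]]]].
  exists 0, 1; rewrite lexx ltr01 lexx; split => // e x _ /=.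
  by rewrite mul0r oppr0 expR0 !mulr1 /FS big_nil mulr0 expR0 mulr1 lexx.
pose S x := \sum_(k <- ks) curv k x.
have tS : tame 3 S by apply: tame_sum => j; exact: tame_curv.
have mS := tame_measurable tS.
have [C' [e0' [C'0 /andP[e0'0 e0'1] h]]] := heat_one_step k tS.
exists (C + C'), (Num.min e0 e0'); split; first exact: addr_ge0.
  by rewrite lt_min e00 e0'0 ge_min e01.
move=> e x /andP[e_gt0]; rewrite le_min => /andP[ee0 ee0'] /=.
have FS0 y : (0 <= (FS e S y)%:E)%E by rewrite lee_fin ltW// FS_gt0.
have F0' y : (0 <= (EFin \o F) y)%E by rewrite lee_fin ltW.
have mF' : measurable_fun [set: V] (EFin \o F) by exact/measurable_EFinP.
have mheats := measurable_heats mmove ks e mF' F0'.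
have scale (q : R) y : (q%:E * heat move k e (fun x => (FS e S x)%:E) y =
    heat move k e (fun x => (q)%:E * (FS e S x)%:E) y)%E -> True by [].
have eS y : FS e (fun x => \sum_(j <- (k :: ks)) curv j x) y =
    FS e (fun x => S x + curv k x) y.
  by rewrite /FS big_cons addrC.
have := h e x; rewrite e_gt0 ee0' => /(_ isT)/andP[lo hi].
have ihe y := ih e y; rewrite e_gt0 ee0 in ihe.
rewrite eS mulrDl opprD !expRD; apply/andP; split.
- apply: (@le_trans _ _ ((expR (- (C * e ^+ 3)))%:E * heat move k e (fun x => (FS e S x)%:E) x)%E).
    by rewrite mulrCA EFinM lee_wpmul2l ?lee_fin ?expR_ge0.
  rewrite -heatZ ?expR_ge0//; last exact: measurable_FS.
  apply: le_heat => //.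
  + by apply: emeasurable_funM => //; exact: measurable_FS.
  + by move=> y; rewrite mule_ge0// lee_fin expR_ge0.
  + by move=> y; rewrite -EFinM mulrC; have /andP[] := ihe y isT.
- apply: (@le_trans _ _ ((expR (C * e ^+ 3))%:E * heat move k e (fun x => (FS e S x)%:E) x)%E).
    rewrite -heatZ ?expR_ge0//; last exact: measurable_FS.
    apply: le_heat => //.
    + by move=> y; exact: heats_ge0.
    + by apply: emeasurable_funM => //; exact: measurable_FS.
    + by move=> y; rewrite -EFinM mulrC; have /andP[] := ihe y isT.
  by rewrite [X in (_ <= X%:E)%E]mulrCA EFinM lee_wpmul2l ?lee_fin ?expR_ge0.
Qed.

(** The upper estimate for [X] and the lower one for [Y] have ordered exponents at order e^2. What
    is left is exp((C + C') e^3), which disappears under subdivision of the flow. *)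
Lemma le_heats_of_curv (X Y : seq I) x :
  (forall x, \sum_(k <- X) curv k x <= \sum_(k <- Y) curv k x) ->
  (heats move X 1 (EFin \o F) x <= heats move Y 1 (EFin \o F) x)%E.
Proof.
move=> hXY; have [C [e0 [C0 /andP[e00 e01] hX]]] := heats_one_step X.
have [C' [e0' [C'0 /andP[e0'0 e0'1] hY]]] := heats_one_step Y.
have em0 : 0 < Num.min e0 e0' by rewrite lt_min e00.
have F0' y : (0 <= (EFin \o F) y)%E by rewrite lee_fin ltW.
have mF' : measurable_fun [set: V] (EFin \o F) by exact/measurable_EFinP.
apply: (le_heats_of_small_time moveD moveC mmove (C := C + C') _ em0) => // e y.
rewrite le_min => /and3P[e_gt0 ee0 ee0'].
have := hX e y; rewrite e_gt0 ee0 => /(_ isT)/andP[_ /le_trans]; apply.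
have := hY e y; rewrite e_gt0 ee0' => /(_ isT)/andP[+ _] => hlo.
apply: (@le_trans _ _ ((expR ((C + C') * e ^+ 3))%:E *
  (FS e (fun x => \sum_(k <- Y) curv k x) y * expR (- (C' * e ^+ 3)))%:E)%E); last first.
  by rewrite lee_wpmul2l// lee_fin expR_ge0.
rewrite -EFinM lee_fin [leRHS]mulrCA -expRD.
rewrite (_ : (C + C') * e ^+ 3 + - (C' * e ^+ 3) = C * e ^+ 3); last by ring.
rewrite ler_wpM2r ?expR_ge0// ler_wpM2l ?(ltW (F0 y))// ler_expR ler_wpM2l//.
by rewrite mulr_ge0// sqr_ge0.
Qed.

End heat_comparison.

(** * Smoothed minima of Gordon's process *)

Section softmin.
Context d (V : measurableType d) (R : realType) (I J : finType) (m : nat).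
Variable move : I -> R -> V -> V.
Variables (z : J -> 'I_m -> V -> R) (s : J -> V -> R).
Variables (zc : I -> J -> 'I_m -> R) (sc : I -> J -> R).
Hypothesis mz : forall u i, measurable_fun [set: V] (z u i).
Hypothesis ms : forall u, measurable_fun [set: V] (s u).
Hypothesis z_move : forall k r x u i, z u i (move k r x) = z u i x + zc k u i * r.
Hypothesis s_move : forall k r x u, s u (move k r x) = s u x + sc k u * r.
Variables (j0 : J) (delta p c : R).
Hypotheses (delta0 : 0 < delta) (p1 : 1 <= p).

Let p0 : 0 < p. Proof. exact: lt_le_trans p1. Qed.

(** The term [delta ^+ 2] keeps the length away from 0, which makes it smooth with bounded
    derivatives. *)
Definition sqlen u x := delta ^+ 2 + \sum_i z u i x ^+ 2.
Definition len u x := Num.sqrt (sqlen u x).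
Definition dir u i x := z u i x / len u x.
Definition energy u x := expR (p * (- c * (len u x + s u x))).
Definition partition x := \sum_u energy u x.
Definition gibbs u x := energy u x / partition x.
(** The l^p norm over [u] of exp(-c (len + s)): it lies between the largest of these numbers and
    that number times the p-th root of the number of directions. *)
Definition softmax x := expR (p^-1 * ln (partition x)).

Definition dlen k u x := \sum_i dir u i x * zc k u i.
Definition dpot k u x := - c * (dlen k u x + sc k u).
Definition ddpot k u x := - c * ((len u x)^-1 * (\sum_i zc k u i ^+ 2 - dlen k u x ^+ 2)).
(** Logarithmic derivative of [softmax] in direction [k]: the Gibbs mean of the derivatives [dpot]
    of the potential -c (len + s). Its own derivative [ddsoft] is [p] times a Gibbs variance plus
    the mean of the second derivatives [ddpot]. *)
Definition dsoft k x := \sum_u gibbs u x * dpot k u x.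
Definition ddsoft k x :=
  \sum_u (p * gibbs u x * (dpot k u x - dsoft k x) * dpot k u x + gibbs u x * ddpot k u x).

Lemma sqlen_gt0 u x : 0 < sqlen u x.
Proof. by rewrite ltr_wpDr ?exprn_gt0// sumr_ge0// => i _; exact: sqr_ge0. Qed.

Lemma len_gt0 u x : 0 < len u x.
Proof. by rewrite sqrtr_gt0 sqlen_gt0. Qed.

Lemma partition_gt0 x : 0 < partition x.
Proof.
rewrite /partition (bigD1 j0)//= ltr_wpDr ?expR_gt0// sumr_ge0// => u _.
exact: expR_ge0.
Qed.

Lemma gibbs_ge0 u x : 0 <= gibbs u x.
Proof. by rewrite divr_ge0 ?expR_ge0// ltW// partition_gt0. Qed.

Lemma gibbs_sum x : \sum_u gibbs u x = 1.
Proof. by rewrite -mulr_suml divff// gt_eqF// partition_gt0. Qed.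

Lemma dir_sqr_sum u x : \sum_i dir u i x ^+ 2 <= 1.
Proof.
under eq_bigr do rewrite expr_div_n sqr_sqrtr ?(ltW (sqlen_gt0 _ _))//.
rewrite -mulr_suml ler_pdivrMr ?sqlen_gt0// mul1r lerDr.
exact: sqr_ge0.
Qed.

Lemma measurable_len u : measurable_fun [set: V] (len u).
Proof.
apply: (measurableT_comp (f := @Num.sqrt R)).
  exact: (continuous_measurable_fun (@sqrt_continuous R)).
apply: measurable_funD => //; apply: measurable_sum => i.
exact: measurable_funX.
Qed.

Lemma measurable_len_inv u : measurable_fun [set: V] (fun x => (len u x)^-1).
Proof.
rewrite (_ : (fun x => _) = fun x => expR (- ln (len u x))).
  apply: measurableT_comp => //; apply: measurableT_comp => //.
  by apply: (measurableT_comp (@measurable_ln R)); exact: measurable_len.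
by apply/funext => x; rewrite expRN lnK// posrE len_gt0.
Qed.

Lemma measurable_energy u : measurable_fun [set: V] (energy u).
Proof.
apply: measurableT_comp => //; apply: measurable_funM => //; apply: measurable_funM => //.
by apply: measurable_funD => //; exact: measurable_len.
Qed.

Lemma measurable_partition : measurable_fun [set: V] partition.
Proof. by apply: measurable_sum => u; exact: measurable_energy. Qed.

Lemma measurable_softmax : measurable_fun [set: V] softmax.
Proof.
apply: measurableT_comp => //; apply: measurable_funM => //.
by apply: (measurableT_comp (@measurable_ln R)); exact: measurable_partition.
Qed.

Lemma measurable_gibbs u : measurable_fun [set: V] (gibbs u).
Proof.
rewrite (_ : gibbs u = fun x => energy u x * expR (- ln (partition x))).
  apply: measurable_funM; first exact: measurable_energy.
  apply: measurableT_comp => //; apply: measurableT_comp => //.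
  by apply: (measurableT_comp (@measurable_ln R)); exact: measurable_partition.
by apply/funext => x; rewrite expRN lnK// posrE partition_gt0.
Qed.

Let dmove := is_dmove move.

Lemma dmove_z k u i : dmove k (z u i) (fun=> zc k u i).
Proof.
move=> x r; rewrite (_ : (fun t => _) = fun t => z u i x + zc k u i * t).
  apply: is_derive_eq (is_derive_add_fun (is_derive_cst_fun r _)
    (is_derive_mul_fun (is_derive_cst_fun r _) (is_derive_id r 1))) _.
  by rewrite mul0r !add0r mulr1.
by apply/funext => t; rewrite z_move.
Qed.

Lemma dmove_s k u : dmove k (s u) (fun=> sc k u).
Proof.
move=> x r; rewrite (_ : (fun t => _) = fun t => s u x + sc k u * t).
  apply: is_derive_eq (is_derive_add_fun (is_derive_cst_fun r _)
    (is_derive_mul_fun (is_derive_cst_fun r _) (is_derive_id r 1))) _.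
  by rewrite mul0r !add0r mulr1.
by apply/funext => t; rewrite s_move.
Qed.

Lemma dmove_len k u : dmove k (len u) (dlen k u).
Proof.
move=> x r; have dQ : is_derive r 1 (fun t => sqlen u (move k t x))
    (\sum_i 2 * z u i (move k r x) * zc k u i).
  apply: is_derive_eq (is_derive_add_fun (is_derive_cst_fun r (delta ^+ 2))
    (is_derive_sum_fun (fun i => is_derive_mul_fun (dmove_z k u i x r) (dmove_z k u i x r)))) _.
  by rewrite add0r; apply: eq_bigr => i _; ring.
apply: is_derive_eq (@is_derive_sqrt_fun _ (fun t => sqlen u (move k t x)) r _ (sqlen_gt0 _ _) dQ) _.
rewrite mulr_suml; apply: eq_bigr => i _; rewrite /dir /len.
by field; rewrite gt_eqF// sqrtr_gt0 sqlen_gt0.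
Qed.

Lemma dmove_len_inv k u : dmove k (fun x => (len u x)^-1)
  (fun x => - ((len u x)^-1 * (len u x)^-1 * dlen k u x)).
Proof.
move=> x r; apply: is_derive_eq (@is_derive_inv_fun _ (fun t => len u (move k t x)) r _
  (lt0r_neq0 (len_gt0 _ _)) (dmove_len k u x r)) _.
by rewrite expr2 invfM mulNr mulrC.
Qed.

Lemma dmove_dir k u i : dmove k (dir u i)
  (fun x => (len u x)^-1 * (zc k u i - dir u i x * dlen k u x)).
Proof.
move=> x r; apply: is_derive_eq (is_derive_mul_fun (dmove_z k u i x r) (dmove_len_inv k u x r)) _.
by rewrite /dir; ring.
Qed.

Lemma dmove_energy k u : dmove k (energy u) (fun x => energy u x * (p * dpot k u x)).
Proof.
move=> x r; apply: is_derive_eq (is_derive_expR_fun (is_derive_mul_fun (is_derive_cst_fun r p)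
  (is_derive_mul_fun (is_derive_cst_fun r (- c))
    (is_derive_add_fun (dmove_len k u x r) (dmove_s k u x r))))) _.
by rewrite !mul0r !add0r.
Qed.

Lemma dmove_partition k :
  dmove k partition (fun x => partition x * (p * dsoft k x)).
Proof.
move=> x r; apply: is_derive_eq (is_derive_sum_fun (fun u => dmove_energy k u x r)) _.
rewrite /dsoft mulrCA mulr_sumr mulr_sumr; apply: eq_bigr => u _; rewrite /gibbs.
by field; rewrite gt_eqF// partition_gt0.
Qed.

Lemma dmove_gibbs k u : dmove k (gibbs u)
  (fun x => p * gibbs u x * (dpot k u x - dsoft k x)).
Proof.
move=> x r; apply: is_derive_eq (is_derive_mul_fun (dmove_energy k u x r)
  (@is_derive_inv_fun _ (fun t => partition (move k t x)) r _
    (lt0r_neq0 (partition_gt0 _)) (dmove_partition k x r))) _.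
by rewrite /gibbs; field; rewrite gt_eqF// partition_gt0.
Qed.

Lemma dmove_softmax k : dmove k softmax (fun x => softmax x * dsoft k x).
Proof.
move=> x r; have dl : is_derive r 1 (fun t => ln (partition (move k t x))) (p * dsoft k (move k r x)).
  apply: is_derive_eq (@is_derive1_comp _ (@ln R) (fun t => partition (move k t x)) r _ _ (is_derive1_ln (partition_gt0 _))
    (dmove_partition k x r)) _.
  by field; rewrite gt_eqF// partition_gt0.
apply: is_derive_eq (is_derive_expR_fun (is_derive_mul_fun (is_derive_cst_fun r p^-1) dl)) _.
by rewrite /softmax; field; rewrite gt_eqF.
Qed.

Lemma dmove_dpot k u : dmove k (dpot k u) (ddpot k u).
Proof.
move=> x r; apply: is_derive_eq (is_derive_mul_fun (is_derive_cst_fun r (- c))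
  (is_derive_add_fun (is_derive_sum_fun (fun i =>
     is_derive_mul_fun (dmove_dir k u i x r) (is_derive_cst_fun r (zc k u i))))
   (is_derive_cst_fun r (sc k u)))) _.
rewrite mul0r add0r addr0 /ddpot; congr (_ * _).
rewrite expr2 [X in _ = _ * (_ - X * _)]/dlen mulrBr mulr_suml !mulr_sumr -sumrB.
by apply: eq_bigr => i _; ring.
Qed.

Lemma dmove_dsoft k : dmove k (dsoft k) (ddsoft k).
Proof.
move=> x r; apply: is_derive_eq (is_derive_sum_fun (fun u =>
  is_derive_mul_fun (dmove_gibbs k u x r) (dmove_dpot k u x r))) _.
by [].
Qed.

Lemma len_inv_le u x : `|(len u x)^-1| <= delta^-1.
Proof.
rewrite ger0_norm; last by rewrite invr_ge0 ltW// len_gt0.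
rewrite lef_pV2 ?posrE ?len_gt0//.
rewrite -(ger0_norm (ltW delta0)) -sqrtr_sqr ler_wsqrtr// lerDl sumr_ge0// => i _.
exact: sqr_ge0.
Qed.

Lemma dir_le u i x : `|dir u i x| <= 1.
Proof.
rewrite -(@ler_pXn2r _ 2)// ?nnegrE// expr1n real_normK ?num_real//.
apply: le_trans (dir_sqr_sum u x); rewrite (bigD1 i)//= lerDl sumr_ge0// => l _.
exact: sqr_ge0.
Qed.

Lemma gibbs_le u x : `|gibbs u x| <= 1.
Proof.
rewrite ger0_norm ?gibbs_ge0// -(gibbs_sum x) (bigD1 u)//= lerDl sumr_ge0// => l _.
exact: gibbs_ge0.
Qed.

Lemma measurable_dir u i : measurable_fun [set: V] (dir u i).
Proof. by apply: measurable_funM => //; exact: measurable_len_inv. Qed.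

Let T := tame move.

Lemma tame_dpot n k u : (forall i, T n (dir u i)) -> T n (dpot k u).
Proof.
move=> h; apply: tame_mul; first exact: tame_cst.
apply: tame_add; last exact: tame_cst.
by apply: tame_sum => i; apply: tame_mul; [exact: h|exact: tame_cst].
Qed.

(** The three families are treated by a joint induction, because the derivative of each is a
    polynomial in all three with constant coefficients. *)
Lemma tame_base n : [/\ forall u, T n (fun x => (len u x)^-1),
  forall u i, T n (dir u i) & forall u, T n (gibbs u)].
Proof.
elim: n => [|n [iha ihd ihg]].
  split=> [u|u i|u]; split => //.
  - exact: measurable_len_inv.
  - by exists delta^-1 => x; exact: len_inv_le.
  - exact: measurable_dir.
  - by exists 1 => x; exact: dir_le.
  - exact: measurable_gibbs.
  - by exists 1 => x; exact: gibbs_le.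
have tdlen k u : T n (dlen k u).
  by apply: tame_sum => i; apply: tame_mul; [exact: ihd|exact: tame_cst].
have tdsoft k : T n (dsoft k).
  by apply: tame_sum => u; apply: tame_mul; [exact: ihg|exact: tame_dpot].
split=> [u|u i|u]; split.
- exact: measurable_len_inv.
- by exists delta^-1 => x; exact: len_inv_le.
- move=> k; exists (fun x => - ((len u x)^-1 * (len u x)^-1 * dlen k u x)).
    exact: dmove_len_inv.
  rewrite (_ : (fun x => _) = fun x => 0 - (len u x)^-1 * (len u x)^-1 * dlen k u x).
    by apply: tame_sub; [exact: tame_cst|apply: tame_mul; [apply: tame_mul; exact: iha|exact: tdlen]].
  by apply/funext => x; rewrite sub0r.
- exact: measurable_dir.
- by exists 1 => x; exact: dir_le.
- move=> k; exists (fun x => (len u x)^-1 * (zc k u i - dir u i x * dlen k u x)).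
    exact: dmove_dir.
  by apply: tame_mul; [exact: iha|apply: tame_sub; [exact: tame_cst|apply: tame_mul; [exact: ihd|exact: tdlen]]].
- exact: measurable_gibbs.
- by exists 1 => x; exact: gibbs_le.
- move=> k; exists (fun x => p * gibbs u x * (dpot k u x - dsoft k x)).
    exact: dmove_gibbs.
  apply: tame_mul; first by apply: tame_mul; [exact: tame_cst|exact: ihg].
  by apply: tame_sub; [exact: tame_dpot|exact: tdsoft].
Qed.

Lemma tame_dsoft n k : T n (dsoft k).
Proof.
have [_ td tg] := tame_base n.
by apply: tame_sum => u; apply: tame_mul; [exact: tg|exact: tame_dpot].
Qed.

Lemma tame_ddsoft n k : T n (ddsoft k).
Proof.
have [ta td tg] := tame_base n.
apply: tame_sum => u; have tp := tame_dpot k (td u); apply: tame_add.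
  apply: tame_mul; last exact: tp.
  apply: tame_mul; first by apply: tame_mul; [exact: tame_cst|exact: tg].
  by apply: tame_sub; [exact: tp|exact: tame_dsoft].
have tl : T n (dlen k u) by apply: tame_sum => i; apply: tame_mul; [exact: td|exact: tame_cst].
apply: tame_mul; first exact: tg.
apply: tame_mul; first exact: tame_cst.
by apply: tame_mul; [exact: ta|apply: tame_sub; [exact: tame_cst|apply: tame_mul; exact: tl]].
Qed.

Definition gram (X : seq I) u v x := \sum_(k <- X) dpot k u x * dpot k v x.

(** The curvature is the squared Gibbs mean of [dpot] plus [p] times its Gibbs variance plus the
    mean of [ddpot]. Written over pairs of directions, the squared mean gets the coefficient 1 - p,
    which is nonpositive for p >= 1: larger covariances mean smaller curvature. *)
Lemma sum_curv_softmax (X : seq I) x :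
  \sum_(k <- X) curv dsoft ddsoft k x =
  (1 - p) * (\sum_u \sum_v gibbs u x * gibbs v x * gram X u v x) +
  p * (\sum_u gibbs u x * gram X u u x) +
  \sum_u gibbs u x * \sum_(k <- X) ddpot k u x.
Proof.
have -> : \sum_u \sum_v gibbs u x * gibbs v x * gram X u v x = \sum_(k <- X) dsoft k x ^+ 2.
  under eq_bigr do (under eq_bigr do rewrite /gram mulr_sumr; rewrite exchange_big /=).
  rewrite exchange_big /=; apply: eq_bigr => k _.
  rewrite expr2 {1}/dsoft mulr_suml; apply: eq_bigr => u _.
  by rewrite /dsoft mulr_sumr; apply: eq_bigr => v _; ring.
have -> : \sum_u gibbs u x * gram X u u x = \sum_(k <- X) \sum_u gibbs u x * dpot k u x ^+ 2.
  by rewrite exchange_big /=; apply: eq_bigr => u _; rewrite /gram mulr_sumr.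
have -> : \sum_u gibbs u x * (\sum_(k <- X) ddpot k u x) =
    \sum_(k <- X) \sum_u gibbs u x * ddpot k u x.
  by rewrite exchange_big /=; apply: eq_bigr => u _; rewrite mulr_sumr.
rewrite !mulr_sumr -!big_split /=; apply: eq_bigr => k _; rewrite /curv.
have -> : ddsoft k x = p * (\sum_u gibbs u x * dpot k u x ^+ 2) - p * dsoft k x ^+ 2 +
    \sum_u gibbs u x * ddpot k u x.
  rewrite /ddsoft big_split /=; congr (_ + _).
  rewrite expr2 {2}/dsoft mulr_suml !mulr_sumr -sumrB.
  by apply: eq_bigr => u _; ring.
by ring.
Qed.

Hypothesis move0 : forall k x, move k 0 x = x.
Hypothesis moveD : forall k s t x, move k s (move k t x) = move k (s + t) x.
Hypothesis moveC : forall k l s t x, move k s (move l t x) = move l t (move k s x).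
Hypothesis mmove : forall k,
  measurable_fun [set: V * measurableTypeR R] (fun xt => move k xt.2 xt.1).

Lemma le_heats_softmax (X Y : seq I) x :
  (forall u v x, gram Y u v x <= gram X u v x) ->
  (forall u x, gram Y u u x = gram X u u x) ->
  (forall u x, \sum_(k <- Y) ddpot k u x = \sum_(k <- X) ddpot k u x) ->
  (heats move X 1 (EFin \o softmax) x <= heats move Y 1 (EFin \o softmax) x)%E.
Proof.
move=> hg hgd hd.
apply: (@le_heats_of_curv _ _ _ _ move move0 moveD moveC mmove softmax dsoft ddsoft) => //.
- by move=> y; exact: expR_gt0.
- exact: measurable_softmax.
- exact: dmove_softmax.
- exact: dmove_dsoft.
- by move=> k; exact: (tame_dsoft 3 k).
- by move=> k; exact: (tame_ddsoft 3 k).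
move=> y; rewrite !sum_curv_softmax lerD//; last first.
  by apply: ler_sum => u _; rewrite hd.
rewrite lerD//; last first.
  by rewrite ler_pM2l//; apply: ler_sum => u _; rewrite hgd.
rewrite ler_wnM2l ?subr_le0//; apply: ler_sum => u _; apply: ler_sum => v _.
by apply: ler_wpM2l => //; apply: mulr_ge0; exact: gibbs_ge0.
Qed.

End softmin.

(** * Product coordinates *)

Section coordinates.
Context (I : finType) (R : realType).
Notation gauss := (@normal_prob R 0 1).

(** Points are tuples along the enumeration of [I], so that they carry the product sigma-algebra. *)
Definition coords := #|I|.-tuple (measurableTypeR R).
HB.instance Definition _ := Measurable.on coords.

Definition coord (x : coords) (k : I) : R := tnth x (enum_rank k).
Definition of_coords (f : I -> R) : coords := [tuple f (enum_val j) | j < #|I|].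
Definition shift_coord (k : I) (r : R) (x : coords) : coords :=
  of_coords (fun l => coord x l + (k == l)%:R * r).

Lemma coordK f k : coord (of_coords f) k = f k.
Proof. by rewrite /coord tnth_mktuple enum_rankK. Qed.

Lemma coordsP (x y : coords) : (forall k, coord x k = coord y k) -> x = y.
Proof. by move=> h; apply: eq_from_tnth => j; have := h (enum_val j); rewrite /coord enum_valK. Qed.

Lemma measurable_coord k : measurable_fun [set: coords] (fun x => coord x k).
Proof. exact: measurable_tnth. Qed.

Lemma measurable_of_coords d (T : measurableType d) (f : T -> I -> R) :
  (forall k, measurable_fun [set: T] (fun t => f t k)) ->
  measurable_fun [set: T] (fun t => of_coords (f t)).
Proof.
move=> h; apply/measurable_fun_tnthP => j.
rewrite (_ : _ \o _ = fun t => f t (enum_val j)); first exact: h.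
by apply/funext => t /=; rewrite tnth_mktuple.
Qed.

Lemma shift_coord0 k x : shift_coord k 0 x = x.
Proof. by apply: coordsP => l; rewrite coordK mulr0 addr0. Qed.

Lemma shift_coordD k r r' x :
  shift_coord k r (shift_coord k r' x) = shift_coord k (r + r') x.
Proof. by apply: coordsP => l; rewrite !coordK; ring. Qed.

Lemma shift_coordC k l r r' x :
  shift_coord k r (shift_coord l r' x) = shift_coord l r' (shift_coord k r x).
Proof. by apply: coordsP => j; rewrite !coordK; ring. Qed.

Lemma measurable_shift_coord k :
  measurable_fun [set: coords * measurableTypeR R] (fun xr => shift_coord k xr.2 xr.1).
Proof.
apply: measurable_of_coords => l; apply: measurable_funD.
  exact: (measurableT_comp (measurable_coord l) measurable_fst).
by apply: measurable_funM => //; exact: measurable_snd.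
Qed.

(** Each coordinate starts at 0 and is moved once, so its factor is integrated against the standard
    Gaussian and is constant for all other moves. *)
Lemma heats_prod (u : I -> R -> R) (ks : seq I) (x : coords) :
  (forall k r, 0 <= u k r) -> (forall k, measurable_fun [set: R] (u k)) ->
  uniq ks -> (forall k, k \in ks -> coord x k = 0) ->
  heats shift_coord ks 1 (fun x => (\prod_(k <- ks) u k (coord x k))%:E) x =
  (\prod_(k <- ks) \int[gauss]_r (u k r)%:E)%E.
Proof.
move=> u0 mu; elim: ks x => [|k ks ih] x /=; first by rewrite !big_nil.
move=> /andP[kks uks] x0; rewrite big_cons.
(* A factor left unchanged by the moves of [ls] comes out of their flow. *)
have pull (ls : seq I) (g : coords -> \bar R) (c : coords -> R) y :
    (forall y, 0 <= c y) -> measurable_fun setT g -> (forall y, 0 <= g y)%E ->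
    measurable_fun setT c ->
    (forall l r y, l \in ls -> c (shift_coord l r y) = c y) ->
    heats shift_coord ls 1 (fun y => (c y)%:E * g y)%E y = ((c y)%:E * heats shift_coord ls 1 g y)%E.
  move=> c0 mg g0 mc; elim: ls y => [//|l ls ihl] y hc /=.
  rewrite /heat -ge0_integralZl//; last 3 first.
  - by apply: (measurable_heat_integrand measurable_shift_coord); apply: (measurable_heats measurable_shift_coord).
  - by move=> r _; exact: heats_ge0.
  - by rewrite lee_fin.
  apply: eq_integral => r _; rewrite ihl; first by rewrite hc ?mem_head.
  by move=> l' r' y' h; apply: hc; rewrite inE h orbT.
pose g (y : coords) := (\prod_(l <- ks) u l (coord y l))%:E.
have mg : measurable_fun [set: coords] g.
  apply/measurable_EFinP; apply: measurable_prod => l _.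
  exact: (measurableT_comp (mu l) (measurable_coord l)).
have g0 y : (0 <= g y)%E by rewrite lee_fin prodr_ge0.
rewrite (_ : (fun y : coords => _) = fun y => ((u k (coord y k))%:E * g y)%E); last first.
  by apply/funext => y; rewrite big_cons EFinM.
rewrite /heat.
transitivity (\int[gauss]_r ((u k r)%:E * \prod_(l <- ks) \int[gauss]_r (u l r)%:E))%E.
  apply: eq_integral => r _; rewrite pull//; last 2 first.
  - exact: (measurableT_comp (mu k) (measurable_coord k)).
  - move=> l r' y lks; rewrite coordK (_ : l == k = false) ?mul0r ?addr0//.
    by apply/eqP => lk; rewrite -lk lks in kks.
  rewrite coordK eqxx mul1r mul1r x0 ?mem_head// add0r; congr (_ * _)%E.
  apply: ih => // l lks; rewrite coordK x0 ?inE ?lks ?orbT// (_ : k == l = false) ?mul0r ?addr0//.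
  by apply/eqP => kl; rewrite kl lks in kks.
rewrite ge0_integralZr//.
- by apply/measurable_EFinP; exact: mu.
- by move=> r _; rewrite lee_fin.
- by apply: prode_ge0 => l _; apply: integral_ge0 => r _; rewrite lee_fin.
Qed.

Definition rectangle (C : I -> set R) : set coords := [set x | forall k, C k (coord x k)].

Lemma measurable_rectangle (C : I -> set R) : (forall k, measurable (C k)) ->
  measurable (rectangle C).
Proof.
move=> mC; rewrite (_ : rectangle C = \bigcap_(k in [set: I]) ((fun x => coord x k) @^-1` C k)).
  apply: fin_bigcap_measurable => // k _.
  by rewrite -[X in measurable X]setTI; exact: measurable_coord.
by apply/seteqP; split => x /= h k; [move=> _|]; exact: h.
Qed.

(** Rectangles are stable under intersection and generate the product sigma-algebra: a generator
    constrains one coordinate and is a rectangle whose other sides are the whole line. *)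
Lemma coords_measurable_unique (m1 m2 : {measure set coords -> \bar R}) :
  (forall C : I -> set R, (forall k, measurable (C k)) -> m1 (rectangle C) = m2 (rectangle C)) ->
  (m1 setT < +oo)%E -> forall A, measurable A -> m1 A = m2 A.
Proof.
move=> h m1oo; pose G := [set rectangle C | C in [set C : I -> set R | forall k, measurable (C k)]].
have GT : G setT by exists (fun=> setT) => //; apply/seteqP; split.
apply: (@measure_unique _ _ coords G (fun=> setT)) => //.
- apply/seteqP; split => A.
    move=> mA; apply: (_ : _ `<=` _) mA; apply: smallest_sub; first exact: smallest_sigma_algebra.
    move=> B; rewrite -bigcup_seq /= => -[i _ [D mD <-]].
    apply: sub_sigma_algebra; exists (fun k => if k == enum_val i then D else setT).
      by move=> k; case: ifP.
    apply/seteqP; split => x /=.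
      by move=> hx; split => //; have := hx (enum_val i); rewrite eqxx /coord enum_valK.
    by move=> [_ hx] k; case: eqP => // ->; rewrite /coord enum_valK.
  apply: smallest_sub; first exact: sigma_algebra_measurable.
  by move=> _ [C mC <-]; exact: measurable_rectangle.
- move=> _ _ [C mC <-] [D mD <-]; exists (fun k => C k `&` D k).
    by move=> k; exact: measurableI.
  apply/seteqP; split => x /=.
    by move=> hx; split => k; have [] := hx k.
  by move=> [hC hD] k; split; [exact: hC|exact: hD].
- by rewrite bigcup_const//; exists 0%N.
- by move=> _ [C mC <-]; exact: h.
Qed.

End coordinates.

(** * Independent Gaussian families *)

Section gaussian_family.
Context (I : finType) (R : realType) d (T : measurableType d) (P : probability T R).
Variable xi : I -> T -> R.
Hypothesis mxi : forall k, measurable_fun [set: T] (xi k).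
Notation gauss := (@normal_prob R 0 1).
Local Open Scope ereal_scope.

Definition gaussian_family (ks : seq I) := forall B : I -> set R,
  (forall k, measurable (B k)) ->
  P [set t | forall k, k \in ks -> B k (xi k t)] = \prod_(k <- ks) gauss (B k).

(** Coordinates outside [ks] are 0, to match a flow that starts at the origin and moves only the
    coordinates in [ks]. *)
Definition sample (ks : seq I) (t : T) : coords I R :=
  of_coords (fun l => if l \in ks then xi l t else 0%R).

Lemma measurable_sample ks : measurable_fun [set: T] (sample ks).
Proof. by apply: measurable_of_coords => k; case: (k \in ks). Qed.

Lemma gaussian_family_behead k ks : k \notin ks ->
  gaussian_family (k :: ks) -> gaussian_family ks.
Proof.
move=> kks h B mB; pose B' l := if l == k then setT else B l.
have /h : forall l, measurable (B' l) by move=> l; rewrite /B'; case: ifP.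
have B'k : B' k = setT by rewrite /B' eqxx.
have gT : gauss setT = 1 := @probability_setT _ _ _ gauss.
rewrite big_cons B'k gT mul1e.
have eB l : l \in ks -> B' l = B l.
  by move=> lks; rewrite /B'; case: eqP => // lk; rewrite -lk lks in kks.
rewrite (eq_big_seq (fun l => gauss (B l))) => [<-|l lks]; last by rewrite eB.
congr (P _); apply/seteqP; split => t /= ht l.
  by rewrite inE /B'; case: eqP => //= _; exact: ht.
by move=> lks; rewrite -eB//; apply: ht; rewrite inE lks orbT.
Qed.

(** With [B] fixed, both sides are finite measures in [A], so it is enough to compare them on
    rectangles, where the joint law is known. *)
Lemma gaussian_family_indep k ks (A : set (coords I R)) (B : set R) : k \notin ks ->
  gaussian_family (k :: ks) -> measurable A -> measurable B ->
  P (sample ks @^-1` A `&` xi k @^-1` B) = P (sample ks @^-1` A) * gauss B.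
Proof.
move=> kks h mA mB.
have hks := gaussian_family_behead kks h.
have mkB : measurable (xi k @^-1` B).
  by rewrite -[X in measurable X]setTI; exact: mxi.
have gB0 : (0 <= fine (gauss B))%R by exact: fine_ge0.
pose m1 := image_measure (mrestr P mkB) (measurable_sample ks).
pose m2 := mscale (NngNum gB0) (image_measure P (measurable_sample ks)).
have gBE : (fine (gauss B))%:E = gauss B by rewrite fineK// fin_num_measure.
have m1E D : m1 D = P (sample ks @^-1` D `&` xi k @^-1` B) by [].
have m2E D : m2 D = P (sample ks @^-1` D) * gauss B.
  by rewrite /m2 /= /mscale /= gBE muleC.
rewrite -m1E -m2E; apply: coords_measurable_unique => //; last first.
  by rewrite m1E preimage_setT setTI -ge0_fin_numE// fin_num_measure.
move=> C mC; apply: etrans (m1E _) _; apply: etrans _ (esym (m2E _)).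
(* If a side of the rectangle outside [ks] omits 0, the sample never meets the rectangle and both
   measures vanish. *)
have [hC|/existsNP[l /not_implyP[lks Cl]]] := pselect (forall l, l \notin ks -> C l 0%R); last first.
  rewrite (_ : sample ks @^-1` rectangle C = set0); first by rewrite set0I measure0 mul0e.
  apply/seteqP; split => // t /= /(_ l); rewrite coordK (negbTE lks); exact: Cl.
have eC : sample ks @^-1` rectangle C = [set t | forall l, l \in ks -> C l (xi l t)].
  apply/seteqP; split => t /= ht l.
    by move=> lks; have := ht l; rewrite coordK lks.
  by rewrite coordK; case: ifPn => lks; [exact: ht|exact: hC].
pose B' l := if l == k then B else C l.
have mB' l : measurable (B' l) by rewrite /B'; case: ifP.
have eB' l : l \in ks -> B' l = C l.
  by move=> lks; rewrite /B'; case: eqP => // lk; rewrite -lk lks in kks.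
rewrite eC (hks C mC); have := h B' mB'.
have B'k : B' k = B by rewrite /B' eqxx.
rewrite big_cons B'k (eq_big_seq (fun l => gauss (C l))) => [|l lks]; last by rewrite eB'.
rewrite muleC => <-; congr (P _); apply/seteqP; split => t /=.
  by move=> [ht hk] l; rewrite inE /B'; case: eqP => [->//|_ /=]; exact: ht.
move=> ht; split; last by have := ht k; rewrite mem_head /B' eqxx; exact.
by move=> l lks; rewrite -eB'//; apply: ht; rewrite inE lks orbT.
Qed.

Lemma sample_cons k ks t : k \notin ks ->
  sample (k :: ks) t = shift_coord k (xi k t) (sample ks t).
Proof.
move=> kks; apply: coordsP => l; rewrite !coordK inE [l == k]eq_sym.
by case: eqP => [<-|_]; rewrite ?(negbTE kks) ?mul0r ?mul1r ?addr0 ?add0r.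
Qed.

(** The flow from the origin with [e] = 1 is an expectation. The step for [k] is commuted next to
    [f]; as the new coordinate is independent of the others, the joint law is a product measure and
    Tonelli's theorem splits off the Gaussian integral. *)
Lemma integral_sample ks (f : coords I R -> \bar R) : uniq ks -> gaussian_family ks ->
  measurable_fun setT f -> (forall x, 0 <= f x) ->
  \int[P]_t f (sample ks t) = heats (@shift_coord I R) ks 1 f (of_coords (fun=> 0%R)).
Proof.
elim: ks f => [|k ks ih] f /=.
  move=> _ _ mf f0; rewrite /sample /= integral_cst//= (@probability_setT _ _ _ P) mule1.
  by [].
move=> /andP[kks uks] h mf f0.
have hks := gaussian_family_behead kks h.
have mheat : measurable_fun setT (heat (@shift_coord I R) k 1 f).
  exact: (measurable_heat (@measurable_shift_coord I R)).
rewrite (heat_heats (@shift_coordC I R) (@measurable_shift_coord I R))//.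
rewrite -ih//; last by move=> x; exact: heat_ge0.
under eq_integral do rewrite sample_cons//.
have mpair : measurable_fun [set: T] (fun t => (sample ks t, xi k t : measurableTypeR R)).
  by apply/measurable_fun_pairP; split; [exact: measurable_sample|exact: mxi].
pose X : {mfun T >-> coords I R} :=
  HB.pack (sample ks) (isMeasurableFun.Build _ _ _ _ _ (measurable_sample ks)).
pose PX := distribution P X.
pose g (xr : coords I R * measurableTypeR R) := f (shift_coord k xr.2 xr.1).
have mg : measurable_fun setT g.
  exact: (measurableT_comp mf (@measurable_shift_coord I R k)).
transitivity (\int[image_measure P mpair]_xr g xr).
  by rewrite ge0_integral_image// => xr; exact: f0.
transitivity (\int[PX \x gauss]_xr g xr).
  apply: eq_measure_integral => A mA _; apply/esym.
  apply: product_measure_unique => // B C mB mC.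
  exact: (gaussian_family_indep kks h mB mC).
rewrite fubini_tonelli1//; last by move=> xr; exact: f0.
rewrite (@ge0_integral_distribution _ _ _ _ _ P X).
- by apply: eq_integral => t _; apply: eq_integral => r _; rewrite /g /= mul1r.
- by apply: (measurable_fun_fubini_tonelli_F (m2 := gauss) g mg) => xr; exact: f0.
- by move=> x; apply: integral_ge0 => r _; exact: f0.
Qed.

End gaussian_family.

(** * Gordon's comparison *)

Section gordon.
Context (R : realType) (m n : nat) (J : finType) (w : J -> 'I_n -> R).
Variables (j0 : J) (delta p c : R).
Hypotheses (delta0 : 0 < delta) (p1 : 1 <= p) (c0 : 0 <= c).
Hypothesis w_unit : forall u, \sum_j w u j ^+ 2 = 1.
Notation gauss := (@normal_prob R 0 1).

Notation index := ('I_m * 'I_n + unit + 'I_m + 'I_n)%type.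
Definition iA (i : 'I_m) (j : 'I_n) : index := inl (inl (inl (i, j))).
Definition i0 : index := inl (inl (inr tt)).
Definition ig (i : 'I_m) : index := inl (inr i).
Definition ih (j : 'I_n) : index := inr j.
Notation point := (coords index R).
Notation shift := (@shift_coord index R).

(** [gvec] and [gscal] hold both processes at once. Where g and h vanish they reduce to A w and g0;
    where A and g0 vanish they reduce to g and h.w. The flows along [listX] and [listY] from the
    origin reach exactly these two kinds of points. *)
Definition gvec (u : J) (i : 'I_m) (x : point) :=
  \sum_j coord x (iA i j) * w u j + coord x (ig i).
Definition gscal (u : J) (x : point) := coord x i0 + \sum_j coord x (ih j) * w u j.
Definition gvecc (k : index) (u : J) (i : 'I_m) : R :=
  \sum_j (k == iA i j)%:R * w u j + (k == ig i)%:R.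
Definition gscalc (k : index) (u : J) : R := (k == i0)%:R + \sum_j (k == ih j)%:R * w u j.

Definition listA := [seq iA ij.1 ij.2 | ij <- index_enum ('I_m * 'I_n)%type].
Definition listX := listA ++ [:: i0].
Definition listY := map ig (index_enum 'I_m) ++ map ih (index_enum 'I_n).

Notation F := (softmax gvec gscal delta p c).

Lemma measurable_gvec u i : measurable_fun [set: point] (gvec u i).
Proof.
apply: measurable_funD; last exact: measurable_coord.
by apply: measurable_sum => j; apply: measurable_funM => //; exact: measurable_coord.
Qed.

Lemma measurable_gscal u : measurable_fun [set: point] (gscal u).
Proof.
apply: measurable_funD; first exact: measurable_coord.
by apply: measurable_sum => j; apply: measurable_funM => //; exact: measurable_coord.
Qed.

Lemma gvec_move k r x u i : gvec u i (shift k r x) = gvec u i x + gvecc k u i * r.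
Proof.
rewrite /gvec /gvecc coordK; under eq_bigr do rewrite coordK mulrDl mulrAC.
by rewrite big_split /= -mulr_suml; ring.
Qed.

Lemma gscal_move k r x u : gscal u (shift k r x) = gscal u x + gscalc k u * r.
Proof.
rewrite /gscal /gscalc coordK; under eq_bigr do rewrite coordK mulrDl mulrAC.
by rewrite big_split /= -mulr_suml; ring.
Qed.

Lemma sum_eqM (K : finType) (k : K) (f : K -> R) : \sum_l (k == l)%:R * f l = f k.
Proof.
rewrite (bigD1 k)//= eqxx mul1r big1 ?addr0// => l lk.
by rewrite eq_sym (negbTE lk) mul0r.
Qed.

Lemma gvecc_A i j u l : gvecc (iA i j) u l = (i == l)%:R * w u j.
Proof.
rewrite /gvecc /= addr0 -[RHS](@sum_eqM _ j (fun j => (i == l)%:R * w u j)).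
apply: eq_bigr => j' _; rewrite mulrA -natrM mulnb andbC.
by congr (_%:R * _).
Qed.

Lemma gvecc_0 u l : gvecc i0 u l = 0.
Proof. by rewrite /gvecc /= addr0 big1// => j _; rewrite mul0r. Qed.

Lemma gvecc_g i u l : gvecc (ig i) u l = (i == l)%:R.
Proof. by rewrite /gvecc /= big1 ?add0r// => j _; rewrite mul0r. Qed.

Lemma gvecc_h j u l : gvecc (ih j) u l = 0.
Proof. by rewrite /gvecc /= addr0 big1// => j' _; rewrite mul0r. Qed.

Lemma gscalc_A i j u : gscalc (iA i j) u = 0.
Proof. by rewrite /gscalc /= add0r big1// => j' _; rewrite mul0r. Qed.

Lemma gscalc_0 u : gscalc i0 u = 1.
Proof. by rewrite /gscalc /= big1 ?addr0// => j' _; rewrite mul0r. Qed.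

Lemma gscalc_g i u : gscalc (ig i) u = 0.
Proof. by rewrite /gscalc /= add0r big1// => j' _; rewrite mul0r. Qed.

Lemma gscalc_h j u : gscalc (ih j) u = w u j.
Proof. by rewrite /gscalc /= add0r -[RHS](@sum_eqM _ j (w u)). Qed.

Let dl k u x := dlen gvec gvecc delta k u x.
Let dr u i x := dir gvec delta u i x.

Lemma dlen_A i j u x : dl (iA i j) u x = dr u i x * w u j.
Proof.
rewrite /dl /dlen -[RHS](@sum_eqM _ i (fun i => dr u i x * w u j)).
by apply: eq_bigr => l _; rewrite gvecc_A mulrCA.
Qed.

Lemma dlen_0 u x : dl i0 u x = 0.
Proof. by rewrite /dl /dlen big1// => i _; rewrite gvecc_0 mulr0. Qed.

Lemma dlen_g i u x : dl (ig i) u x = dr u i x.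
Proof.
rewrite /dl /dlen -[RHS](@sum_eqM _ i (fun i => dr u i x)).
by apply: eq_bigr => l _; rewrite gvecc_g mulrC.
Qed.

Lemma dlen_h j u x : dl (ih j) u x = 0.
Proof. by rewrite /dl /dlen big1// => i _; rewrite gvecc_h mulr0. Qed.

Lemma big_listX (f : index -> R) :
  \sum_(k <- listX) f k = \sum_i \sum_j f (iA i j) + f i0.
Proof.
rewrite big_cat big_seq1 /=; congr (_ + _).
by rewrite big_map /= [RHS](pair_bigA _ (fun i j => f (iA i j))).
Qed.

Lemma big_listY (f : index -> R) :
  \sum_(k <- listY) f k = \sum_i f (ig i) + \sum_j f (ih j).
Proof. by rewrite big_cat /= !big_map. Qed.

Let gr X u v x := gram gvec gvecc gscalc delta c X u v x.

Lemma gram_X u v x : gr listX u v x =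
  c ^+ 2 * ((\sum_i dr u i x * dr v i x) * (\sum_j w u j * w v j) + 1).
Proof.
rewrite /gr /gram big_listX /dpot -!/(dl _ _ _) !dlen_0 !gscalc_0 !add0r !mulr1.
rewrite mulrDr mulr1 [in RHS]mulr_suml mulr_sumr; congr (_ + _); last by ring.
apply: eq_bigr => i _; rewrite !mulr_sumr; apply: eq_bigr => j _.
by rewrite -!/(dl _ _ _) !dlen_A !gscalc_A; ring.
Qed.

Lemma gram_Y u v x : gr listY u v x =
  c ^+ 2 * (\sum_i dr u i x * dr v i x + \sum_j w u j * w v j).
Proof.
rewrite /gr /gram big_listY /dpot mulrDr !mulr_sumr; congr (_ + _); apply: eq_bigr => i _.
  by rewrite -!/(dl _ _ _) !dlen_g !gscalc_g; ring.
by rewrite -!/(dl _ _ _) !dlen_h !gscalc_h; ring.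
Qed.

Lemma sum_prod_le1 (K : finType) (f g : K -> R) :
  \sum_k f k ^+ 2 <= 1 -> \sum_k g k ^+ 2 <= 1 -> \sum_k f k * g k <= 1.
Proof.
move=> hf hg; apply: (@le_trans _ _ (\sum_k (f k ^+ 2 + g k ^+ 2) / 2)).
  by apply: ler_sum => k _; have := sqr_ge0 (f k - g k); nra.
by rewrite -mulr_suml big_split /=; lra.
Qed.

Lemma gordon_comparison x : (heats shift listX 1 (EFin \o F) x <= heats shift listY 1 (EFin \o F) x)%E.
Proof.
apply: (@le_heats_softmax _ _ _ _ _ _ shift gvec gscal gvecc gscalc) => //.
- exact: measurable_gvec.
- exact: measurable_gscal.
- exact: gvec_move.
- exact: gscal_move.
- exact: shift_coord0.
- exact: shift_coordD.
- exact: shift_coordC.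
- exact: measurable_shift_coord.
- move=> u v y; rewrite -!/(gr _ _ _ _) gram_X gram_Y ler_wpM2l ?sqr_ge0//.
  have D1 : \sum_i dr u i y * dr v i y <= 1.
    by apply: sum_prod_le1; exact: dir_sqr_sum.
  have W1 : \sum_j w u j * w v j <= 1 by apply: sum_prod_le1; rewrite w_unit.
  (* The difference D W + 1 - D - W equals (1 - D)(1 - W); both factors are nonnegative by
     Cauchy-Schwarz. *)
  by move: D1 W1; set D := \sum_i _; set W := \sum_i _; nra.
- move=> u y; rewrite -!/(gr _ _ _ _) gram_X gram_Y.
  have -> : \sum_j w u j * w u j = 1 by rewrite -(w_unit u); apply: eq_bigr => j _; rewrite expr2.
  by rewrite mulr1.
(* The traces of the Hessian of the length agree: for fixed i, the entries A i j contribute w_j^2 (1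
   - dir_i^2), whose sum over j is the contribution 1 - dir_i^2 of g i because w is a unit
   vector. *)
- move=> u y; rewrite big_listX big_listY /ddpot -!/(dl _ _ _).
  rewrite dlen_0 [X in _ = _ + X](_ : _ = 0); last first.
    by rewrite big1 => [|i _]; rewrite ?gvecc_0; ring.
  rewrite [X in _ + X = _]big1 => [|j _]; last first.
    by rewrite -!/(dl _ _ _) dlen_h big1 => [|i _]; rewrite ?gvecc_h; ring.
  rewrite !addr0; apply: eq_bigr => i _; rewrite -!/(dl _ _ _) dlen_g.
  rewrite -mulr_sumr; congr (_ * _); rewrite -mulr_sumr; congr (_ * _).
  rewrite (eq_bigr (fun j => w u j ^+ 2 * (1 - dr u i y ^+ 2))).
    rewrite -mulr_suml w_unit mul1r; congr (_ - _).
    under eq_bigr do rewrite gvecc_g.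
    rewrite -[RHS](@sum_eqM _ i (fun=> 1)); apply: eq_bigr => l _.
    by rewrite mulr1 -natrX; case: (i == l).
  move=> j _; rewrite -!/(dl _ _ _) dlen_A.
  under eq_bigr do rewrite gvecc_A.
  rewrite (_ : \sum__ _ = w u j ^+ 2); first by ring.
  rewrite -[RHS](@sum_eqM _ i (fun=> w u j ^+ 2)); apply: eq_bigr => l _.
  by rewrite exprMn -natrX; case: (i == l).
Qed.

End gordon.

(** * The two sides of the comparison *)

Section gordon_bound.
Context (R : realType) (m n : nat) (J : finType) (w : J -> 'I_n -> R).
Variables (j0 : J) (delta p c : R).
Hypotheses (delta0 : 0 < delta) (p1 : 1 <= p) (c_ge0 : 0 <= c).
Hypothesis w_unit : forall u, \sum_j w u j ^+ 2 = 1.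
Notation gauss := (@normal_prob R 0 1).
Notation index := ('I_m * 'I_n + unit + 'I_m + 'I_n)%type.
Notation point := (coords index R).
Notation shift := (@shift_coord index R).
Notation origin := (of_coords (fun=> 0) : point).
Notation iA := (@iA m n).
Notation i0 := (@i0 m n).
Notation ig := (@ig m n).
Notation ih := (@ih m n).
Notation F := (softmax (gvec (m := m) w) (gscal w) delta p c).

Let p0 : 0 < p. Proof. exact: lt_le_trans p1. Qed.

Let mgv u i : measurable_fun [set: point] (gvec w u i).
Proof. exact: measurable_gvec. Qed.

Let mF : measurable_fun [set: point] (EFin \o F).
Proof.
apply/measurable_EFinP; apply: measurable_softmax => //.
exact: measurable_gscal.
Qed.

Let F_ge0 x : (0 <= (EFin \o F) x)%E.
Proof. by rewrite lee_fin expR_ge0. Qed.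

(** g0 enters all energies in the same way and hence factors out. Its exponential moment produces
    the factor exp(c^2/2) on the side of A. *)
Lemma softmax_shift0 r x : F (shift i0 r x) = expR (- c * r) * F x.
Proof.
have lenE u : len (gvec w) delta u (shift i0 r x) = len (gvec w) delta u x.
  rewrite /len /sqlen; congr (Num.sqrt (_ + _)); apply: eq_bigr => i _.
  by rewrite gvec_move gvecc_0 mul0r addr0.
have eE u : energy (gvec w) (gscal w) delta p c u (shift i0 r x) =
    expR (p * (- c * r)) * energy (gvec w) (gscal w) delta p c u x.
  rewrite /energy lenE gscal_move gscalc_0 -expRD; congr expR; ring.
rewrite /softmax /partition; under eq_bigr do rewrite eE.
rewrite -mulr_sumr lnM ?posrE ?expR_gt0//; last exact: (partition_gt0 _ _ j0).
rewrite expRK mulrDr expRD; congr (expR _ * _).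
by rewrite mulKf// gt_eqF.
Qed.

Lemma softmax_ge u x : expR (- c * (len (gvec w) delta u x + gscal w u x)) <= F x.
Proof.
rewrite ler_expR -[leLHS](mulKf (lt0r_neq0 p0)) ler_wpM2l ?invr_ge0 ?(ltW p0)//.
rewrite -[leLHS]expRK ler_ln ?posrE ?expR_gt0//; last exact: (partition_gt0 _ _ j0).
rewrite /partition (bigD1 u)//= lerDl sumr_ge0// => v _; exact: expR_ge0.
Qed.

Lemma sqrt_sum_le (K : finType) (f : K -> R) :
  Num.sqrt (delta ^+ 2 + \sum_k f k ^+ 2) <= delta + \sum_k `|f k|.
Proof.
have s0 : 0 <= \sum_k `|f k| by exact: sumr_ge0.
have d0 := ltW delta0.
rewrite -[leRHS]ger0_norm ?addr_ge0// -sqrtr_sqr ler_wsqrtr// sqrrD -addrA lerD2l.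
rewrite -[leLHS]add0r lerD//; first by rewrite mulrn_wge0// mulr_ge0.
rewrite expr2 mulr_suml; apply: ler_sum => k _.
rewrite -real_normK ?num_real// expr2 ler_wpM2l// (bigD1 k)//= lerDl.
exact: sumr_ge0.
Qed.

(** * Duality bound for the decoupled process |g| + h.w *)

Section upper.
Variables (S : {set 'I_n}) (nu Gam c3 gam : R) (qs : seq (R * R)).
Hypotheses (nu0 : 0 <= nu) (Gam0 : 0 < Gam) (gam0 : 0 < gam) (c3gam : c3 / 2 < gam).
Hypothesis cGam : c / (4 * Gam) = c3 / (4 * gam).
Hypothesis w_off : forall u j, j \notin S -> 0 <= w u j.
Hypothesis w_on : forall u j, j \in S -> w u j <= 0.
Hypothesis w_sum : forall u, \sum_j w u j <= 0.
Hypothesis qs_ge0 : forall q, q \in qs -> 0 <= q.2.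
Hypothesis qs_bound : forall r, 0 <= r ->
  expR (- c * r) <= \sum_(q <- qs) expR (q.1 - q.2 * r ^+ 2).

(** What remains of the j-th coefficient of -h.w after subtracting the multiplier [nu] of the
    constraint sum w <= 0, when the sign of w_j is prescribed. *)
Definition excess (j : 'I_n) (r : R) : R :=
  if j \in S then Num.max (r + nu) 0 else Num.max (- r - nu) 0.

(** Weak duality. Since sum w <= 0, subtracting [nu] from the coefficients can only increase the
    value; the sign constraints replace the coefficients by their positive parts; then x |w_j| <=
    Gam w_j^2 + x^2/(4 Gam) is summed, with sum w_j^2 = 1. *)
Lemma neg_inner_le u (h : 'I_n -> R) :
  - \sum_j h j * w u j <= Gam + \sum_j excess j (h j) ^+ 2 / (4 * Gam).
Proof.
apply: (@le_trans _ _ (\sum_j (Gam * w u j ^+ 2 + excess j (h j) ^+ 2 / (4 * Gam)))); last first.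
  by rewrite big_split /= -mulr_sumr w_unit mulr1.
apply: (@le_trans _ _ (\sum_j (- h j - nu) * w u j)).
  under [leRHS]eq_bigr do rewrite mulrBl mulNr.
  rewrite sumrB sumrN lerDl -mulr_sumr oppr_ge0.
  by rewrite mulr_ge0_le0.
apply: ler_sum => j _.
apply: (@le_trans _ _ (excess j (h j) * `|w u j|)).
  rewrite /excess; case: ifPn => jS.
    rewrite ler0_norm ?w_on// mulrN -mulNr ler_wnM2r ?w_on//.
    by rewrite lerNl opprB addrC opprK le_max lexx.
  by rewrite ger0_norm ?w_off// ler_wpM2r ?w_off// le_max lexx.
set x := excess j _; rewrite -(real_normK (num_real (w u j))).
have -> : Gam * `|w u j| ^+ 2 + x ^+ 2 / (4 * Gam) =
    x * `|w u j| + (x - 2 * Gam * `|w u j|) ^+ 2 / (4 * Gam).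
  by field; rewrite gt_eqF.
by rewrite lerDl divr_ge0 ?sqr_ge0// mulr_ge0// ltW.
Qed.

(** Factors of a bound that is a product over coordinates. A pair [q] of [qs] stands for the
    Gaussian exp(q.1 - q.2 r^2) in the mixture that dominates exp(-c r); [l] is its slope [q.2]. *)
Definition profile (l : R) (k : index) (r : R) : R :=
  match k with
  | inl (inr _) => expR (- l * r ^+ 2)
  | inr j => expR (c3 / (4 * gam) * excess j r ^+ 2)
  | _ => 1
  end.

Lemma measurable_excess j : measurable_fun [set: R] (excess j).
Proof.
rewrite /excess; case: (j \in S).
  by apply: measurable_maxr => //; exact: measurable_funD.
by apply: measurable_maxr => //; exact: measurable_funB.
Qed.

Lemma measurable_profile l k : measurable_fun [set: R] (profile l k).
Proof.
case: k => [[[ij|[]]|i]|j]; rewrite /profile; try exact: measurable_cst.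
  by apply: measurableT_comp => //; apply: measurable_funM => //; exact: measurable_funX.
apply: measurableT_comp => //; apply: measurable_funM => //.
by apply: measurable_funX; exact: measurable_excess.
Qed.

Lemma profile_ge0 l k r : 0 <= profile l k r.
Proof. by case: k => [[[ij|[]]|i]|j]; rewrite /profile// expR_ge0. Qed.

(** Invariant of the moves in g and h, true at the origin. *)
Let Q (x : point) := (forall i j, coord x (iA i j) = 0) /\ coord x i0 = 0.

Lemma softmax_le x : Q x ->
  F x <= \sum_(q <- qs) expR (p^-1 * ln #|J|%:R + c * Gam + q.1) *
    \prod_(k <- listY m n) profile q.2 k (coord x k).
Proof.
move=> [xA x0].
have gE u i : gvec w u i x = coord x (ig i).
  by rewrite /gvec big1 ?add0r// => j _; rewrite xA mul0r.
have sE u : gscal w u x = \sum_j coord x (ih j) * w u j by rewrite /gscal x0 add0r.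
pose r := Num.sqrt (\sum_i coord x (ig i) ^+ 2).
have r2 : r ^+ 2 = \sum_i coord x (ig i) ^+ 2.
  by rewrite sqr_sqrtr// sumr_ge0// => i _; exact: sqr_ge0.
pose Mx := \sum_j c3 / (4 * gam) * excess j (coord x (ih j)) ^+ 2.
have N0 : (0 : R) < #|J|%:R by rewrite ltr0n; apply/card_gt0P; exists j0.
have energy_le u : energy (gvec w) (gscal w) delta p c u x <=
    expR (p * (- c * r + (c * Gam + Mx))).
  rewrite ler_expR ler_wpM2l ?(ltW p0)//.
  have h1 : c * r <= c * len (gvec w) delta u x.
    rewrite ler_wpM2l// ler_wsqrtr// /sqlen.
    have -> : \sum_i gvec w u i x ^+ 2 = \sum_i coord x (ig i) ^+ 2.
      by apply: eq_bigr => i _; rewrite gE.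
    by rewrite lerDr sqr_ge0.
  have h2 : c * (- gscal w u x) <= c * Gam + Mx.
    apply: (@le_trans _ _ (c * (Gam + \sum_j excess j (coord x (ih j)) ^+ 2 / (4 * Gam)))).
      by rewrite ler_wpM2l// sE; exact: neg_inner_le.
    rewrite mulrDr lerD2l mulr_sumr le_eqVlt; apply/orP; left; apply/eqP.
    by apply: eq_bigr => j _; rewrite mulrCA mulrC -cGam.
  by move: h1 h2; rewrite mulrN => h1 h2; lra.
(* The sum over [J] costs the factor #|J|^(1/p), which disappears for large [p]. *)
have FE : F x <= expR (p^-1 * ln #|J|%:R + c * Gam + Mx) * expR (- c * r).
  rewrite -expRD ler_expR.
  rewrite [leRHS](_ : _ = p^-1 * (ln #|J|%:R + p * (- c * r + (c * Gam + Mx)))); last first.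
    by field; rewrite gt_eqF.
  rewrite ler_wpM2l ?invr_ge0 ?(ltW p0)//.
  rewrite -[X in _ + X]expRK -lnM ?posrE ?expR_gt0// ler_ln ?posrE ?mulr_gt0 ?expR_gt0//.
    apply: (@le_trans _ _ (\sum_(u in J) expR (p * (- c * r + (c * Gam + Mx))))).
      by apply: ler_sum => u _; exact: energy_le.
    by rewrite sumr_const mulr_natl.
  exact: (partition_gt0 _ _ j0).
apply: (le_trans FE).
apply: (le_trans (ler_wpM2l (expR_ge0 _) (qs_bound (sqrtr_ge0 _ : 0 <= r)))).
rewrite mulr_sumr; apply: ler_sum => q _; rewrite -expRD.
rewrite (_ : \prod_(k <- _) _ = expR (Mx - q.2 * r ^+ 2)); last first.
  rewrite big_cat /= !big_map /= r2 mulr_sumr -sumrN expRD mulrC.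
  by rewrite !expR_sum; congr (_ * _); apply: eq_bigr => i _; rewrite mulNr.
by rewrite -expRD ler_expR le_eqVlt; apply/orP; left; apply/eqP; ring.
Qed.

Lemma profile_integral_off l j : j \notin S ->
  (\int[gauss]_r (profile l (ih j) r)%:E = (w1 c3 nu gam)%:E)%E.
Proof.
move=> jS; rewrite -[RHS]w_gen_integral// -[RHS]ge0_integral_gauss_opp//.
  by apply: eq_integral => r _; rewrite /profile /= /excess (negbTE jS).
apply/measurable_EFinP; apply: measurableT_comp => //; apply: measurable_funM => //.
by apply: measurable_funX; apply: measurable_maxr => //; exact: measurable_funB.
Qed.

Lemma profile_integral_on l j : j \in S ->
  (\int[gauss]_r (profile l (ih j) r)%:E = (w2 c3 nu gam)%:E)%E.
Proof.
move=> jS; rewrite -[RHS]w_gen_integral//.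
by apply: eq_integral => r _; rewrite /profile /= /excess jS opprK.
Qed.

Lemma uniq_listY : uniq (listY m n).
Proof.
rewrite cat_uniq !map_inj_uniq ?index_enum_uniq => [|j j' []//|i i' []//].
by rewrite /= andbT; apply/hasPn => k /mapP[j _ ->]; apply/negP => /mapP[].
Qed.

Definition upper_bound : R :=
  expR (p^-1 * ln #|J|%:R + c * Gam) *
  (\sum_(q <- qs) expR q.1 * (Num.sqrt (1 + 2 * q.2))^-1 ^+ m) *
  (w2 c3 nu gam ^+ #|S| * w1 c3 nu gam ^+ (n - #|S|)).

Lemma heats_listY_le : (heats shift (listY m n) 1 (EFin \o F) origin <= upper_bound%:E)%E.
Proof.
pose f (q : R * R) (x : point) : \bar R := ((expR (p^-1 * ln #|J|%:R + c * Gam + q.1))%:E *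
    (\prod_(k <- listY m n) profile q.2 k (coord x k))%:E)%E.
have mprod l : measurable_fun [set: point]
    (fun x => (\prod_(k <- listY m n) profile l k (coord x k))%:E).
  apply/measurable_EFinP; apply: measurable_prod => k _.
  exact: (measurableT_comp (measurable_profile l k) (measurable_coord k)).
have prod0 l x : (0 <= (\prod_(k <- listY m n) profile l k (coord x k))%:E)%E.
  by rewrite lee_fin prodr_ge0// => k _; exact: profile_ge0.
have mf q : measurable_fun [set: point] (f q) by exact: emeasurable_funM.
have f0 q x : (0 <= f q x)%E by rewrite mule_ge0// lee_fin expR_ge0.
pose K (k : index) := if k is inl (inl _) then false else true.
have hK : all K (listY m n) by rewrite all_cat !all_map; apply/andP; split; apply/allP.
have QK k r y : K k -> Q y -> Q (shift k r y).
  case: k => [[//|i]|j] _ [yA y0]; split=> [i' j'|]; rewrite coordK /= mul0r addr0 //.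
apply: (@le_trans _ _ (heats shift (listY m n) 1 (fun x => \sum_(q <- qs) f q x)%E origin)).
  apply: (le_heats_on (@measurable_shift_coord _ _) (Q := Q) (K := K)) => //.
  - exact: emeasurable_sum.
  - by move=> x; exact: sume_ge0.
  - move=> x Qx; rewrite /f; under eq_bigr do rewrite -EFinM.
    by rewrite sumEFin lee_fin; exact: softmax_le.
  - by split=> [i j|]; rewrite coordK.
rewrite (heats_sum (@measurable_shift_coord _ _))//.
have prodE q : q \in qs -> (heats shift (listY m n) 1 (f q) origin =
    (expR (p^-1 * ln #|J|%:R + c * Gam + q.1) *
      ((Num.sqrt (1 + 2 * q.2))^-1 ^+ m * (w2 c3 nu gam ^+ #|S| * w1 c3 nu gam ^+ (n - #|S|))))%:E)%E.
  move=> qqs; rewrite (heatsZ (@measurable_shift_coord _ _)) ?expR_ge0// EFinM; congr (_ * _)%E.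
  rewrite heats_prod; first last.
  - by move=> k _; rewrite coordK.
  - exact: uniq_listY.
  - by move=> k; exact: measurable_profile.
  - by move=> k r; exact: profile_ge0.
  rewrite big_cat /= !big_map EFinM; congr (_ * _)%E.
    under eq_bigr do rewrite /= gauss_mgf_sqr ?qs_ge0//.
    by rewrite prodEFin prodr_const card_ord.
  rewrite (bigID (fun j => j \in S)) /= EFinM; congr (_ * _)%E.
    rewrite (eq_bigr (fun=> (w2 c3 nu gam)%:E)); last by move=> j; exact: profile_integral_on.
    by rewrite prodEFin prodr_const.
  rewrite (eq_bigr (fun=> (w1 c3 nu gam)%:E)); last by move=> j; exact: profile_integral_off.
  rewrite prodEFin prodr_const; congr (_ ^+ _)%:E.
  have e := cardC (mem S); rewrite card_ord in e.
  by rewrite -[X in (X - _)%N]e addKn; exact: eq_card.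
rewrite (eq_big_seq _ prodE) sumEFin lee_fin /upper_bound.
rewrite mulr_sumr mulr_suml le_eqVlt; apply/orP; left; apply/eqP.
by apply: eq_bigr => q _; rewrite expRD; ring.
Qed.

End upper.

(** * The coupled process, evaluated at the random matrix *)

Context d (T : measurableType d) (P : probability T R) (A : T -> 'M[R]_(m, n)).
Hypothesis hA : iid_std_normal P A.

Definition entry (k : index) (t : T) : R :=
  if k is inl (inl (inl (i, j))) then A t i j else 0.

Lemma measurable_entry k : measurable_fun [set: T] (entry k).
Proof. by case: k => [[[[i j]|[]]|i]|j]; rewrite /entry//; case: hA. Qed.

Lemma uniq_listA : uniq (listA m n).
Proof.
by rewrite map_inj_uniq ?index_enum_uniq// => -[i j] [i' j'] [-> ->].
Qed.

Lemma gaussian_family_entry : gaussian_family P entry (listA m n).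
Proof.
move=> B mB; have [mA [lawA indA]] := hA.
have := indA (fun i j => B (iA i j)) (fun i j => mB _).
rewrite (_ : \bigcap_(_ in _) _ = [set t | forall k, k \in listA m n -> B k (entry k t)]); last first.
  apply/seteqP; split => t /= ht.
    by move=> k /mapP[[i j] _ ->]; exact: (ht (i, j)).
  by move=> [i j] _; apply: (ht (iA i j)); apply/mapP; exists (i, j); rewrite ?mem_index_enum.
move=> ->; rewrite big_map /= -(pair_bigA _ (fun i j => gauss (B (iA i j)))) /=.
rewrite -prodEFin; apply: eq_bigr => i _; rewrite -prodEFin; apply: eq_bigr => j _.
rewrite (lawA i j _ (mB (iA i j))) fineK //.
by apply: fin_num_measure; exact: mB.
Qed.

Notation smp := (sample entry (listA m n)).

Lemma coord_sample_A i j t : coord (smp t) (iA i j) = A t i j.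
Proof. by rewrite coordK (_ : iA i j \in _)//; apply/mapP; exists (i, j); rewrite ?mem_index_enum. Qed.

Lemma coord_sample_out k t : k \notin listA m n -> coord (smp t) k = 0.
Proof. by move=> /negbTE h; rewrite coordK h. Qed.

(** [i0] is last in [listX], so its step acts first on [F] and yields the constant exp(c^2/2); the
    remaining flow is the expectation over the entries of A. *)
Lemma heats_listX :
  (heats shift (listX m n) 1 (EFin \o F) origin =
   (expR (c ^+ 2 / 2))%:E * \int[P]_t (F (smp t))%:E)%E.
Proof.
rewrite /heats /listX foldr_cat /= -/(heats _ _ _ _).
have hE : heat shift i0 1 (EFin \o F) = fun x => ((expR (c ^+ 2 / 2))%:E * (EFin \o F) x)%E.
  apply/funext => x; rewrite /heat.
  under eq_integral do rewrite mul1r /= softmax_shift0 EFinM.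
  rewrite ge0_integralZr ?lee_fin ?expR_ge0//.
    by rewrite gauss_mgf sqrrN.
  apply/measurable_EFinP; apply: measurableT_comp => //; exact: measurable_funM.
rewrite hE (heatsZ (@measurable_shift_coord _ _)) ?expR_ge0//; congr (_ * _)%E.
by rewrite -(integral_sample measurable_entry uniq_listA gaussian_family_entry).
Qed.

Lemma softmax_sample_ge u t :
  expR (- c * (delta + \sum_i `|\sum_j A t i j * w u j|)) <= F (smp t).
Proof.
apply: le_trans (softmax_ge u _); rewrite ler_expR ler_wnM2l ?oppr_le0//.
have out0 : i0 \notin listA m n by apply/negP => /mapP[].
have outg i : ig i \notin listA m n by apply/negP => /mapP[].
have outh j : ih j \notin listA m n by apply/negP => /mapP[].
rewrite /gscal coord_sample_out// big1 ?addr0 => [|j _]; last by rewrite coord_sample_out ?mul0r.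
apply: le_trans (sqrt_sum_le _) _; rewrite lerD2l le_eqVlt; apply/orP; left; apply/eqP.
apply: eq_bigr => i _; congr (`|_|); rewrite /gvec coord_sample_out// addr0.
by apply: eq_bigr => j _; rewrite coord_sample_A.
Qed.

End gordon_bound.

(** * Directions of failure *)

Lemma continuous_sum_fun (R : realType) (X : topologicalType) (I : Type) (r : seq I)
  (f : I -> X -> R) : (forall i, continuous (f i)) -> continuous (fun x => \sum_(i <- r) f i x).
Proof.
move=> h; elim: r => [|i r ih] x.
  by rewrite (_ : (fun x => _) = fun=> 0); [exact: cvg_cst|apply/funext => y; rewrite big_nil].
rewrite (_ : (fun x => _) = fun x => f i x + \sum_(j <- r) f j x).
  by apply: cvgD; [exact: h|exact: ih].
by apply/funext => y; rewrite big_cons.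
Qed.

Section null_directions.
Context (R : realType) (n : nat) (S : {set 'I_n}).

(* Unit directions pointing from [xtilde S] into the cube along which the l1 norm does not increase. *)
Definition bad_dir (v : 'I_n -> R) := [/\ forall j, j \in S -> v j <= 0, forall j, j \notin S -> 0 <= v j,
  \sum_j v j <= 0 & \sum_j v j ^+ 2 = 1].

Lemma bad_dir_le1 (v : 'I_n -> R) j : bad_dir v -> `|v j| <= 1.
Proof.
move=> [_ _ _ h]; rewrite -(@ler_pXn2r _ 2)// ?nnegrE// expr1n real_normK ?num_real// -h.
by rewrite (bigD1 j)//= lerDl sumr_ge0// => l _; exact: sqr_ge0.
Qed.

(** A competitor gives the direction x - xtilde after normalisation. Conversely, the full step from
    xtilde along a unit direction stays in the cube, since its coordinates are at most 1 in absolute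
    value and have the right signs. *)
Lemma recovery_failsP m (A : 'M[R]_(m, n)) :
  recovery_fails A S <-> exists2 v, bad_dir v & forall i, \sum_j A i j * v j = 0.
Proof.
have xtE j : xtilde R S j 0 = (j \in S)%:R by rewrite mxE.
have l1xt : l1norm (xtilde R S) = \sum_j xtilde R S j 0.
  by apply: eq_bigr => j _; rewrite xtE ger0_norm.
split.
- move=> /not_andP[|/existsNP[x /not_implyP[[Ax x01] /not_implyP[xne /negP]]]].
    by move=> /not_andP[//|/existsNP[j]]; rewrite xtE ler0n lern1 leq_b1.
  rewrite -leNgt l1xt (_ : l1norm x = \sum_j x j 0); last first.
    by apply: eq_bigr => j _; rewrite ger0_norm//; have /andP[] := x01 j.
  move=> l1; pose y j := x j 0 - xtilde R S j 0.
  have y2 : 0 < \sum_j y j ^+ 2.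
    rewrite lt_neqAle sumr_ge0 ?andbT => [|j _]; last exact: sqr_ge0.
    apply: contra xne; rewrite eq_sym psumr_eq0 => [|j _]; last exact: sqr_ge0.
    move=> /allP h; apply/eqP/colP => j; apply/eqP.
    by have := h j (mem_index_enum _); rewrite sqrf_eq0 subr_eq0.
  pose s := (Num.sqrt (\sum_j y j ^+ 2))^-1.
  have s0 : 0 < s by rewrite invr_gt0 sqrtr_gt0.
  exists (fun j => s * y j).
    split.
    - move=> j jS; rewrite pmulr_rle0// /y xtE jS subr_le0; have /andP[] // := x01 j.
    - move=> j /negbTE jS; rewrite pmulr_rge0// /y xtE jS subr0; have /andP[] // := x01 j.
    - by rewrite -mulr_sumr pmulr_rle0// sumrB subr_le0.
    - under eq_bigr do rewrite exprMn.
      by rewrite -mulr_sumr exprVn sqr_sqrtr ?(ltW y2)// mulVf// gt_eqF.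
  move=> i; have : (A *m x) i 0 = (A *m xtilde R S) i 0 by rewrite Ax.
  rewrite !mxE => /eqP; rewrite -subr_eq0 -sumrB => /eqP e.
  rewrite (eq_bigr (fun j => s * (A i j * x j 0 - A i j * xtilde R S j 0))).
    by rewrite -mulr_sumr e mulr0.
  by move=> j _; rewrite /y; ring.
- move=> [v hv Av] [_ h]; have [v_on v_off vsum v2] := hv.
  pose x := xtilde R S + \col_j v j.
  have xE j : x j 0 = (j \in S)%:R + v j by rewrite !mxE.
  have x01 j : 0 <= x j 0 <= 1.
    rewrite xE; have := bad_dir_le1 j hv; rewrite ler_norml => /andP[l1 l2].
    have [jS|jS] := boolP (j \in S); first by have := v_on j jS; rewrite mulr1n; lra.
    by have := v_off j jS; rewrite mulr0n; lra.
  have Ax : A *m x = A *m xtilde R S.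
    apply/colP => i; rewrite mulmxDr mxE [X in _ + X](_ : _ = 0) ?addr0//.
    by rewrite mxE -[RHS](Av i); apply: eq_bigr => j _; rewrite mxE.
  have xne : x != xtilde R S.
    apply/eqP => e; have v0 j : v j = 0.
      by have := xE j; rewrite e xtE => /eqP; rewrite eq_sym addrC -subr_eq0 addrK => /eqP.
    by move: v2; rewrite big1 => [/eqP|j _]; rewrite ?v0 ?expr0n// eq_sym oner_eq0.
  have := h x (conj Ax x01) xne; rewrite l1xt.
  rewrite (_ : l1norm x = \sum_j x j 0); last first.
    by apply: eq_bigr => j _; rewrite ger0_norm//; have /andP[] := x01 j.
  under [X in _ < X]eq_bigr do rewrite xE -xtE.
  by rewrite big_split /= -subr_gt0 addrAC subrr add0r ltNge vsum.
Qed.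

(** The cube [-1,1]^n is cut into cells of width 1/M and a representative is chosen in each cell
    that meets the set, so the net consists of bad directions; [v0] only fills the empty cells. *)
Lemma bad_dir_net (v0 : 'I_n -> R) (e : R) : bad_dir v0 -> 0 < e ->
  exists (J : finType) (_ : J) (w : J -> 'I_n -> R), (forall u, bad_dir (w u)) /\
  forall v, bad_dir v -> exists u, forall j, `|v j - w u j| <= e.
Proof.
move=> hv0 e0; pose M := (Num.truncn (e^-1)).+1.
have M0 : (0 : R) < M%:R by rewrite ltr0n.
have Me : M%:R^-1 <= e.
  have ei0 : 0 < e^-1 by rewrite invr_gt0.
  have /andP[_ h] := truncn_itv (ltW ei0).
  by rewrite -[leRHS]invrK lef_pV2 ?posrE//; exact: ltW.
(* Rescaled coordinates range over [0, 2M], and the value 2M is attained at v_j = 1; hence 2M + 1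
   values. *)
pose cell (v : 'I_n -> R) : {ffun 'I_n -> 'I_(2 * M).+1} := [ffun j => inord (Num.truncn ((v j + 1) * M%:R))].
pose has k := `[< exists2 v, bad_dir v & cell v = k >].
pose w k := if pselect (exists2 v, bad_dir v & cell v = k) is left h
  then projT1 (cid2 h) else v0.
exists {ffun 'I_n -> 'I_(2 * M).+1}, [ffun=> ord0], w; split.
  by move=> u; rewrite /w; case: pselect => // h; case: cid2.
move=> v hv; exists (cell v) => j; rewrite /w; case: pselect; last by case; exists v.
move=> h; case: cid2 => /= v' hv' /(congr1 (fun f : {ffun _} => f j)); rewrite !ffunE.
have bnd u : bad_dir u -> 0 <= (u j + 1) * M%:R /\ (Num.truncn ((u j + 1) * M%:R) < (2 * M).+1)%N.
  move=> hu; have := bad_dir_le1 j hu; rewrite ler_norml => /andP[l1 l2].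
  have p : 0 <= (u j + 1) * M%:R by rewrite mulr_ge0 ?(ltW M0)//; lra.
  split=> //; rewrite ltnS truncn_le_nat (@le_lt_trans _ _ (2 * M%:R))//.
    by rewrite ler_wpM2r ?(ltW M0)//; lra.
  by rewrite -natrM ltr_nat.
have [pv tv] := bnd v hv; have [pv' tv'] := bnd v' hv'.
move=> /(congr1 val); rewrite /= !inordK// => te.
have /andP[a1 a2] := truncn_itv pv; have /andP[b1 b2] := truncn_itv pv'.
rewrite te in b1 b2; apply: le_trans Me.
rewrite -(ler_pM2r M0) mulVf ?gt_eqF// -[X in _ * X](gtr0_norm M0) -normrM.
rewrite -natr1 in a2 b2.
by rewrite ler_norml; move: a1 a2 b1 b2; set q := _%:R; lra.
Qed.

Lemma compact_bad_dir : compact [set v : 'rV[R]_n | bad_dir (fun j => v 0 j)].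
Proof.
have cc j : continuous (fun v : 'rV[R]_n => v 0 j) by exact: coord_continuous.
have pc (f : 'rV[R]_n -> R) (D : set R) : continuous f -> closed D -> closed (f @^-1` D).
  by move=> cf cD; apply: preimage_closed => // x _; exact: cf.
apply: bounded_closed_compact.
  exists 1; split => // M M1 v /= hv; apply: (le_trans _ (ltW M1)).
  suff h : mx_norm v <= 1 by exact: h.
  have [->|/mx_norm_neq0[[i j] ->]] := eqVneq (mx_norm v) 0; first exact: ler01.
  by rewrite ord1; exact: (bad_dir_le1 j hv).
rewrite (_ : [set _ | _] =
  (\bigcap_(j in [set j | j \in S]) ((fun v : 'rV[R]_n => v 0 j) @^-1` [set x | x <= 0])) `&`
  (\bigcap_(j in [set j | j \notin S]) ((fun v : 'rV[R]_n => v 0 j) @^-1` [set x | 0 <= x])) `&`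
  ((fun v : 'rV[R]_n => \sum_j v 0 j) @^-1` [set x | x <= 0]) `&`
  ((fun v : 'rV[R]_n => \sum_j v 0 j ^+ 2) @^-1` [set x | x = 1])); last first.
  by apply/seteqP; split => v /=; [move=> []|move=> [[[]]]].
apply: closedI; last first.
  apply: pc; last exact: closed_eq.
  by apply: continuous_sum_fun => j v; exact: (cvgM (cc j v) (cc j v)).
apply: closedI; last by apply: pc; [exact: continuous_sum_fun|exact: closed_le].
apply: closedI; apply: closed_bigI => j _; apply: pc; try exact: cc.
  exact: closed_le.
exact: closed_ge.
Qed.

(** By compactness the continuous function |B v|_1 attains its minimum over bad directions, and the
    minimum is at most c/(k+1) for every k. *)
Lemma exists_null_bad_dir m (B : 'M[R]_(m, n)) (c : R) :
  (forall k : nat, exists2 v, bad_dir v & \sum_i `|\sum_j B i j * v j| <= c / k.+1%:R) ->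
  exists2 v, bad_dir v & forall i, \sum_j B i j * v j = 0.
Proof.
move=> h; pose K := [set v : 'rV[R]_n | bad_dir (fun j => v 0 j)].
pose f (v : 'rV[R]_n) := \sum_i `|\sum_j B i j * v 0 j|.
have inK v : bad_dir v -> K (\row_j v j).
  by move=> hv; rewrite /K /= (_ : (fun j => _) = v)//; apply/funext => j; rewrite mxE.
have fE v : f (\row_j v j) = \sum_i `|\sum_j B i j * v j|.
  by apply: eq_bigr => i _; congr (`|_|); apply: eq_bigr => j _; rewrite mxE.
have cf : continuous f.
  have ci i : continuous (fun u : 'rV[R]_n => \sum_j B i j * u 0 j).
    have cc j : continuous (fun v : 'rV[R]_n => v 0 j) by exact: coord_continuous.
    by apply: continuous_sum_fun => j u; exact: (cvgM (cvg_cst (B i j)) (cc j u)).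
  by apply: continuous_sum_fun => i v; exact: (cvg_norm (ci i v)).
have [|v Kv hv] := @EVT_min_rV R n f K _ compact_bad_dir (continuous_subspaceT cf).
  by have [v hv _] := h 0%N; exists (\row_j v j); exact: inK.
rewrite inE in Kv; exists (fun j => v 0 j) => // i.
have fk k : f v <= c / k.+1%:R.
  have [u hu uc] := h k; apply: le_trans uc; rewrite -fE; apply: hv.
  by rewrite inE; exact: inK.
have f0 : f v <= 0.
  have cv : (fun k : nat => c / k.+1%:R) @ \oo --> c * 0 by apply: cvgMl_tmp; exact: cvg_harmonic.
  by rewrite mulr0 in cv; apply: (cvgr_to_ge cv); exists 0%N => // k _; exact: fk.
apply/eqP; rewrite -normr_le0; apply: le_trans f0.
by rewrite /f (bigD1 i)//= lerDl sumr_ge0.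
Qed.

End null_directions.

Section failure_event.
Context (R : realType) (m n : nat) (S : {set 'I_n}).
Context d (T : measurableType d) (A : T -> 'M[R]_(m, n)).
Hypothesis mA : forall i j, measurable_fun [set: T] (fun t => A t i j).

(** Failure quantifies over uncountably many directions. Finite nets of mesh 1/(k+1) turn it into a
    countable intersection of finite unions; the tolerance is scaled by the size [nA t] of the
    matrix, so that a null direction always passes at a nearby net point. *)
Lemma measurable_recovery_fails : measurable [set t | recovery_fails (A t) S].
Proof.
have [[v0 hv0]|nv] := pselect (exists v : 'I_n -> R, bad_dir S v); last first.
  rewrite (_ : [set _ | _] = set0); first exact: measurable0.
  by apply/seteqP; split => // t /= /recovery_failsP[v hv _]; apply: nv; exists v.
have pos (k : nat) : (0 : R) < k.+1%:R^-1 by rewrite invr_gt0.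
pose net k := cid (bad_dir_net hv0 (pos k)).
pose J k := projT1 (net k).
pose w k : J k -> 'I_n -> R := projT1 (cid (projT2 (cid (projT2 (net k))))).
have hw k : (forall u, bad_dir S (@w k u)) /\
    forall v, bad_dir S v -> exists u, forall j, `|v j - @w k u j| <= k.+1%:R^-1.
  by rewrite /w; case: (cid (projT2 (cid (projT2 (net k))))).
pose nA t := \sum_i \sum_j `|A t i j|.
have mnA : measurable_fun [set: T] nA.
  by apply: measurable_sum => i; apply: measurable_sum => j; exact: measurableT_comp.
pose E k u := [set t | \sum_i `|\sum_j A t i j * @w k u j| <= nA t / k.+1%:R].
rewrite (_ : [set _ | _] = \bigcap_k \bigcup_(u in [set: J k]) E k u); last first.
  apply/seteqP; split => t /=.
    move=> /recovery_failsP[v hv Av] k _; have [u hu] := (hw k).2 v hv.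
    exists u => //; rewrite /E /= /nA mulr_suml; apply: ler_sum => i _.
    have -> : \sum_j A t i j * w k u j = \sum_j A t i j * (w k u j - v j).
      by under [RHS]eq_bigr do rewrite mulrBr; rewrite sumrB Av subr0.
    apply: (le_trans (ler_norm_sum _ _ _)); rewrite mulr_suml; apply: ler_sum => j _.
    by rewrite normrM distrC ler_wpM2l.
  move=> h; apply/recovery_failsP; apply: (@exists_null_bad_dir _ _ _ _ _ (nA t)) => k.
  by have [u _ hu] := h k I; exists (w k u) => //; exact: (hw k).1.
apply: bigcap_measurable => // k _; apply: fin_bigcup_measurable => // u _.
rewrite /E -[X in measurable X]setTI; apply: measurable_fun_le => //.
  apply: measurable_sum => i; apply: measurableT_comp => //.
  by apply: measurable_sum => j; exact: measurable_funM.
exact: measurable_funM.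
Qed.

End failure_event.

(** * The error probability at fixed n *)

Lemma w_gen_ge0 (R : realType) (c nu gam : R) : 0 < gam -> c / 2 < gam -> 0 <= w_gen c nu gam.
Proof.
move=> g0 cg; rewrite -lee_fin -w_gen_integral//; apply: integral_ge0 => z _.
by rewrite lee_fin expR_ge0.
Qed.

Section probability_bound.
Context (R : realType) (m n : nat) (S : {set 'I_n}).
Context d (T : measurableType d) (P : probability T R) (A : T -> 'M[R]_(m, n)).
Hypothesis hA : iid_std_normal P A.
Variables (c nu Gam c3 gam : R) (qs : seq (R * R)).
Hypotheses (c_ge0 : 0 <= c) (nu0 : 0 <= nu) (Gam0 : 0 < Gam) (gam0 : 0 < gam).
Hypotheses (c3gam : c3 / 2 < gam) (cGam : c / (4 * Gam) = c3 / (4 * gam)).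
Hypothesis qs_ge0 : forall q, q \in qs -> 0 <= q.2.
Hypothesis qs_bound : forall r, 0 <= r ->
  expR (- c * r) <= \sum_(q <- qs) expR (q.1 - q.2 * r ^+ 2).

Let B := (\sum_(q <- qs) expR q.1 * (Num.sqrt (1 + 2 * q.2))^-1 ^+ m) *
  (w2 c3 nu gam ^+ #|S| * w1 c3 nu gam ^+ (n - #|S|)).

Let B_ge0 : 0 <= B.
Proof.
rewrite mulr_ge0//.
  by rewrite sumr_ge0// => q _; rewrite mulr_ge0 ?expR_ge0// exprn_ge0// invr_ge0.
by rewrite mulr_ge0// exprn_ge0// w_gen_ge0.
Qed.

Let mA i j : measurable_fun [set: T] (fun t => A t i j).
Proof. by case: hA. Qed.

(** Bounding the entries lets the mesh of the net be fixed independently of the matrix. *)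
Let E (L : nat) := [set t | recovery_fails (A t) S] `&` [set t | forall i j, `|A t i j| <= L%:R].

Let mE L : measurable (E L).
Proof.
apply: measurableI; first exact: measurable_recovery_fails.
rewrite (_ : [set t | _] = \bigcap_(i in [set: 'I_m]) \bigcap_(j in [set: 'I_n])
    [set t | `|A t i j| <= L%:R]).
  apply: fin_bigcap_measurable => // i _; apply: fin_bigcap_measurable => // j _.
  rewrite -[X in measurable X]setTI; apply: measurable_fun_le => //.
  exact: measurableT_comp.
by apply/seteqP; split => t /= h i => [_ j _|j]; exact: h.
Qed.

Lemma prob_bounded_recovery_fails_le L (e : R) : 0 < e ->
  (P (E L) <= (expR ((2 * c + 1) * e) * (expR (- (c ^+ 2 / 2) + c * Gam) * B))%:E)%E.
Proof.
move=> e0; have [[v0 hv0]|nv] := pselect (exists v : 'I_n -> R, bad_dir S v); last first.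
  rewrite (_ : E L = set0); first by rewrite measure0 lee_fin; apply: mulr_ge0; [exact: expR_ge0|apply: mulr_ge0 => //; exact: expR_ge0].
  by apply/seteqP; split => // t [/recovery_failsP[v hv _] _]; apply: nv; exists v.
(* With this mesh the m n entries, each at most L, change |A w|_1 by at most [e]; the successor
   keeps the denominator positive. *)
pose e' := e / (m * n * L).+1%:R.
have e'0 : 0 < e' by rewrite divr_gt0.
have [J [j0 [w [hw net]]]] := bad_dir_net hv0 e'0.
(* Chosen so that the cost (ln #|J|)/p of the soft minimum is at most [e]. *)
pose p := 1 + ln #|J|%:R / e.
have N1 : (1 : R) <= #|J|%:R by rewrite ler1n; apply/card_gt0P; exists j0.
have p1 : 1 <= p by rewrite lerDl divr_ge0 ?ln_ge0// ltW.
have p0 : 0 < p by exact: lt_le_trans p1.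
have w_unit u : \sum_j w u j ^+ 2 = 1 by case: (hw u).
pose F := softmax (gvec (m := m) w) (gscal w) e p c.
pose smp t : coords ('I_m * 'I_n + unit + 'I_m + 'I_n)%type R := sample (entry A) (listA m n) t.
have key : ((expR (c ^+ 2 / 2))%:E * \int[P]_t (F (smp t))%:E <=
    (expR (p^-1 * ln #|J|%:R + c * Gam) * B)%:E)%E.
  rewrite -(heats_listX w j0 e c p1 hA).
  apply: (le_trans (gordon_comparison j0 c e0 p1 w_unit _)).
  rewrite [X in (_ <= X%:E)%E]mulrA; apply: (heats_listY_le m j0 e p1 c_ge0 w_unit nu0 Gam0 gam0 c3gam cGam) => //.
  - by move=> u j; have [_ h _ _] := hw u; exact: h.
  - by move=> u j; have [h _ _ _] := hw u; exact: h.
  - by move=> u; have [] := hw u.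
have mFs : measurable_fun [set: T] (fun t => (F (smp t))%:E).
  apply/measurable_EFinP; apply: (measurableT_comp (f := F)).
    by apply: measurable_softmax => //; [exact: measurable_gvec|exact: measurable_gscal].
  by apply: measurable_sample => k; exact: (measurable_entry hA).
(* On the event, a null direction has a net point where the smoothed length is at most 2 e: [e] from
   [delta] and [e] from the mesh. *)
have low t : E L t -> expR (- (2 * c * e)) <= F (smp t).
  move=> [/recovery_failsP[v hv Av] hL]; have [u hu] := net v hv.
  apply: le_trans (softmax_sample_ge w j0 e0 p1 c_ge0 A u t); rewrite ler_expR.
  rewrite mulNr lerN2 -mulrA mulrCA ler_wpM2l// mulr_natl mulr2n lerD2l.
  apply: (@le_trans _ _ (\sum_(i < m) \sum_(j < n) L%:R * e')).
    apply: ler_sum => i _.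
    have -> : \sum_j A t i j * w u j = \sum_j A t i j * (w u j - v j).
      by under [RHS]eq_bigr do rewrite mulrBr; rewrite sumrB Av subr0.
    apply: (le_trans (ler_norm_sum _ _ _)); apply: ler_sum => j _.
    by rewrite normrM distrC ler_pM.
  rewrite sumr_const card_ord sumr_const card_ord -mulrnA -[leLHS]mulr_natr mulrAC -natrM.
  rewrite /e' mulrCA ler_piMr ?(ltW e0)// ler_pdivrMr// mul1r ler_nat.
  by rewrite mulnC (mulnC n) leqW.
(* Markov's inequality for [F]. *)
have int_ge : ((expR (- (2 * c * e)))%:E * P (E L) <= \int[P]_t (F (smp t))%:E)%E.
  rewrite -integral_cst//.
  apply: (@le_trans _ _ (\int[P]_(t in E L) (F (smp t))%:E)%E).
    apply: ge0_le_integral => //; first by move=> t _; rewrite lee_fin expR_ge0.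
    exact: measurable_funTS.
  by apply: ge0_subset_integral => // t _; rewrite lee_fin expR_ge0.
have pN : p^-1 * ln #|J|%:R <= e.
  rewrite mulrC ler_pdivrMr// /p mulrDr mulr1 mulrCA divff ?gt_eqF// mulr1.
  by rewrite lerDr ltW.
have h1 : ((expR (c ^+ 2 / 2))%:E * ((expR (- (2 * c * e)))%:E * P (E L)) <=
    (expR (e + c * Gam) * B)%:E)%E.
  apply: (le_trans (lee_wpmul2l _ int_ge)); first by rewrite lee_fin expR_ge0.
  by apply: (le_trans key); rewrite lee_fin ler_wpM2r// ler_expR lerD2r.
have fP : P (E L) \is a fin_num by exact: fin_num_measure.
rewrite -(fineK fP) in h1 *.
move: h1; rewrite -!EFinM !lee_fin => h1.
rewrite -(ler_pM2l (expR_gt0 (c ^+ 2 / 2 - 2 * c * e))).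
rewrite expRD -[leLHS]mulrA (le_trans h1)// [leRHS]mulrA [in leRHS]mulrA.
apply: ler_wpM2r; first exact: B_ge0.
by rewrite -!expRD ler_expR; lra.
Qed.

(** The error [e] tends to 0 at fixed [L]; then [L] tends to infinity along increasing events. *)
Lemma prob_recovery_fails_le :
  (P [set t | recovery_fails (A t) S] <= (expR (- (c ^+ 2 / 2) + c * Gam) * B)%:E)%E.
Proof.
set K := expR _ * B.
have K0 : 0 <= K by rewrite mulr_ge0// expR_ge0.
have EK L : (P (E L) <= K%:E)%E.
  have fP : P (E L) \is a fin_num by exact: fin_num_measure.
  rewrite -(fineK fP) lee_fin.
  have cv : (fun k : nat => expR ((2 * c + 1) * k.+1%:R^-1) * K) @ \oo --> expR ((2 * c + 1) * 0) * K.
    apply: cvgMr_tmp; apply: (cvg_comp _ expR); last exact: continuous_expR.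
    by apply: cvgMl_tmp; exact: cvg_harmonic.
  rewrite mulr0 expR0 mul1r in cv; apply: (cvgr_to_ge cv); exists 0%N => // k _.
  by rewrite -lee_fin fineK//; apply: prob_bounded_recovery_fails_le; rewrite invr_gt0.
have -> : [set t | recovery_fails (A t) S] = \bigcup_L E L.
  apply/seteqP; split => t; last by move=> [L _ []].
  move=> ft; pose s := \sum_i \sum_j `|A t i j|.
  exists (Num.truncn s).+1 => //; split => // i j.
  have s0 : 0 <= s by apply: sumr_ge0 => k _; apply: sumr_ge0.
  have /andP[_ /ltW] := truncn_itv s0; apply: le_trans.
  rewrite /s (bigD1 i)//= (bigD1 j)//= -addrA lerDl addr_ge0 ?sumr_ge0// => k _.
  exact: sumr_ge0.
have ndE : nondecreasing_seq E.
  move=> L L' LL'; apply/subsetPset => t [ft hL]; split => // i j.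
  by apply: (le_trans (hL i j)); rewrite ler_nat.
have cvP : (P \o E) @ \oo --> P (\bigcup_L E L).
  by apply: nondecreasing_cvg_mu => //; exact: bigcupT_measurable.
rewrite -(cvg_lim _ cvP)//; apply: lime_le; first by apply/cvg_ex; eexists; exact: cvP.
by apply: nearW => L; exact: EK.
Qed.

End probability_bound.

(** * Laplace's method on a grid of radii *)

Section laplace_grid.
Context (R : realType) (alpha c3 : R).
Hypotheses (alpha0 : 0 < alpha) (c3_ge0 : 0 <= c3).
Local Notation s := (Num.sqrt alpha).

Let s0 : 0 < s. Proof. by rewrite sqrtr_gt0. Qed.
Let sE : s ^+ 2 = alpha. Proof. by rewrite sqr_sqrtr// ltW. Qed.

(** For g in dimension alpha n, (alpha - rho^2)/2 + alpha ln(rho / sqrt alpha) is the exponential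
    rate of the density of |g| / sqrt n at rho, so [I_sph] is the Laplace exponent of E exp(-c3 sqrt
    n |g|). *)
Lemma sphere_rate_le (rho : R) : 0 < rho ->
  - c3 * rho + (alpha - rho ^+ 2) / 2 + alpha * ln (rho / s) <= I_sph alpha c3.
Proof.
move=> rho0; set D := Num.sqrt (c3 ^+ 2 + 4 * alpha).
have D0 : 0 <= c3 ^+ 2 + 4 * alpha by rewrite addr_ge0 ?sqr_ge0// mulr_ge0// ltW.
have DE : D ^+ 2 = c3 ^+ 2 + 4 * alpha by rewrite sqr_sqrtr.
have cD : c3 < D by rewrite -[ltLHS]ger0_norm// -sqrtr_sqr ltr_sqrt ?ltrDl ?mulr_gt0// ltr_pwDr ?sqr_ge0 ?mulr_gt0.
(* The maximiser: the positive root of r0^2 + c3 r0 = alpha, equal to -2 [gamma_hat]. The bound ln(1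
   + x) <= x at r0 leaves a deficit of (rho - r0)^2 / 2. *)
pose r0 := (D - c3) / 2.
have r00 : 0 < r0 by rewrite divr_gt0// subr_gt0.
have r0E : r0 ^+ 2 + c3 * r0 = alpha.
  have -> : r0 ^+ 2 + c3 * r0 = (D ^+ 2 - c3 ^+ 2) / 4 by rewrite /r0; field.
  by rewrite DE; field.
have gE : gamma_hat alpha c3 = - r0 / 2 by rewrite /gamma_hat -/D /r0; field.
have -> : I_sph alpha c3 = - (r0 * c3) / 2 + alpha * ln (r0 / s).
  rewrite /I_sph gE.
  have -> : 1 - c3 / (2 * (- r0 / 2)) = (r0 / s) ^- 2.
    by rewrite [in RHS]exprMn [in RHS]exprVn sE -r0E; field; rewrite r0E !gt_eqF.
  have rs : 0 < r0 / s by exact: divr_gt0.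
  rewrite lnV ?posrE ?exprn_gt0//. by rewrite lnXn// -mulr_natl; field.
have -> : rho / s = (r0 / s) * (1 + (rho / r0 - 1)).
  by field; rewrite !gt_eqF.
have rr0 : 0 < rho / r0 by rewrite divr_gt0.
rewrite lnM; [|by rewrite posrE divr_gt0|by rewrite posrE addrC subrK].
have : alpha * ln (1 + (rho / r0 - 1)) <= alpha * (rho / r0 - 1).
  by rewrite ler_pM2l// le_ln1Dx// ltrBrDr addNr.
have -> : alpha * (rho / r0 - 1) = (r0 + c3) * rho - alpha.
  by rewrite -r0E; field; rewrite gt_eqF.
have := sqr_ge0 (rho - r0).
nra.
Qed.

Variable J : nat.
Hypothesis J0 : (0 < J)%N.

Definition grid_slope (j : nat) : R := ((J%:R / j.+1%:R) ^+ 2 - 1) / 2.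

(* With rho_j = sqrt alpha * j / J, term j dominates e^(-c3 n rho) for rho in
   [rho_j, rho_(j+1)]; its slope is the one for which a standard Gaussian g has
   E e^(-slope g^2) = rho_(j+1) / sqrt alpha, and vanishes for the last term,
   which therefore covers [rho_(J-1), oo). *)
Definition laplace_grid (n : nat) : seq (R * R) :=
  [seq (n%:R * (- c3 * (s * j%:R / J%:R) + (alpha - (s * j.+1%:R / J%:R) ^+ 2) / 2),
        grid_slope j) | j <- index_iota 0 J].

Let JR0 : (0 : R) < J%:R. Proof. by rewrite ltr0n. Qed.

Lemma grid_slope_ge0 j : (j < J)%N -> 0 <= grid_slope j.
Proof.
move=> jJ; rewrite divr_ge0// subr_ge0 -[leLHS](expr1n _ 2) ler_sqr ?nnegrE ?divr_ge0//.
by rewrite ler_pdivlMr// mul1r ler_nat.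
Qed.

Lemma sqrt_grid_slope j : (Num.sqrt (1 + 2 * grid_slope j))^-1 = j.+1%:R / J%:R.
Proof.
rewrite /grid_slope mulrCA divff// mulr1 addrC subrK sqrtr_sqr ger0_norm ?divr_ge0//.
by rewrite invf_div.
Qed.

Lemma laplace_grid_ge0 n q : q \in laplace_grid n -> 0 <= q.2.
Proof.
by move=> /mapP[j]; rewrite mem_index_iota => /andP[_ jJ] ->; exact: grid_slope_ge0.
Qed.

Lemma laplace_grid_bound n r : (0 < n)%N -> 0 <= r ->
  expR (- (c3 * Num.sqrt n%:R) * r) <=
    \sum_(q <- laplace_grid n) expR (q.1 - q.2 * r ^+ 2).
Proof.
move=> n0 r0; have n0R : (0 : R) < n%:R by rewrite ltr0n.
set a := Num.sqrt n%:R; have a0 : 0 < a by rewrite sqrtr_gt0.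
have aE : a ^+ 2 = n%:R by rewrite sqr_sqrtr// ltW.
pose rho := r / a; have rE : r = a * rho by rewrite /rho mulrCA divff ?mulr1// gt_eqF.
have rho0 : 0 <= rho by rewrite divr_ge0// ltW.
(* The cell containing [rho]; beyond sqrt alpha it is the last one, whose slope is 0. Only the term
   of this cell is kept in the sum. *)
have [j jJ [jl jr]] : exists2 j, (j < J)%N & s * j%:R / J%:R <= rho /\
    (j.+1 = J \/ rho <= s * j.+1%:R / J%:R).
  have [h|h] := leP s rho.
    exists J.-1; first by rewrite prednK.
    split; last by left; rewrite prednK.
    apply: le_trans h; rewrite ler_pdivrMr// ler_wpM2l ?(ltW s0)// ler_nat.
    exact: leq_pred.
  have x0 : 0 <= rho * J%:R / s by apply: divr_ge0; [exact: mulr_ge0|exact: ltW].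
  have /andP[h1 h2] := truncn_itv x0; exists (Num.truncn (rho * J%:R / s)).
    rewrite -(ltr_nat R); apply: le_lt_trans h1 _.
    by rewrite ltr_pdivrMr// mulrC ltr_pM2l.
  split; first by rewrite ler_pdivrMr// mulrC -ler_pdivlMr.
  by right; rewrite ler_pdivlMr// (mulrC s) -ler_pdivrMr// ltW.
rewrite big_map (bigD1_seq j)/= ?mem_index_iota ?iota_uniq//.
rewrite -[leLHS]addr0 lerD//; last by apply: sumr_ge0 => i _; exact: expR_ge0.
rewrite ler_expR rE [(a * rho) ^+ 2]exprMn aE.
have -> : - (c3 * a) * (a * rho) = n%:R * (- c3 * rho) by rewrite -aE; ring.
have -> : n%:R * (- c3 * (s * j%:R / J%:R) + (alpha - (s * j.+1%:R / J%:R) ^+ 2) / 2) -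
    grid_slope j * (n%:R * rho ^+ 2) =
   n%:R * (- c3 * (s * j%:R / J%:R) + grid_slope j * ((s * j.+1%:R / J%:R) ^+ 2 - rho ^+ 2)).
  rewrite (mulrBr (grid_slope j)) /grid_slope; have := sE; set t := s => <-.
  by field; rewrite !gt_eqF.
rewrite ler_pM2l// !mulNr.
have h1 : c3 * (s * j%:R / J%:R) <= c3 * rho by rewrite ler_wpM2l.
have h2 : 0 <= grid_slope j * ((s * j.+1%:R / J%:R) ^+ 2 - rho ^+ 2).
  case: jr => [jE|jr].
    by rewrite /grid_slope jE divff ?gt_eqF// expr1n subrr !mul0r.
  rewrite mulr_ge0 ?grid_slope_ge0// subr_ge0 ler_sqr// nnegrE.
  exact: le_trans jr.
by lra.
Qed.

(** Each of the J terms obeys [sphere_rate_le] at the right end of its cell. Evaluating the linear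
    part at the left end costs c3 sqrt(alpha) / J, and replacing m/n by alpha costs at most ln J
    times their distance. *)
Lemma laplace_grid_sum_le n m : (0 < n)%N ->
  \sum_(q <- laplace_grid n) expR q.1 * (Num.sqrt (1 + 2 * q.2))^-1 ^+ m <=
  expR (ln J%:R + n%:R * (I_sph alpha c3 + c3 * (s / J%:R) +
                            `|m%:R / n%:R - alpha| * ln J%:R)).
Proof.
move=> n0; have n0R : (0 : R) < n%:R by rewrite ltr0n.
rewrite expRD lnK ?posrE// mulr_natl; set b := expR _.
have -> : b *+ J = \sum_(0 <= j < J) b by rewrite sumr_const_nat subn0.
rewrite big_map {}/b.
rewrite big_seq [leRHS]big_seq; apply: ler_sum => j; rewrite mem_index_iota /= => jJ.
have x0 : 0 < j.+1%:R / J%:R :> R by rewrite divr_gt0.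
rewrite sqrt_grid_slope -[X in _ * X ^+ m](lnK (x := _)) ?posrE//.
rewrite -expRM_natl -expRD ler_expR.
set l := ln (j.+1%:R / J%:R).
have l1 : `|l| <= ln J%:R.
  rewrite ler_norml /l ln_div ?posrE// lerBrDr addrC subrr ln_ge0 ?ler1n//=.
  rewrite lerBlDr ler_wpDl ?ln_ge0 ?ler1n// ler_ln ?posrE// ler_nat.
  by case: j jJ {x0 l}.
have h : alpha * l - (m%:R / n%:R) * l >= - (`|m%:R / n%:R - alpha| * ln J%:R).
  rewrite -mulrBl lerNl -mulNr opprB; apply: (le_trans (ler_norm _)).
  by rewrite normrM ler_wpM2l.
have := @sphere_rate_le (s * j.+1%:R / J%:R).
rewrite !divr_gt0 ?mulr_gt0// => /(_ isT).
have -> : s * j.+1%:R / J%:R / s = j.+1%:R / J%:R by field; rewrite !gt_eqF.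
rewrite -/l => h2.
have -> : m%:R * l = n%:R * (m%:R / n%:R * l) by field; rewrite gt_eqF.
rewrite -mulrDr ler_pM2l//.
have -> : s * j%:R / J%:R = s * j.+1%:R / J%:R - s / J%:R.
  by rewrite -natr1; field; rewrite gt_eqF.
nra.
Qed.

End laplace_grid.

(** * The error exponent *)

(** The integrand is at least 1 for c >= 0. This makes [w1] and [w2] positive, so that their powers
    are exponentials of logarithms. *)
Lemma w_gen_ge1 (R : realType) (c nu gam : R) : 0 <= c -> c / 2 < gam -> 1 <= w_gen c nu gam.
Proof.
move=> c0 cg; have g0 : 0 < gam by apply: le_lt_trans cg; exact: divr_ge0.
rewrite -lee_fin -w_gen_integral//.
rewrite -(ge0_integral_gauss_cst 1).
apply: ge0_le_integral => //.
  apply/measurable_EFinP; apply: measurableT_comp => //; apply: measurable_funM => //.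
  apply: measurable_funX; apply: measurable_maxr => //.
  by apply: measurable_funB.
move=> z _; rewrite lee_fin -expR0 ler_expR mulr_ge0 ?sqr_ge0//.
by rewrite divr_ge0// mulr_ge0// ltW.
Qed.

Lemma limn_esup_le_lim (R : realType) (u : (\bar R)^nat) (v : R^nat) (l : R) :
  (\forall n \near \oo, (u n <= (v n)%:E)%E) -> v @ \oo --> l ->
  (limn_esup u <= l%:E)%E.
Proof.
move=> uv vl; apply/lee_addgt0Pr => e e0.
have [N _ hN] : \forall n \near \oo, (u n <= (l + e)%:E)%E.
  have ve : \forall n \near \oo, v n <= l + e by apply: (cvgr_le l vl); rewrite ltrDl.
  near=> n; apply: (@le_trans _ _ (v n)%:E); first by near: n.
  by rewrite lee_fin; near: n.
apply: (@le_trans _ _ (ereal_sup (u @` [set n | (N <= n)%N]))).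
  by apply: ereal_inf_lbound; exists [set n | (N <= n)%N] => //; exists N.
by apply: ge_ereal_sup => _ [n /= Nn <-]; exact: hN.
Unshelve. all: by end_near. Qed.

Lemma logE_scale_le (R : realType) (x : \bar R) (a b : R) : 0 < a ->
  (0 <= x)%E -> (x <= (expR b)%:E)%E -> (logE x * (a^-1)%:E <= (b / a)%:E)%E.
Proof.
move=> a0; case: x => [x||]//= x0 xb; have ai0 : 0 < a^-1 by rewrite invr_gt0.
(* A vanishing probability has logarithm -oo, which satisfies every bound. *)
case: eqVneq => [_|xn0]; first by rewrite gt0_mulNye ?leNye// lte_fin.
rewrite -EFinM lee_fin ler_pM2r// -ler_expR lnK//.
by rewrite posrE lt_neqAle eq_sym xn0.
Qed.

Section error_exponent.
Context (R : realType) (alpha beta : R).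
Hypothesis alpha0 : 0 < alpha.
Context (m : nat -> nat) (S : forall n : nat, {set 'I_n}).
Hypothesis hm : (fun n : nat => (m n)%:R / n%:R : R) @ \oo --> alpha.
Hypothesis hk : (fun n : nat => #|S n|%:R / n%:R : R) @ \oo --> beta.
Context d (T : measurableType d) (P : probability T R) (A : forall n : nat, T -> 'M[R]_(m n, n)).
Hypothesis hA : forall n : nat, iid_std_normal P (A n).
Variables c3 nu gam : R.
Hypotheses (c3_ge0 : 0 <= c3) (nu0 : 0 <= nu) (c3gam : c3 / 2 < gam).

Let gam0 : 0 < gam. Proof. by apply: le_lt_trans c3gam; exact: divr_ge0. Qed.

(** The grid size [J] stays fixed while [n] grows, so that ln J / n and |m/n - alpha| ln J vanish;
    only afterwards does [J] tend to infinity. *)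
Definition exponent_bound (J n : nat) : R :=
  - c3 ^+ 2 / 2 + c3 * gam + (ln J%:R / n%:R + (I_sph alpha c3 +
    c3 * (Num.sqrt alpha / J%:R) + `|(m n)%:R / n%:R - alpha| * ln J%:R)) +
  (#|S n|%:R / n%:R * ln (w2 c3 nu gam) + (1 - #|S n|%:R / n%:R) * ln (w1 c3 nu gam)).

Lemma prob_recovery_fails_exponent J n : (0 < J)%N -> (0 < n)%N ->
  (P [set t | recovery_fails (A n t) (S n)] <= (expR (n%:R * exponent_bound J n))%:E)%E.
Proof.
move=> J0 n0; have n0R : (0 : R) < n%:R by rewrite ltr0n.
have a0 : 0 < Num.sqrt n%:R :> R by rewrite sqrtr_gt0.
have aE : Num.sqrt n%:R ^+ 2 = n%:R :> R by rewrite sqr_sqrtr// ltW.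
have w10 : 0 < w1 c3 nu gam by apply: lt_le_trans (w_gen_ge1 _ c3_ge0 c3gam).
have w20 : 0 < w2 c3 nu gam by apply: lt_le_trans (w_gen_ge1 _ c3_ge0 c3gam).
(* The norm multiplier scales like c: with c = c3 sqrt n and Gam = gam sqrt n the quotient is free
   of n, and c Gam contributes c3 gam to the exponent. *)
have cGam : c3 * Num.sqrt n%:R / (4 * (gam * Num.sqrt n%:R)) = c3 / (4 * gam).
  by field; rewrite !gt_eqF.
have c_ge0 : 0 <= c3 * Num.sqrt n%:R by rewrite mulr_ge0// ltW.
have Gam0 : 0 < gam * Num.sqrt n%:R by rewrite mulr_gt0.
apply: le_trans (prob_recovery_fails_le (S n) (hA n) c_ge0 nu0 Gam0 gam0 c3gam cGam
  (@laplace_grid_ge0 _ alpha c3 J n) _) _.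
  by move=> r r0; exact: laplace_grid_bound.
rewrite lee_fin; set W := _ * w1 _ _ _ ^+ _.
have WE : W = expR (n%:R * (#|S n|%:R / n%:R * ln (w2 c3 nu gam) +
    (1 - #|S n|%:R / n%:R) * ln (w1 c3 nu gam))).
  have kn : (#|S n| <= n)%N by rewrite -[leqRHS](card_ord n) max_card.
  have powE (x : R) k : 0 < x -> x ^+ k = expR (k%:R * ln x).
    by move=> x0; rewrite expRM_natl lnK.
  rewrite /W (powE _ _ w20) (powE _ _ w10) -expRD natrB//; congr expR; field.
  by rewrite gt_eqF.
have sum_le := laplace_grid_sum_le alpha0 c3_ge0 J0 (m n) n0.
rewrite {}WE mulrA; move: sum_le; set X := (X in X <= _); set Y := (Y in _ <= expR Y).
move=> XY; apply: (@le_trans _ _ (expR (- ((c3 * Num.sqrt n%:R) ^+ 2 / 2) +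
  c3 * Num.sqrt n%:R * (gam * Num.sqrt n%:R)) * expR Y * expR (n%:R *
    (#|S n|%:R / n%:R * ln (w2 c3 nu gam) + (1 - #|S n|%:R / n%:R) * ln (w1 c3 nu gam))))).
  by apply: ler_wpM2r; [exact: expR_ge0|apply: ler_wpM2l; [exact: expR_ge0|exact: XY]].
rewrite /Y.
rewrite -!expRD ler_expR le_eqVlt; apply/orP; left; apply/eqP.
have -> : c3 * Num.sqrt n%:R * (gam * Num.sqrt n%:R) = n%:R * (c3 * gam) by rewrite mulrACA -expr2 aE mulrC.
rewrite exprMn aE /exponent_bound; field.
by rewrite !gt_eqF ?ltr0n.
Qed.

Lemma cvg_exponent_bound J : exponent_bound J @ \oo -->
  - c3 ^+ 2 / 2 + I_sph alpha c3 + inner_obj beta c3 nu gam + c3 * (Num.sqrt alpha / J%:R).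
Proof.
have -> : - c3 ^+ 2 / 2 + I_sph alpha c3 + inner_obj beta c3 nu gam + c3 * (Num.sqrt alpha / J%:R) =
  - c3 ^+ 2 / 2 + c3 * gam + (ln J%:R * 0 + (I_sph alpha c3 +
    c3 * (Num.sqrt alpha / J%:R) + `|alpha - alpha| * ln J%:R)) +
  (beta * ln (w2 c3 nu gam) + (1 - beta) * ln (w1 c3 nu gam)).
  by rewrite subrr normr0 /inner_obj; ring.
apply: cvgD.
  apply: cvgD; first exact: cvg_cst.
  apply: cvgD.
    apply: cvgM; first exact: cvg_cst.
    by rewrite -cvg_shiftS; exact: cvg_harmonic.
  apply: cvgD; first exact: cvg_cst.
  apply: cvgM; last exact: cvg_cst.
  apply: cvg_norm; apply: cvgB => //; exact: cvg_cst.
apply: cvgD; apply: cvgM => //; try exact: cvg_cst.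
by apply: cvgB => //; exact: cvg_cst.
Qed.

Lemma error_exponent_le :
  (limn_esup (fun n : nat => logE (P [set t | recovery_fails (A n t) (S n)]) * ((n%:R)^-1)%:E)
   <= (- c3 ^+ 2 / 2 + I_sph alpha c3 + inner_obj beta c3 nu gam)%:E)%E.
Proof.
set L := limn_esup _; set l := _ + inner_obj _ _ _ _.
have LJ J : (0 < J)%N -> (L <= (l + c3 * (Num.sqrt alpha / J%:R))%:E)%E.
  move=> J0; apply: limn_esup_le_lim (@cvg_exponent_bound J).
  exists 1%N => // n /= n0; have n0R : (0 : R) < n%:R by rewrite ltr0n.
  have -> : exponent_bound J n = n%:R * exponent_bound J n / n%:R by rewrite mulrAC divff ?mul1r// gt_eqF.
  by apply: logE_scale_le => //; exact: prob_recovery_fails_exponent.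
apply/lee_addgt0Pr => e e0.
pose x := c3 * Num.sqrt alpha / e.
have x0 : 0 <= x by rewrite divr_ge0 ?mulr_ge0 ?sqrtr_ge0// ltW.
have /andP[_ xJ] := truncn_itv x0.
(* This [J] exceeds c3 sqrt(alpha) / e, so the discretisation error is at most [e]. *)
apply: le_trans (LJ (Num.truncn x).+1 isT) _.
by rewrite lee_fin lerD2l mulrA ler_pdivrMr// (mulrC e) -ler_pdivrMr// ltW.
Qed.

End error_exponent.

Theorem theorem4 (R : realType) (alpha beta : R)
  (hb0 : 0 < beta) (hba : beta < alpha) (ha1 : alpha <= 1)
  (m : nat -> nat) (S : forall n : nat, {set 'I_n})
  (hm : (fun n : nat => (m n)%:R / n%:R : R) @ \oo --> alpha)
  (hk : (fun n : nat => #|S n|%:R / n%:R : R) @ \oo --> beta)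
  (d : measure_display) (T : measurableType d) (P : probability T R)
  (A : forall n : nat, T -> 'M[R]_(m n, n))
  (hA : forall n : nat, iid_std_normal P (A n)) :
  (limn_esup (fun n : nat =>
     logE (P [set t | recovery_fails (A n t) (S n)]) * ((n%:R)^-1)%:E)
   <= I_bin_ub alpha beta)%E.
Proof.
have alpha0 : 0 < alpha by exact: lt_trans hba.
apply: le_ereal_inf_tmp => _ [c3 [c3_ge0 ->]].
(* The finite term is moved across so that the inner infimum can be bounded element by element. *)
rewrite -leeBlDl//; apply: le_ereal_inf_tmp => _ [nu [gam [nu0 [c3gam ->]]]].
rewrite leeBlDl// -EFinD.
exact: (error_exponent_le alpha0 hm hk hA c3_ge0 nu0 c3gam).
Qed.
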